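(* Let $q\ge 2$ be an integer and let $w$ be a radial weight on $\mathbb{R}^q$. (i) If $w$ is approximable by a harmonic map on $\mathbb{R}^q$, then the weight function $w$ is equivalent to a log-tropical weight function. (ii) If $q$ is even, then $w$ is approximable by a harmonic map on $\mathbb{R}^q$ if and only if the weight function $w$ is equivalent to a log-tropical weight function.
   Context: A weight function $w:[0,+\infty)\to(0,+\infty)$ is a non-decreasing, continuous and unbounded function. A radial weight on $\mathbb{R}^q$ is the extension $w(y)=w(|y|)$, $y\in\mathbb{R}^q$, of a weight function, where $|\cdot|$ is the Euclidean norm; the same letter denotes the weight function and the radial weight. For functions $u,v:X\to(0,+\infty)$ on a set $X$, $u\asymp v$ (''$u$ and $v$ are equivalent'') means that there are constants $C_1,C_2>0$ with $C_1u(x)\le v(x)\le C_2u(x)$ for all $x\in X$. A radial weight $w$ on $\mathbb{R}^q$ is approximable by a harmonic map if there exist $m\in\mathbb{N}$ and a harmonic map $h=(h_1,\dots,h_m):\mathbb{R}^q\to\mathbb{R}^m$ (each $h_j$ is a harmonic function on $\mathbb{R}^q$) such that $|h(y)|\asymp w(y)$, $y\in\mathbb{R}^q$. A tropical power series on $\mathbb{R}$ is a function of the form $\Psi(x)=\sup_{j\in E}(b_j+jx)$, $x\in\mathbb{R}$, where $E\subset\mathbb{Z}_+=\{0,1,2,\dots\}$ is an arbitrary subset, $b_j\in\mathbb{R}$ for $j\in E$, and the supremum is finite for all $x\in\mathbb{R}$. A weight function $v:[0,+\infty)\to(0,+\infty)$ is log-tropical if $\Phi_v(x)=\log v(e^x)$,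 $x\in\mathbb{R}$, is a tropical power series. *)

(* Defs.v *)
From mathcomp Require Import all_boot all_order all_algebra.
From mathcomp Require Import all_classical all_reals all_analysis.

Set Implicit Arguments.
Unset Strict Implicit.
Unset Printing Implicit Defensive.

Import Order.TTheory GRing.Theory Num.Theory.
Import numFieldNormedType.Exports.
Local Open Scope classical_set_scope.
Local Open Scope ring_scope.

(* The library norm `|y| on 'rV[R]_q is the max norm (it induces the usual
   topology), hence this separate definition. *)
Definition euclid {R : realType} {q : nat} (y : 'rV[R]_q) : R :=
  Num.sqrt (\sum_i y ord0 i ^+ 2).

Definition equivalent {R : realType} {T : Type} (X : set T) (u v : T -> R) :
    Prop :=
  exists C1 C2 : R, [/\ 0 < C1, 0 < C2 &
    forall x, X x -> C1 * u x <= v x /\ v x <= C2 * u x].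

(* A function [0, +oo) -> (0, +oo) is represented by a map R -> R, whose values
   at negative arguments are irrelevant. *)
Definition weight {R : realType} (w : R -> R) : Prop :=
  [/\ forall t : R, 0 <= t -> 0 < w t,
      forall s t : R, 0 <= s -> s <= t -> w s <= w t,
      {within `[0, +oo[, continuous w} &
      forall M : R, exists2 t : R, 0 <= t & M < w t].

Definition radial {R : realType} (q : nat) (w : R -> R) : 'rV[R]_q -> R :=
  fun y => w (euclid y).

Definition partial {R : realType} {q : nat} (i : 'I_q) (f : 'rV[R]_q -> R) :
    'rV[R]_q -> R :=
  fun x => 'D_(delta_mx ord0 i) f x.

Definition has_partial {R : realType} {q : nat} (i : 'I_q)
    (f : 'rV[R]_q -> R) : Prop :=
  forall x, derivable f x (delta_mx ord0 i).

Definition class_C2 {R : realType} {q : nat} (f : 'rV[R]_q -> R) : Prop :=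
  [/\ continuous f,
      forall i, has_partial i f /\ continuous (partial i f) &
      forall i j, has_partial j (partial i f) /\
                  continuous (partial j (partial i f))].

Definition laplacian {R : realType} {q : nat} (f : 'rV[R]_q -> R) :
    'rV[R]_q -> R :=
  fun x => \sum_i partial i (partial i f) x.

Definition harmonic_fun {R : realType} {q : nat} (f : 'rV[R]_q -> R) : Prop :=
  class_C2 f /\ forall x, laplacian f x = 0.

Definition harmonic_map {R : realType} {q m : nat}
    (h : 'rV[R]_q -> 'rV[R]_m) : Prop :=
  forall j, harmonic_fun (fun y => h y ord0 j).

(* The equivalence with a positive function forces |h| > 0 everywhere. *)
Definition harmonic_approximable {R : realType} (q : nat) (w : R -> R) : Prop :=
  exists m : nat, (0 < m)%N /\
    exists h : 'rV[R]_q -> 'rV[R]_m,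
      harmonic_map h /\ equivalent setT (fun y => euclid (h y)) (radial w).

(* [has_sup] makes the supremum finite; it excludes only E = set0, whose
   supremum is -oo, and families unbounded at some x.  The values of b outside
   of E are unused. *)
Definition tropical_power_series {R : realType} (Psi : R -> R) : Prop :=
  exists (E : set nat) (b : nat -> R), forall x : R,
    let S : set R := [set b j + j%:R * x | j in E] in has_sup S /\ Psi x = sup S.

Definition log_tropical {R : realType} (v : R -> R) : Prop :=
  tropical_power_series (fun x => ln (v (expR x))).

Definition equivalent_to_log_tropical {R : realType} (w : R -> R) : Prop :=
  exists v : R -> R, [/\ weight v, log_tropical v & equivalent `[0, +oo[ w v].

(* Main.v *)
Require Import Defs.
From mathcomp Require Import all_boot all_order all_algebra.
From mathcomp Require Import all_classical all_reals all_analysis.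
From mathcomp Require Import ring lra zify.

(** Nothing below integrates over spheres: harmonic functions enter only through
    harmonic polynomials, the maximum principle and finite algebra.

    From a harmonic map to a log-tropical weight.  By Weierstrass approximation
    on a cube, the division of a polynomial by [r^2 - |x|^2] with harmonic
    remainder ([extendable_pol], from the Fischer decomposition), and the maximum
    principle, a harmonic map [h] is uniformly close on a ball to a harmonic
    polynomial map [u].  The Pizzetti functional
    [L_t p = sum_m c_m t^(2m) (Lap^m p)(0)] is the spherical mean of [p] in
    disguise.  It is positive ([pizzetti_ge0]), because [L_t p] is the value at 0
    of the harmonic polynomial that agrees with [p] on the sphere of radius [t];
    and the numbers [(Lap^m |u|^2)(0)] are nonnegative, because
    [Lap (u^2) = 2 |grad u|^2] for [u] harmonic.  Hence on each interval [(0, r]]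
    the square of [w] is comparable, with constants independent of [r], to a
    polynomial in [t^2] with nonnegative coefficients ([approximable_profile]).
    In such a sum the median term at [r] yields an integer [j] such that
    [w t / t^j >= c * w r / r^j] for all [t] ([median_index],
    [approximable_tangent]).  This says that in logarithmic coordinates [w] has,
    up to a constant, a supporting line of slope [j] at every point, so [w] is
    equivalent to [sup_j B_j t^j] where [B_j] is the infimum of [w t / t^j]
    ([monomial_hull]); the supremum is a log-tropical weight.

    From a log-tropical weight to a harmonic map, for even [q].  A log-tropical
    weight is comparable to [sup_j B_j t^j].  The lemma [peak_sequence] extracts
    a sequence of monomials [a_p t^(j_p)] such that at each [t] one of them
    realizes the supremum up to a factor 16 and the others decay geometrically
    with the distance of their positions to it.  Splitting the positions into
    residue classes modulo a large [M] makes one monomial dominate the sum of its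
    class, so that no cancellation can occur.  It remains to replace [t^j] by
    harmonic maps [H_j], with a number of components independent of [j], such
    that [|H_j x|] is comparable to [|x|^j] uniformly in [j] ([exists_blocks]).
    For [q = 2] these are the real and imaginary parts of [z^j].  Two more
    variables are added by applying the same splitting to the weight
    [(1 + t^2)^(n/2)] and using the products of powers of the new complex
    variable with blocks in the old variables: a product of harmonic functions of
    disjoint sets of variables is harmonic.  The resulting series converge
    locally uniformly, and a locally uniform limit of harmonic polynomials is
    harmonic ([converges_harmonic]), again by positivity of the Pizzetti
    functional, which bounds the gradient ([partial_bound]). *)

Set Implicit Arguments.
Unset Strict Implicit.
Unset Printing Implicit Defensive.

Import Order.TTheory GRing.Theory Num.Theory.
Import numFieldNormedType.Exports.
Local Open Scope classical_set_scope.
Local Open Scope ring_scope.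

(** * Polynomial functions and the Laplacian *)

Section PolynomialFunctions.
Context {R : realType} {q : nat}.
Local Notation V := 'rV[R]_q.
Implicit Types (f g : V -> R) (x : V).

(** Polynomials are kept as functions, so that the derivatives of the statement
    act on them directly.  The index is a degree of homogeneity: the zero function
    has every degree. *)
Inductive homog_fun : nat -> (V -> R) -> Prop :=
| hom_cst c : homog_fun 0 (fun=> c)
| hom_coord i : homog_fun 1 (fun x => x ord0 i)
| hom_zero k : homog_fun k (fun=> 0)
| homD k f g : homog_fun k f -> homog_fun k g -> homog_fun k (fun x => f x + g x)
| homM k l f g : homog_fun k f -> homog_fun l g -> homog_fun (k + l) (fun x => f x * g x).

Inductive poly_fun : (V -> R) -> Prop :=
| pol_hom k f : homog_fun k f -> poly_fun f
| polD f g : poly_fun f -> poly_fun g -> poly_fun (fun x => f x + g x).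

Lemma partial_cst i c : partial i (fun=> c : R) = (fun=> 0) :> (V -> R).
Proof. by apply/funext => x; rewrite /partial derive_cst. Qed.

Lemma partial_coord i j :
  partial i (fun x : V => x ord0 j) = fun=> (i == j)%:R.
Proof.
apply/funext => x; rewrite /partial.
have := derive_mx (@derivable_id _ V x (delta_mx ord0 i)); rewrite derive_id.
by move=> /matrixP/(_ ord0 j); rewrite !mxE eqxx /= eq_sym => ->.
Qed.

Lemma partialD i f g :
  (forall x, differentiable f x) -> (forall x, differentiable g x) ->
  partial i (fun x => f x + g x) = fun x => partial i f x + partial i g x.
Proof.
move=> df dg; apply/funext => x; rewrite /partial.
by rewrite (deriveD (f := f) (g := g)) //; apply: diff_derivable.
Qed.

Lemma partialM i f g :
  (forall x, differentiable f x) -> (forall x, differentiable g x) ->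
  partial i (fun x => f x * g x) =
  fun x => f x * partial i g x + g x * partial i f x.
Proof.
move=> df dg; apply/funext => x; rewrite /partial.
by rewrite (deriveM (f := f) (g := g)) //; apply: diff_derivable.
Qed.

Lemma partial_shift i f a :
  partial i (fun x => f (x + a)) = fun x => partial i f (x + a).
Proof.
apply/funext => x; rewrite /partial /derive.
suff -> : (fun h : R => h^-1 *: (((fun x0 => f (x0 + a)) \o shift x)
    (h *: delta_mx ord0 i) - f (x + a))) =
  (fun h : R => h^-1 *: ((f \o shift (x + a)) (h *: delta_mx ord0 i) - f (x + a))).
  by [].
by apply/funext => h /=; rewrite addrA.
Qed.

Lemma hom_differentiable k f : homog_fun k f -> forall x, differentiable f x.
Proof.
elim=> [c|i|l|l g h _ IH1 _ IH2|l m g h _ IH1 _ IH2] x.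
- exact: differentiable_cst.
- exact: differentiable_coord.
- exact: differentiable_cst.
- exact: (differentiableD (IH1 x) (IH2 x)).
- exact: (differentiableM (IH1 x) (IH2 x)).
Qed.

Lemma pol_differentiable f : poly_fun f -> forall x, differentiable f x.
Proof.
elim=> [k g /hom_differentiable//|g h _ IH1 _ IH2 x].
exact: (differentiableD (IH1 x) (IH2 x)).
Qed.

Lemma pol_continuous f : poly_fun f -> continuous f.
Proof. by move=> pf x; apply/differentiable_continuous/pol_differentiable. Qed.

Lemma pol_derivable f : poly_fun f -> forall x v, derivable f x v.
Proof. by move=> pf x v; apply/diff_derivable/pol_differentiable. Qed.

Lemma hom_partial0 i f : homog_fun 0 f -> partial i f = fun=> 0.
Proof.
suff H k : homog_fun k f -> k = 0%N -> partial i f = fun=> 0 by move=> /H; apply.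
elim=> //.
- by move=> c _; rewrite partial_cst.
- by move=> l _; rewrite partial_cst.
- move=> l g h pg IH1 ph IH2 E.
  rewrite partialD; [|exact: hom_differentiable pg|exact: hom_differentiable ph].
  by rewrite IH1 // IH2 //; apply/funext => x; rewrite addr0.
- move=> l m g h pg IH1 ph IH2 E.
  rewrite partialM; [|exact: hom_differentiable pg|exact: hom_differentiable ph].
  rewrite IH1 ?IH2; [|lia|lia].
  by apply/funext => x; rewrite !mulr0 addr0.
Qed.

(** The truncated degree [k.-1] is harmless for [k = 0]: the derivative is then
    zero, and zero has every degree. *)
Lemma hom_partial k i f : homog_fun k f -> homog_fun k.-1 (partial i f).
Proof.
elim=> [c|j|l|l g h pg IH1 ph IH2|l m g h pg IH1 ph IH2].
- by rewrite partial_cst; apply: hom_zero.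
- by rewrite partial_coord; apply: hom_cst.
- by rewrite partial_cst; apply: hom_zero.
- rewrite partialD; [|exact: hom_differentiable pg|exact: hom_differentiable ph].
  exact: homD.
- rewrite partialM; [|exact: hom_differentiable pg|exact: hom_differentiable ph].
  apply: homD.
    case: m ph IH2 => [|m] ph IH2.
      rewrite (hom_partial0 i ph) (_ : (fun _ => _) = fun=> 0); first exact: hom_zero.
      by apply/funext => x; rewrite mulr0.
    by rewrite addnS /=; apply: homM.
  case: l pg IH1 => [|l] pg IH1.
    rewrite (hom_partial0 i pg) (_ : (fun _ => _) = fun=> 0); first exact: hom_zero.
    by apply/funext => x; rewrite mulr0.
  by rewrite addSn addnC /=; apply: homM.
Qed.

Lemma pol_cst c : poly_fun (fun=> c).
Proof. exact: (pol_hom (hom_cst c)). Qed.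

Lemma pol_coord i : poly_fun (fun x => x ord0 i).
Proof. exact: (pol_hom (hom_coord i)). Qed.

Lemma polM f g : poly_fun f -> poly_fun g -> poly_fun (fun x => f x * g x).
Proof.
elim=> [k {}f hf|f1 f2 p1 IH1 p2 IH2] pg.
  elim: pg => [l {}g hg|g1 g2 p1 IH1 p2 IH2]; first exact: pol_hom (homM hf hg).
  rewrite (_ : (fun _ => _) = fun x => f x * g1 x + f x * g2 x); first exact: polD.
  by apply/funext => x; rewrite mulrDr.
rewrite (_ : (fun _ => _) = fun x => f1 x * g x + f2 x * g x).
  by apply: polD; [apply: IH1|apply: IH2].
by apply/funext => x; rewrite mulrDl.
Qed.

Lemma polZ c f : poly_fun f -> poly_fun (fun x => c * f x).
Proof. exact/polM/pol_cst. Qed.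

Lemma polB f g : poly_fun f -> poly_fun g -> poly_fun (fun x => f x - g x).
Proof.
move=> pf pg; rewrite (_ : (fun _ => _) = fun x => f x + -1 * g x).
  exact/polD/polZ.
by apply/funext => x; rewrite mulN1r.
Qed.

Lemma pol_sum (I : Type) (r : seq I) (P : pred I) (F : I -> V -> R) :
  (forall i, P i -> poly_fun (F i)) -> poly_fun (fun x => \sum_(i <- r | P i) F i x).
Proof.
move=> pF; elim: r => [|i r IH].
  by rewrite (_ : (fun _ => _) = fun=> 0); [exact: pol_cst|
    apply/funext => x; rewrite big_nil].
case: (boolP (P i)) => Pi.
  rewrite (_ : (fun _ => _) = fun x => F i x + \sum_(j <- r | P j) F j x).
    by apply: polD => //; apply: pF.
  by apply/funext => x; rewrite big_cons Pi.
by under eq_fun do rewrite big_cons (negbTE Pi).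
Qed.

Lemma pol_exp f n : poly_fun f -> poly_fun (fun x => f x ^+ n).
Proof.
move=> pf; elim: n => [|n IH].
  by under eq_fun do rewrite expr0; exact: pol_cst.
by under eq_fun do rewrite exprS; exact: polM.
Qed.

Lemma pol_partialD i f g : poly_fun f -> poly_fun g ->
  partial i (fun x => f x + g x) = fun x => partial i f x + partial i g x.
Proof. by move=> pf pg; apply: partialD; apply: pol_differentiable. Qed.

Lemma pol_partialM i f g : poly_fun f -> poly_fun g ->
  partial i (fun x => f x * g x) =
  fun x => f x * partial i g x + g x * partial i f x.
Proof. by move=> pf pg; apply: partialM; apply: pol_differentiable. Qed.

Lemma pol_partialZ i c f : poly_fun f ->
  partial i (fun x => c * f x) = fun x => c * partial i f x.
Proof.
move=> pf; rewrite pol_partialM //; last exact: pol_cst.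
by rewrite partial_cst; apply/funext => x; rewrite mulr0 addr0.
Qed.

Lemma pol_partialB i f g : poly_fun f -> poly_fun g ->
  partial i (fun x => f x - g x) = fun x => partial i f x - partial i g x.
Proof.
move=> pf pg; under eq_fun do rewrite -mulN1r.
rewrite pol_partialD //; last exact: polZ.
by rewrite pol_partialZ //; apply/funext => x; rewrite mulN1r.
Qed.

Lemma pol_partial i f : poly_fun f -> poly_fun (partial i f).
Proof.
elim=> [k g hg|g h pg IH1 ph IH2]; first exact: pol_hom (hom_partial i hg).
by rewrite pol_partialD //; apply: polD.
Qed.

Lemma pol_partial_sum (I : Type) (r : seq I) (P : pred I) i (F : I -> V -> R) :
  (forall k, P k -> poly_fun (F k)) ->
  partial i (fun x => \sum_(k <- r | P k) F k x) =
  fun x => \sum_(k <- r | P k) partial i (F k) x.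
Proof.
move=> pF; elim: r => [|k r IH].
  under eq_fun do rewrite big_nil.
  by rewrite partial_cst; apply/funext => x; rewrite big_nil.
case: (boolP (P k)) => Pk.
  under eq_fun do rewrite big_cons Pk.
  rewrite pol_partialD; [|exact: pF|exact: pol_sum].
  by rewrite IH; apply/funext => x; rewrite big_cons Pk.
under eq_fun do rewrite big_cons (negbTE Pk).
by rewrite IH; apply/funext => x; rewrite big_cons (negbTE Pk).
Qed.

(** Proved by induction on the construction of [f], which avoids the theorem of
    Schwarz. *)
Lemma partialC i j f : poly_fun f ->
  partial i (partial j f) = partial j (partial i f).
Proof.
have D g h : poly_fun g -> poly_fun h ->
    partial i (partial j g) = partial j (partial i g) ->
    partial i (partial j h) = partial j (partial i h) ->
    partial i (partial j (fun x => g x + h x)) =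
    partial j (partial i (fun x => g x + h x)).
  move=> pg ph Eg Eh; rewrite !(pol_partialD _ pg ph).
  rewrite (pol_partialD i (pol_partial j pg) (pol_partial j ph)).
  by rewrite (pol_partialD j (pol_partial i pg) (pol_partial i ph)) Eg Eh.
elim=> [k g|g h pg IH1 ph IH2]; last exact: D.
elim=> {k g} [c|l|l|l g h pg IH1 ph IH2|l m g h /pol_hom pg IH1 /pol_hom ph IH2].
- by rewrite !partial_cst.
- by rewrite !partial_coord !partial_cst.
- by rewrite !partial_cst.
- exact: (D _ _ (pol_hom pg) (pol_hom ph) IH1 IH2).
- have [pi pj] := (pol_partial i pg, pol_partial j pg).
  have [ri rj] := (pol_partial i ph, pol_partial j ph).
  rewrite !(pol_partialM _ pg ph).
  rewrite (pol_partialD i (polM pg rj) (polM ph pj)).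
  rewrite (pol_partialD j (polM pg ri) (polM ph pi)).
  rewrite (pol_partialM i pg rj) (pol_partialM i ph pj).
  rewrite (pol_partialM j pg ri) (pol_partialM j ph pi) IH1 IH2.
  apply/funext => x.
  move: (g x) (h x) (partial i g x) (partial j g x) (partial i h x) (partial j h x)
    (partial j (partial i g) x) (partial j (partial i h) x) => *; ring.
Qed.

Lemma euler_identity k f : homog_fun k f ->
  forall x, \sum_i x ord0 i * partial i f x = k%:R * f x.
Proof.
elim=> [c|j|l|l g h pg IH1 ph IH2|l m g h pg IH1 ph IH2] x.
- by rewrite mul0r big1 // => i _; rewrite partial_cst mulr0.
- rewrite (bigD1 j) //= big1 ?partial_coord; last first.
    by move=> i /negbTE ij; rewrite partial_coord ij mulr0.
  by rewrite eqxx addr0 mulr1 mul1r.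
- by rewrite mulr0 big1 // => i _; rewrite partial_cst mulr0.
- rewrite mulrDr -IH1 -IH2 -big_split /=; apply: eq_bigr => i _.
  by rewrite pol_partialD ?mulrDr //; apply: pol_hom; eassumption.
- rewrite natrD mulrDl [m%:R * _]mulrCA mulrA -IH1 -IH2 mulr_suml mulr_sumr -big_split /=.
  apply: eq_bigr => i _; rewrite (pol_partialM i (pol_hom pg) (pol_hom ph)).
  by move: (partial i g x) (partial i h x) => *; ring.
Qed.

Lemma pol_shift a f : poly_fun f -> poly_fun (fun x => f (x + a)).
Proof.
elim=> [k g|g h pg IH1 ph IH2]; last exact: polD.
elim=> [c|j|l|l ? ? _ IH1 _ IH2|l m ? ? _ IH1 _ IH2].
- exact: pol_cst.
- under eq_fun do rewrite mxE.
  exact: polD (pol_coord j) (pol_cst _).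
- exact: pol_cst.
- exact: polD.
- exact: polM.
Qed.

Lemma pol_laplacian f : poly_fun f -> poly_fun (laplacian f).
Proof. by move=> pf; apply: pol_sum => i _; do 2!apply: pol_partial. Qed.

Lemma hom_sum (I : Type) (r : seq I) k (F : I -> V -> R) :
  (forall i, homog_fun k (F i)) -> homog_fun k (fun x => \sum_(i <- r) F i x).
Proof.
move=> hF; elim: r => [|i r IH].
  by under eq_fun do rewrite big_nil; exact: hom_zero.
by under eq_fun do rewrite big_cons; exact: homD.
Qed.

Lemma hom_laplacian k f : homog_fun k f -> homog_fun k.-2 (laplacian f).
Proof. by move=> hf; apply: hom_sum => i; do 2!apply: hom_partial. Qed.

Lemma hom_laplacian_small k f : homog_fun k f -> (k < 2)%N -> laplacian f = fun=> 0.
Proof.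
move=> hf k2; apply/funext => x; apply: big1 => i _.
have := hom_partial i hf; rewrite (_ : k.-1 = 0)%N; last by lia.
by move=> /(hom_partial0 i) ->.
Qed.

Lemma laplacian_cst c : laplacian (fun=> c) = (fun=> 0) :> (V -> R).
Proof. exact: hom_laplacian_small (hom_cst c) _. Qed.

Lemma laplacianD f g : poly_fun f -> poly_fun g ->
  laplacian (fun x => f x + g x) = fun x => laplacian f x + laplacian g x.
Proof.
move=> pf pg; apply/funext => x; rewrite /laplacian -big_split /=.
apply: eq_bigr => i _; rewrite (pol_partialD i pf pg).
by rewrite (pol_partialD i (pol_partial i pf) (pol_partial i pg)).
Qed.

Lemma laplacianM f g : poly_fun f -> poly_fun g ->
  laplacian (fun x => f x * g x) = fun x =>
    f x * laplacian g x + g x * laplacian f x +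
    2 * \sum_i partial i f x * partial i g x.
Proof.
move=> pf pg; apply/funext => x; rewrite /laplacian !mulr_sumr -!big_split /=.
apply: eq_bigr => i _; rewrite pol_partialM //.
have [pi pj] := (pol_partial i pf, pol_partial i pg).
rewrite pol_partialD; [|exact: polM..].
rewrite (pol_partialM i pf pj) (pol_partialM i pg pi).
move: (f x) (g x) (partial i f x) (partial i g x) (partial i (partial i f) x)
  (partial i (partial i g) x) => *; ring.
Qed.

Lemma laplacianZ c f : poly_fun f ->
  laplacian (fun x => c * f x) = fun x => c * laplacian f x.
Proof.
move=> pf; apply/funext => x; rewrite /laplacian mulr_sumr; apply: eq_bigr => i _.
by rewrite !pol_partialZ //; apply: pol_partial.
Qed.

Lemma laplacianB f g : poly_fun f -> poly_fun g ->
  laplacian (fun x => f x - g x) = fun x => laplacian f x - laplacian g x.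
Proof.
move=> pf pg; under eq_fun do rewrite -mulN1r.
rewrite laplacianD //; last exact: polZ.
by rewrite laplacianZ //; apply/funext => x; rewrite mulN1r.
Qed.

Lemma laplacian_sum (I : Type) (r : seq I) (P : pred I) (F : I -> V -> R) :
  (forall k, P k -> poly_fun (F k)) ->
  laplacian (fun x => \sum_(k <- r | P k) F k x) =
  fun x => \sum_(k <- r | P k) laplacian (F k) x.
Proof.
move=> pF; elim: r => [|k r IH].
  under eq_fun do rewrite big_nil.
  by rewrite laplacian_cst; apply/funext => x; rewrite big_nil.
case: (boolP (P k)) => Pk.
  under eq_fun do rewrite big_cons Pk.
  rewrite laplacianD; [|exact: pF|exact: pol_sum].
  by rewrite IH; apply/funext => x; rewrite big_cons Pk.
under eq_fun do rewrite big_cons (negbTE Pk).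
by rewrite IH; apply/funext => x; rewrite big_cons (negbTE Pk).
Qed.

Lemma laplacian_partial i f : poly_fun f -> laplacian (partial i f) = partial i (laplacian f).
Proof.
move=> pf; rewrite [in RHS]/laplacian pol_partial_sum; last first.
  by move=> j _; do 2!apply: pol_partial.
apply/funext => x; apply: eq_bigr => j _.
by rewrite (partialC j i pf) (partialC j i (pol_partial j pf)).
Qed.

Lemma laplacian_shift a f :
  laplacian (fun x => f (x + a)) = fun x => laplacian f (x + a).
Proof.
apply/funext => x; apply: eq_bigr => i _.
by rewrite partial_shift partial_shift.
Qed.

Lemma pol_class_C2 f : poly_fun f -> class_C2 f.
Proof.
move=> pf; split.
- exact: pol_continuous.
- move=> i; split; last exact/pol_continuous/pol_partial.
  by move=> x; apply: pol_derivable.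
- move=> i j; split; last by apply/pol_continuous; do 2!apply: pol_partial.
  by move=> x; apply/pol_derivable/pol_partial.
Qed.

Definition sqnorm x : R := \sum_i x ord0 i ^+ 2.

Lemma hom_sqnorm : homog_fun 2 sqnorm.
Proof.
apply: hom_sum => i; under eq_fun do rewrite expr2.
exact: (homM (hom_coord i) (hom_coord i)).
Qed.

Lemma pol_sqnorm : poly_fun sqnorm.
Proof. exact: pol_hom hom_sqnorm. Qed.

Lemma partial_sqnorm i : partial i sqnorm = fun x => 2 * x ord0 i.
Proof.
rewrite /sqnorm pol_partial_sum; last by move=> j _; apply/pol_exp/pol_coord.
apply/funext => x; rewrite (bigD1 i) //= big1 ?addr0 => [|j /negbTE ji].
  under eq_fun do rewrite expr2.
  rewrite pol_partialM; [|exact: pol_coord..].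
  by rewrite partial_coord eqxx mulr1 mulr_natl mulr2n.
under eq_fun do rewrite expr2.
rewrite pol_partialM; [|exact: pol_coord..].
by rewrite partial_coord eq_sym ji mulr0 addr0.
Qed.

Lemma laplacian_sqnorm : laplacian sqnorm = fun=> 2 * q%:R.
Proof.
apply/funext => x; rewrite /laplacian (eq_bigr (fun=> 2)).
  by rewrite sumr_const card_ord mulr_natr.
move=> i _; rewrite partial_sqnorm pol_partialZ; last exact: pol_coord.
by rewrite partial_coord eqxx mulr1.
Qed.

(** The commutation relation behind the Fischer decomposition and the Pizzetti
    coefficients; the middle term of the product rule is an Euler identity. *)
Lemma laplacian_sqnormM k f : homog_fun k f ->
  laplacian (fun x => sqnorm x * f x) =
  fun x => sqnorm x * laplacian f x + (4 * k + 2 * q)%:R * f x.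
Proof.
move=> hf; rewrite laplacianM; [|exact: pol_sqnorm|exact: pol_hom hf].
apply/funext => x; rewrite laplacian_sqnorm -addrA; congr (_ + _).
under eq_bigr do rewrite partial_sqnorm -mulrA.
rewrite -mulr_sumr (euler_identity hf) natrD !natrM.
move: (f x) => *; ring.
Qed.

End PolynomialFunctions.

(** * The maximum principle *)

Section MaximumPrinciple.
Context {R : realType}.

Lemma is_derive_line {V : normedModType R} (f : V -> R) (a v : V) (t : R) :
  derivable f (t *: v + a) v ->
  is_derive t 1 (fun s : R => f (s *: v + a)) ('D_v f (t *: v + a)).
Proof.
move=> df.
have E : (fun h : R => h^-1 *: (((fun s => f (s *: v + a)) \o shift t) (h *: 1) -
            f (t *: v + a))) =
         (fun h : R => h^-1 *: ((f \o shift (t *: v + a)) (h *: v) - f (t *: v + a))).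
  by apply/funext => h /=; rewrite [h *: 1]mulr1 scalerDl addrA.
by split; rewrite /derivable /derive E.
Qed.

(** If the second derivative were positive, the first one would vanish at [a] and
    be positive just after, so that [f] would increase along [v]. *)
Lemma second_derivative_at_max {V : normedModType R} (f : V -> R) (a v : V) (e : R) :
  0 < e ->
  (forall x, derivable f x v) -> derivable (fun x => 'D_v f x) a v ->
  (forall t : R, `|t| < e -> f (t *: v + a) <= f a) ->
  'D_v (fun x => 'D_v f x) a <= 0.
Proof.
move=> e0 df d2f fmax; rewrite leNgt; apply/negP => D0.
pose g (t : R) := 'D_v f (t *: v + a).
have dphi (t : R) : is_derive t 1 (fun s : R => f (s *: v + a)) (g t).
  exact: (is_derive_line (df (t *: v + a))).
have oN : (0 : R) \in `]-e, e[%R by rewrite in_itv /= oppr_lt0 e0.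
have [_ g0] : is_derive (0 : R) 1 (fun s : R => f (s *: v + a)) 0.
  apply: (@derive1_at_max R _ (- e) e 0 _ _ oN).
  - by rewrite ge0_cp // ltW.
  - by move=> t _; case: (dphi t).
  - by move=> t; rewrite in_itv /= -ltr_norml => /fmax; rewrite scale0r add0r.
have [_ g00] := dphi 0; rewrite g00 in g0.
have dg : is_derive (0 : R) 1 g ('D_v (fun x => 'D_v f x) a).
  have := @is_derive_line _ (fun x => 'D_v f x) a v 0.
  by rewrite scale0r add0r => /(_ d2f).
set D := 'D_v _ a in D0 dg.
have : (h^-1 *: (g (h *: 1 + 0) - g 0)) @[h --> 0^'] --> D.
  by case: dg => dg <-; exact: dg.
move=> /cvgrPdist_lt /(_ D D0) [d /= d0 H].
(* On the whole of [(0, h]] the derivative [g] is positive, and [h] is still in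
   the range where [f] is at most [f a]. *)
pose h := Num.min d e / 2.
have h0 : 0 < h by rewrite divr_gt0 // lt_min d0.
have hd : h < d.
  rewrite /h ltr_pdivrMr //; have : Num.min d e <= d by rewrite ge_min lexx.
  lra.
have he : h < e.
  rewrite /h ltr_pdivrMr //; have : Num.min d e <= e by rewrite ge_min lexx orbT.
  lra.
have gpos t : 0 < t -> t <= h -> 0 < g t.
  move=> t0 th; have := H t; rewrite /= sub0r normrN (gtr0_norm t0).
  move=> /(_ (le_lt_trans th hd) (lt0r_neq0 t0)).
  rewrite addr0 [t *: 1]mulr1 g0 subr0 => /(le_lt_trans (ler_norm _)).
  rewrite ltrBlDr -ltrBlDl subrr => /= .
  by rewrite pmulr_rgt0 // invr_gt0.
have [c + ] := MVT h0 (fun x _ => dphi x)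
  (derivable_within_continuous (fun x _ => @ex_derive _ _ _ _ _ _ _ (dphi x))).
rewrite in_itv /= => /andP[c0 ch] E.
have := fmax h; rewrite (gtr0_norm h0) => /(_ he).
rewrite -subr_le0; move: E; rewrite scale0r add0r => ->.
by rewrite leNgt subr0 pmulr_rgt0 ?h0 // gpos // ltW.
Qed.

Lemma continuous_add {T : topologicalType} (f g : T -> R) :
  continuous f -> continuous g -> continuous (fun x => f x + g x).
Proof. by move=> cf cg x; exact: (cvgD (cf x) (cg x)). Qed.

Lemma line_continuous {V : normedModType R} (a v : V) :
  continuous (fun t : R => t *: v + a).
Proof.
by move=> t; apply: cvgD; [apply: scalel_continuous|exact: cvg_cst].
Qed.

Section Ball.
Context {q : nat}.
Local Notation V := 'rV[R]_q.

Lemma sqnorm_ge0 (x : V) : 0 <= sqnorm x.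
Proof. by apply: sumr_ge0 => i _; apply: sqr_ge0. Qed.

Lemma coord_sqr_le (x : V) i : x ord0 i ^+ 2 <= sqnorm x.
Proof.
rewrite /sqnorm (bigD1 i) //= lerDl; apply: sumr_ge0 => j _; exact: sqr_ge0.
Qed.

Lemma norm_le_sqnorm (x : V) (r : R) : 0 <= r -> sqnorm x <= r ^+ 2 -> `|x| <= r.
Proof.
move=> r0 H; rewrite /Num.Def.normr /= mx_normrE; apply: bigmax_le => //= -[i j] _ /=.
rewrite ord1 -(@ler_pXn2r _ 2) ?nnegrE // real_normK ?num_real //.
exact: le_trans (coord_sqr_le _ _) H.
Qed.

Lemma compact_sqball (rho : R) : compact [set x : V | sqnorm x <= rho].
Proof.
apply: bounded_closed_compact.
  exists (Num.sqrt `|rho|); split; first exact: num_real.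
  move=> y ry x /= xr; apply: (le_trans _ (ltW ry)).
  apply: norm_le_sqnorm; first exact: sqrtr_ge0.
  by rewrite sqr_sqrtr ?normr_ge0 // (le_trans xr) // ler_norm.
have -> : [set x : V | sqnorm x <= rho] = sqnorm @^-1` [set x | x <= rho] by [].
apply: closed_comp; last exact: closed_le.
by move=> x _; apply: pol_continuous; exact: pol_sqnorm.
Qed.

(** The function [f + d * |x|^2] has positive Laplacian, so its maximum over the
    ball cannot be interior, where all second derivatives along the axes are
    nonpositive; then [d] tends to 0. *)
Lemma maximum_principle (f : V -> R) (rho M : R) : (0 < q)%N ->
  class_C2 f -> (forall x, laplacian f x = 0) ->
  (forall x, sqnorm x = rho -> f x <= M) ->
  forall x, sqnorm x <= rho -> f x <= M.
Proof.
move=> q0 [cf df d2f] lf fM x xr.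
have H d : 0 < d -> f x + d * sqnorm x <= M + d * rho.
  move=> d0; pose g y := f y + d * sqnorm y.
  have pS : poly_fun (fun y : V => d * sqnorm y) by exact/polZ/pol_sqnorm.
  have cg : continuous g.
    exact: (continuous_add cf (pol_continuous pS)).
  have [c] := EVT_max_rV (ex_intro _ x xr) (@compact_sqball rho)
    (continuous_subspaceT cg).
  rewrite inE /= => cr cmax.
  have gx : g x <= g c by apply: cmax; rewrite inE.
  apply: le_trans gx _; move: cr; rewrite le_eqVlt => /predU1P[cr|cr].
    by rewrite /g cr lerD2r fM.
  exfalso.
  have pg i : partial i g = fun y => partial i f y + partial i (fun y => d * sqnorm y) y.
    apply/funext => y; rewrite /partial (deriveD (f := f)) //.
      by case: (df i) => + _; apply.
    exact: pol_derivable.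
  have ppg i : partial i (partial i g) =
    fun y => partial i (partial i f) y + partial i (partial i (fun y => d * sqnorm y)) y.
    apply/funext => y; rewrite pg /partial (deriveD (f := partial i f)) //.
      by case: (d2f i i) => + _; apply.
    exact/pol_derivable/pol_partial.
  have lg : laplacian g c = d * (2 * q%:R).
    have -> : laplacian g c = laplacian f c + laplacian (fun y => d * sqnorm y) c.
      by rewrite /laplacian -big_split; apply: eq_bigr => i _; rewrite ppg.
    by rewrite lf add0r (laplacianZ d pol_sqnorm) laplacian_sqnorm.
  have : laplacian g c <= 0.
    apply: sumr_le0 => i _.
    have cs : continuous (fun t : R => sqnorm (t *: (delta_mx ord0 i : V) + c)).
      move=> t; apply: (@continuous_comp _ _ _ (fun t : R => t *: delta_mx ord0 i + c) sqnorm).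
        exact: line_continuous.
      by apply: pol_continuous; exact: pol_sqnorm.
    have : \forall t \near (0 : R), sqnorm (t *: (delta_mx ord0 i : V) + c) < rho.
      have := cs 0 [set y | y < rho]; apply; apply: lt_nbhsl.
      by rewrite scale0r add0r.
    move=> [e /= e0 He].
    apply: (second_derivative_at_max e0).
    - move=> y; rewrite /g; apply: (derivableD (f := f)); last exact: pol_derivable.
      by case: (df i) => + _; apply.
    - rewrite -/(partial i g) pg; apply: (derivableD (f := partial i f)).
        by case: (d2f i i) => + _; apply.
      exact/pol_derivable/pol_partial.
    - move=> t te; apply: cmax; rewrite inE /=; apply/ltW/He => /=.
      by rewrite sub0r normrN.
  rewrite lg leNgt => /negP; apply.
  by rewrite mulr_gt0 // mulr_gt0 // ltr0n.
apply/ler_addgt0Pr => e e0.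
have r1 : 0 < rho + 1 by have := le_trans (sqnorm_ge0 x) xr; lra.
have := H (e / (rho + 1)) (divr_gt0 e0 r1).
have : 0 <= e / (rho + 1) * sqnorm x.
  by rewrite mulr_ge0 ?sqnorm_ge0 // ltW // divr_gt0.
have : e / (rho + 1) * rho <= e.
  by rewrite -mulrA ger_pMr // mulrC ler_pdivrMr //; lra.
lra.
Qed.

End Ball.
End MaximumPrinciple.

(** * Fischer decomposition and the Pizzetti functional *)

Section Pizzetti.
Context {R : realType} {q : nat}.
Local Notation V := 'rV[R]_q.
Implicit Types (f g s : V -> R) (x : V) (l m N : nat).

Lemma hom_sqnormX l g i : homog_fun l g -> homog_fun (i * 2 + l) (fun x => sqnorm x ^+ i * g x).
Proof.
move=> hg; apply: homM hg; elim: i => [|i IHi].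
  by under eq_fun do rewrite expr0; exact: hom_cst.
by under eq_fun do rewrite exprS; exact: homM hom_sqnorm IHi.
Qed.

(** By [i + 1] applications of [laplacian_sqnormM]; the constant is
    [2 (i + 1) (2 i + 2 l + q)]. *)
Lemma laplacian_sqnormX l f i : (0 < q)%N -> homog_fun l f -> laplacian f = (fun=> 0) ->
  exists2 c : R, 0 < c &
    laplacian (fun x => sqnorm x ^+ i.+1 * f x) = fun x => c * (sqnorm x ^+ i * f x).
Proof.
move=> q0 hf lf; elim: i => [|i [c c0 IH]].
  exists (4 * l + 2 * q)%:R; first by rewrite ltr0n; lia.
  under eq_fun do rewrite expr1.
  rewrite (laplacian_sqnormM hf); apply/funext => x.
  by rewrite lf mulr0 add0r expr0 mul1r.
exists (c + (4 * (i.+1 * 2 + l) + 2 * q)%:R).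
  by rewrite ltr_wpDr.
under eq_fun do rewrite exprS -mulrA.
rewrite (laplacian_sqnormM (hom_sqnormX i.+1 hf)) IH; apply/funext => x.
rewrite [RHS]mulrDl; congr (_ + _).
by rewrite exprS -mulrA mulrCA.
Qed.

(** Finite sums of functions [|x|^(2 i) g] with [g] harmonic and homogeneous, of
    total degree [k]; by [fischer_decomposition] these are all homogeneous
    polynomials. *)
Inductive fischer : nat -> (V -> R) -> Prop :=
| fischer_zero k : fischer k (fun=> 0)
| fischer_add i l f g : homog_fun l g -> laplacian g = (fun=> 0) ->
    fischer (i * 2 + l) f ->
    fischer (i * 2 + l) (fun x => f x + sqnorm x ^+ i * g x).

Lemma fischer_hom k f : fischer k f -> homog_fun k f.
Proof.
elim=> [l|i l {}f g hg _ _ IH]; first exact: hom_zero.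
by apply: homD => //; exact: hom_sqnormX.
Qed.

(** On the summand [|x|^(2 i) g] a preimage under the Laplacian is a multiple of
    [|x|^(2 i + 2) g]. *)
Lemma fischer_laplacian_preimage k f : (0 < q)%N -> fischer k f ->
  exists2 s, fischer k.+2 s & laplacian s = f.
Proof.
move=> q0; elim=> [l|i l {}f g hg lg _ [s fs ls]].
  by exists (fun=> 0); [exact: fischer_zero|rewrite laplacian_cst].
have [c c0 Ec] := laplacian_sqnormX i q0 hg lg.
have hcg : homog_fun l (fun x => c^-1 * g x) by exact: homM (hom_cst _) hg.
have lcg : laplacian (fun x => c^-1 * g x) = fun=> 0.
  rewrite laplacianZ; last exact: pol_hom hg.
  by apply/funext => x; rewrite lg mulr0.
exists (fun x => s x + sqnorm x ^+ i.+1 * (c^-1 * g x)).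
  have := @fischer_add i.+1 l s _ hcg lcg.
  by rewrite mulSn !addSn add0n; apply.
rewrite laplacianD; first last.
- exact: pol_hom (hom_sqnormX i.+1 hcg).
- exact: pol_hom (fischer_hom fs).
apply/funext => x; rewrite ls; congr (_ + _).
under eq_fun do rewrite mulrCA.
rewrite laplacianZ; last exact: pol_hom (hom_sqnormX i.+1 hg).
by rewrite Ec mulrA mulVf ?mul1r // gt_eqF.
Qed.

(** Strong induction on the degree: the Laplacian of [f], of degree [k - 2],
    decomposes, hence is the Laplacian of some [s] that decomposes too, and
    [f - s] is harmonic. *)
Lemma fischer_decomposition k f : (0 < q)%N -> homog_fun k f -> fischer k f.
Proof.
move=> q0; have [n] := ubnP k; elim: n k f => // n IH k f kn hf.
have harm g : homog_fun k g -> laplacian g = (fun=> 0) -> forall s, fischer k s ->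
    fischer k (fun x => s x + g x).
  move=> hg lg s fs; rewrite (_ : (fun _ => _) = fun x => s x + sqnorm x ^+ 0 * g x).
    exact: (@fischer_add 0 k).
  by apply/funext => x; rewrite expr0 mul1r.
case: (ltnP k 2) => k2.
  rewrite (_ : f = fun x => 0 + f x); last by apply/funext => x; rewrite add0r.
  by apply: harm => //; [exact: hom_laplacian_small hf k2|exact: fischer_zero].
have [s fs ls] : exists2 s, fischer k.-2.+2 s & laplacian s = laplacian f.
  by apply: fischer_laplacian_preimage => //; apply: IH; [lia|exact: hom_laplacian].
have Ek : k.-2.+2 = k by lia.
rewrite Ek in fs.
rewrite (_ : f = fun x => s x + (f x - s x)); last first.
  by apply/funext => x; rewrite addrC subrK.
have hs := fischer_hom fs.
apply: harm fs.
  under eq_fun do rewrite -mulN1r.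
  exact: homD hf (homM (hom_cst _) hs).
rewrite laplacianB; [|exact: pol_hom hf|exact: pol_hom hs].
by rewrite ls; apply/funext => x; rewrite subrr.
Qed.

(** [u] is the harmonic extension into the ball of the values of [f] on the sphere
    [|x|^2 = rho]. *)
Definition extendable (rho : R) f := exists u s,
  [/\ poly_fun u, poly_fun s, laplacian u = (fun=> 0) &
      f = fun x => u x + (rho - sqnorm x) * s x].

Lemma extendableD rho f g : extendable rho f -> extendable rho g ->
  extendable rho (fun x => f x + g x).
Proof.
move=> [u [s [pu ps lu ->]]] [v [t [pv pt lv ->]]].
exists (fun x => u x + v x), (fun x => s x + t x); split; [exact: polD..| |].
  by rewrite laplacianD // lu lv; apply/funext => x; rewrite addr0.
by apply/funext => x; rewrite mulrDr addrACA.
Qed.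

(** On a summand [|x|^(2 i) g] of the Fischer decomposition, replace one factor
    [|x|^2] after the other by [rho]. *)
Lemma extendable_pol rho f : (0 < q)%N -> poly_fun f -> extendable rho f.
Proof.
move=> q0; elim=> [k {}f hf|g h _ IH1 _ IH2]; last exact: extendableD.
elim: {k hf} (fischer_decomposition q0 hf) => [l|i l {}f g hg lg _ IH].
  exists (fun=> 0), (fun=> 0); split; [exact: pol_cst..|exact: laplacian_cst|].
  by apply/funext => x; rewrite mulr0 addr0.
apply: extendableD IH _.
have pg := pol_hom hg.
elim: i => [|i [u [s [pu ps lu E]]]].
  exists g, (fun=> 0); split => //; first exact: pol_cst.
  by apply/funext => x; rewrite expr0 mul1r mulr0 addr0.
exists (fun x => rho * u x), (fun x => rho * s x - sqnorm x ^+ i * g x); split.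
- exact: polZ.
- apply: polB; first exact: polZ.
  by apply: polM => //; exact/pol_exp/pol_sqnorm.
- by rewrite laplacianZ // lu; apply/funext => x; rewrite mulr0.
apply/funext => x; have Ex : sqnorm x ^+ i * g x = u x + (rho - sqnorm x) * s x.
  by have := congr1 (@^~ x) E.
rewrite exprS -mulrA Ex; move: (sqnorm x) (u x) (s x) => *; ring.
Qed.

Lemma hom_iter_laplacian k f m : homog_fun k f ->
  homog_fun (k - 2 * m) (iter m laplacian f) /\
  ((k < 2 * m)%N -> iter m laplacian f = fun=> 0).
Proof.
move=> hf; elim: m => [|m [IH1 IH2]]; first by rewrite muln0 subn0.
split=> [|km].
  by rewrite (_ : k - _ = (k - 2 * m).-2)%N; [exact: hom_laplacian|lia].
case: (ltnP k (2 * m)) => [/IH2 E|km']; first by rewrite iterS E laplacian_cst.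
by rewrite iterS (hom_laplacian_small IH1) //; lia.
Qed.

Lemma hom_at0 k f : homog_fun k f -> (0 < k)%N -> f 0 = 0.
Proof.
elim=> {k f} [//|i _|//|k f g _ IH1 _ IH2 k0|k l f g _ IH1 _ IH2 k0].
- by rewrite mxE.
- by rewrite IH1 // IH2 // addr0.
- case: (posnP k) => [k'|/IH1 ->]; last by rewrite mul0r.
  by rewrite IH2 ?mulr0 //; lia.
Qed.

Lemma pol_iter_laplacian m f : poly_fun f -> poly_fun (iter m laplacian f).
Proof. by move=> pf; elim: m => [//|m IH]; exact: pol_laplacian. Qed.

Lemma iter_laplacianD m f g : poly_fun f -> poly_fun g ->
  iter m laplacian (fun x => f x + g x) =
  fun x => iter m laplacian f x + iter m laplacian g x.
Proof.
move=> pf pg; elim: m => [//|m IH].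
by rewrite iterS IH laplacianD //; exact: pol_iter_laplacian.
Qed.

Lemma iter_laplacianZ m c f : poly_fun f ->
  iter m laplacian (fun x => c * f x) = fun x => c * iter m laplacian f x.
Proof.
move=> pf; elim: m => [//|m IH].
by rewrite iterS IH laplacianZ //; exact: pol_iter_laplacian.
Qed.

Lemma iter_laplacian_harmonic m f : laplacian f = (fun=> 0) ->
  iter m.+1 laplacian f = fun=> 0.
Proof. by move=> lf; elim: m => [//|m IH]; rewrite iterS IH laplacian_cst. Qed.

Lemma iter_laplacian_sum m (I : Type) (r : seq I) (P : pred I) (F : I -> V -> R) :
  (forall k, P k -> poly_fun (F k)) ->
  iter m laplacian (fun x => \sum_(k <- r | P k) F k x) =
  fun x => \sum_(k <- r | P k) iter m laplacian (F k) x.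
Proof.
move=> pF; elim: m => [//|m IH].
by rewrite iterS IH laplacian_sum // => k /pF; exact: pol_iter_laplacian.
Qed.

Lemma pol_nilpotent f : poly_fun f ->
  exists N0, forall N, (N0 <= N)%N -> iter N laplacian f = fun=> 0.
Proof.
elim=> [k g hg|g h pg [N1 H1] ph [N2 H2]].
  exists k.+1 => N kN; have [_] := hom_iter_laplacian N hg; apply.
  lia.
exists (maxn N1 N2) => N; rewrite geq_max => /andP[/H1 E1 /H2 E2].
by rewrite iter_laplacianD // E1 E2; apply/funext => x; rewrite addr0.
Qed.

Lemma iter_laplacian_sqnormM k f m : homog_fun k f ->
  iter m.+1 laplacian (fun x => sqnorm x * f x) = fun x =>
    sqnorm x * iter m.+1 laplacian f x +
    2 * m.+1%:R * (2 * k%:R - 2 * m%:R + q%:R) * iter m laplacian f x.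
Proof.
move=> hf; elim: m => [|m IH].
  rewrite /= (laplacian_sqnormM hf); apply/funext => x; congr (_ + _ * _).
  by rewrite natrD !natrM; ring.
have [hm zm] := hom_iter_laplacian m.+1 hf.
rewrite iterS IH laplacianD; first last.
- exact/polZ/pol_iter_laplacian/(pol_hom hf).
- exact: polM pol_sqnorm (pol_hom hm).
rewrite (laplacian_sqnormM hm) laplacianZ; last first.
  exact/pol_iter_laplacian/(pol_hom hf).
apply/funext => x; rewrite -!iterS -addrA; congr (_ + _).
case: (ltnP k (2 * m.+1)) => [/zm -> |km]; first by rewrite !mulr0 addr0.
rewrite natrD !natrM natrB // natrM -mulrDl; congr (_ * _).
ring.
Qed.

(** At the origin only the homogeneous part of degree [2 m] survives, which turns
    the factor of [iter_laplacian_sqnormM] into one that does not depend on the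
    degree. *)
Lemma iter_laplacian_sqnormM0 f m : poly_fun f ->
  iter m.+1 laplacian (fun x => sqnorm x * f x) 0 =
  2 * m.+1%:R * (2 * m%:R + q%:R) * iter m laplacian f 0.
Proof.
elim=> [k g hg|g h pg IH1 ph IH2].
  rewrite (iter_laplacian_sqnormM _ hg) /=.
  rewrite {1}(_ : sqnorm 0 = 0) ?mul0r ?add0r; last first.
    by rewrite /sqnorm big1 // => i _; rewrite mxE expr0n.
  have [hm zm] := hom_iter_laplacian m hg.
  case: (ltngtP k (2 * m)) => km.
  - by rewrite zm // !mulr0.
  - by rewrite (hom_at0 hm) ?mulr0 //; lia.
  - by congr (_ * _); rewrite km natrM; ring.
under eq_fun do rewrite mulrDr.
rewrite (iter_laplacianD m.+1 (polM pol_sqnorm pg) (polM pol_sqnorm ph)).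
by rewrite IH1 IH2 (iter_laplacianD m pg ph) [RHS]mulrDr.
Qed.

Fixpoint pizzetti_coef m : R :=
  if m is m'.+1 then pizzetti_coef m' / (2 * m'.+1%:R * (2 * m'%:R + q%:R)) else 1.

(** Pizzetti's formula: for large [N] this is the mean of [f] over the sphere
    [|x|^2 = rho]. *)
Definition pizzetti N (rho : R) f : R :=
  \sum_(m < N) pizzetti_coef m * rho ^+ m * iter m laplacian f 0.

Lemma pizzetti_coef_gt0 m : (0 < q)%N -> 0 < pizzetti_coef m.
Proof.
move=> q0; elim: m => [|m IH] //=.
by rewrite divr_gt0 // !mulr_gt0 // ltr_wpDl ?ltr0n // mulr_ge0.
Qed.

Lemma pizzettiD N rho f g : poly_fun f -> poly_fun g ->
  pizzetti N rho (fun x => f x + g x) = pizzetti N rho f + pizzetti N rho g.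
Proof.
move=> pf pg; rewrite /pizzetti -big_split /=; apply: eq_bigr => m _.
by rewrite iter_laplacianD // mulrDr.
Qed.

Lemma pizzettiZ N rho c f : poly_fun f ->
  pizzetti N rho (fun x => c * f x) = c * pizzetti N rho f.
Proof.
move=> pf; rewrite /pizzetti mulr_sumr; apply: eq_bigr => m _.
by rewrite iter_laplacianZ // mulrCA.
Qed.

Lemma pizzetti_harmonic N rho f : laplacian f = (fun=> 0) ->
  pizzetti N.+1 rho f = f 0.
Proof.
move=> lf; rewrite /pizzetti big_ord_recl big1 => [|m _]; last first.
  by rewrite lift0 iter_laplacian_harmonic // mulr0.
by rewrite /= !mul1r addr0.
Qed.

(** The coefficients are chosen so that this sum telescopes; the remaining term
    vanishes once [N] exceeds the degree of [s]. *)
Lemma pizzetti_vanish N rho s : (0 < q)%N -> poly_fun s ->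
  pizzetti N.+1 rho (fun x => (rho - sqnorm x) * s x) =
  pizzetti_coef N * rho ^+ N.+1 * iter N laplacian s 0.
Proof.
move=> q0 ps.
have E m : iter m laplacian (fun x => (rho - sqnorm x) * s x) 0 =
   rho * iter m laplacian s 0 -
   iter m laplacian (fun x => sqnorm x * s x) 0.
  under eq_fun do rewrite mulrBl -[- _]mulN1r.
  rewrite iter_laplacianD; [|exact: polZ|exact/polZ/polM/ps/pol_sqnorm].
  rewrite !iter_laplacianZ //; last exact/polM/ps/pol_sqnorm.
  by rewrite mulN1r.
elim: N => [|N IH].
  rewrite /pizzetti big_ord1 E /= /sqnorm.
  rewrite big1 => [|i _]; last by rewrite mxE expr0n.
  by rewrite mul0r subr0 expr0 expr1 !mul1r.
rewrite /pizzetti big_ord_recr -/(pizzetti _ _ _) IH E iter_laplacian_sqnormM0 //=.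
have d0 : 2 * N.+1%:R * (2 * N%:R + q%:R) != 0 :> R.
  by rewrite gt_eqF // !mulr_gt0 // ltr_wpDl ?ltr0n // mulr_ge0.
move: (iter N.+1 laplacian s 0) (iter N laplacian s 0) (pizzetti_coef N) d0 => a b c.
rewrite !exprS; move: (rho ^+ N) (2 * N.+1%:R * _) => e d d0.
by field.
Qed.

(** The functional kills the multiples of [rho - |x|^2], so it sends [f] to the
    value at 0 of its harmonic extension, which the maximum principle controls. *)
Lemma pizzetti_ge0 rho f : (0 < q)%N -> poly_fun f ->
  (forall x, sqnorm x = rho -> 0 <= f x) -> 0 <= rho ->
  exists N0, forall N, (N0 <= N)%N -> 0 <= pizzetti N rho f.
Proof.
move=> q0 pf f0 rho0; have [u [s [pu ps lu E]]] := extendable_pol rho q0 pf.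
have [N0 HN] := pol_nilpotent ps.
exists N0.+1 => -[//|N] /HN sN; rewrite E pizzettiD //; last first.
  exact: polM (polB (pol_cst _) pol_sqnorm) ps.
rewrite pizzetti_vanish // sN mulr0 addr0 pizzetti_harmonic //.
rewrite -oppr_le0 -[- u 0]mulN1r.
apply: (@maximum_principle R q (fun x => -1 * u x) rho 0 q0).
- exact/pol_class_C2/polZ.
- by move=> x; rewrite laplacianZ // lu mulr0.
- move=> x xr; rewrite mulN1r oppr_le0; have := f0 x xr.
  by rewrite E xr subrr mul0r addr0.
- by rewrite /sqnorm big1 // => i _; rewrite mxE expr0n.
Qed.

(** For harmonic [f] one has [Lap (f^2) = 2 |grad f|^2], and the partial
    derivatives are harmonic again. *)
Lemma iter_laplacian_sqr_ge0 m f : poly_fun f -> laplacian f = (fun=> 0) ->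
  0 <= iter m laplacian (fun x => f x * f x) 0.
Proof.
elim: m f => [|m IH] f pf lf; first by rewrite /= -expr2 sqr_ge0.
have -> : iter m.+1 laplacian (fun x => f x * f x) =
    iter m laplacian (fun x => 2 * \sum_i partial i f x * partial i f x).
  rewrite iterSr laplacianM // lf; congr (iter m laplacian _); apply/funext => x.
  by rewrite !mulr0 !add0r.
have pp i : poly_fun (fun x => partial i f x * partial i f x).
  by apply: polM; exact: pol_partial.
rewrite iter_laplacianZ; last exact: pol_sum.
rewrite mulr_ge0 // iter_laplacian_sum // sumr_ge0 // => i _.
apply: IH; first exact: pol_partial.
by rewrite laplacian_partial // lf partial_cst.
Qed.

(** For harmonic [u] the Pizzetti functional sends [x_i u] to
    [r^2 / q * partial i u 0]; apply its positivity to [r * M + x_i u] and to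
    [r * M - x_i u], which are nonnegative on the sphere. *)
Lemma partial_bound0 i u (r M : R) : (0 < q)%N -> poly_fun u -> laplacian u = (fun=> 0) ->
  0 < r -> (forall x, sqnorm x = r ^+ 2 -> `|u x| <= M) ->
  `|partial i u 0| <= q%:R / r * M.
Proof.
move=> q0 pu lu r0 uM.
have pxu : poly_fun (fun x => x ord0 i * u x) by exact: polM (pol_coord i) pu.
have main c : `|c| = 1 -> - c * partial i u 0 <= q%:R / r * M.
  move=> c1.
  have pc : poly_fun (fun x => c * (x ord0 i * u x)) by exact: polZ.
  have [N0 HN] : exists N0, forall N, (N0 <= N)%N ->
      0 <= pizzetti N (r ^+ 2) (fun x => r * M + c * (x ord0 i * u x)).
    apply: pizzetti_ge0 => //.
    - exact: polD (pol_cst _) pc.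
    - move=> x xr; rewrite -(opprK (_ * (_ * _))) subr_ge0.
      apply: le_trans (ler_norm _) _; rewrite normrN !normrM c1 mul1r.
      apply: ler_pM => //; last exact: uM.
      rewrite -(@ler_pXn2r _ 2) ?nnegrE ?(ltW r0) // real_normK ?num_real //.
      by rewrite -xr coord_sqr_le.
    - exact: sqr_ge0.
  have := HN N0.+2 (leq_trans (leqnSn _) (leqnSn _)).
  rewrite pizzettiD //; last exact: pol_cst.
  rewrite pizzetti_harmonic; last exact: laplacian_cst.
  rewrite pizzettiZ //.
  have L1 : laplacian (fun x => x ord0 i * u x) = fun x => 2 * partial i u x.
    rewrite laplacianM; [|exact: pol_coord|exact: pu].
    rewrite lu (hom_laplacian_small (hom_coord i)) //.
    apply/funext => x; rewrite !mulr0 !add0r (bigD1 i) //= big1 => [|j ji].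
      by rewrite partial_coord eqxx mul1r addr0.
    by rewrite partial_coord (negbTE ji) mul0r.
  have L2 m : iter m.+2 laplacian (fun x => x ord0 i * u x) = fun=> 0.
    rewrite iterSr L1; apply: iter_laplacian_harmonic.
    rewrite (laplacianZ _ (pol_partial i pu)) laplacian_partial // lu partial_cst.
    by apply/funext => x; rewrite mulr0.
  rewrite /pizzetti !big_ord_recl big1 => [|m _]; last by rewrite !lift0 L2 mulr0.
  rewrite /= L1 mxE /bump /= mul0r mulr0 add0r addr0 !mul1r expr1 mulr0 add0r => H.
  have q0' : 0 < q%:R :> R by rewrite ltr0n.
  move: H; move: (partial i u 0) => p H.
  rewrite -(ler_pM2l (mulr_gt0 r0 r0)).
  have E1 : r * r * (q%:R / r * M) = q%:R * (r * M).
    by move: (q%:R : R) q0' => Q Q0; field; rewrite gt_eqF.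
  rewrite E1 -(ler_pM2l (_ : 0 < q%:R^-1)) ?invr_gt0 // mulKf ?gt_eqF //.
  rewrite -subr_ge0; apply: le_trans H _; rewrite le_eqVlt; apply/orP; left.
  apply/eqP; move: (q%:R : R) q0' => Q Q0; field.
  by rewrite gt_eqF.
rewrite ler_norml -lerNl; apply/andP; split.
  by have := main 1 (normr1 _); rewrite mulN1r.
by have := main (- 1); rewrite opprK mul1r; apply; rewrite normrN1.
Qed.

Lemma partial_bound i u (a : V) (M : R) : (0 < q)%N -> poly_fun u -> laplacian u = (fun=> 0) ->
  (forall x, `|x - a| <= 1 -> `|u x| <= M) -> `|partial i u a| <= q%:R * M.
Proof.
move=> q0 pu lu uM.
have := @partial_bound0 i (fun x => u (x + a)) 1 M q0 (pol_shift a pu).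
rewrite laplacian_shift lu partial_shift add0r divr1; apply => // x.
rewrite expr1n => x1; apply: uM; rewrite addrK; apply: norm_le_sqnorm => //.
by rewrite x1 expr1n.
Qed.

End Pizzetti.

(** * Peak sequences of monomials *)

Section PeakSequences.
Context {R : realType}.
Implicit Types (r t c x y : R) (i j p n : nat).

Lemma monomial_cross i j r t : (i <= j)%N -> 0 < r -> r <= t ->
  r ^+ j * t ^+ i <= r ^+ i * t ^+ j.
Proof.
move=> ij r0 rt; have t0 := lt_le_trans r0 rt.
rewrite -(subnKC ij) !exprD mulrAC [leRHS]mulrA.
rewrite ler_pM2l ?mulr_gt0 ?exprn_gt0 //.
by apply: lerXn2r; rewrite ?nnegrE // ltW.
Qed.

(** A monomial of larger degree that dominates at [r] dominates after [r]. *)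
Lemma dominate_right i j r t x y : (i <= j)%N -> 0 < r -> r <= t -> 0 <= x ->
  x * r ^+ i <= y * r ^+ j -> x * t ^+ i <= y * t ^+ j.
Proof.
move=> ij r0 rt x0 H; have t0 := lt_le_trans r0 rt.
rewrite -(ler_pM2l (exprn_gt0 j r0)).
apply: (@le_trans _ _ (x * r ^+ i * t ^+ j)).
  by rewrite mulrCA -mulrA ler_wpM2l // monomial_cross.
by rewrite [leRHS]mulrA ler_pM2r ?exprn_gt0 // [leRHS]mulrC.
Qed.

Lemma dominate_left i j r t x y : (i <= j)%N -> 0 < t -> t <= r -> 0 <= y ->
  y * r ^+ j <= x * r ^+ i -> y * t ^+ j <= x * t ^+ i.
Proof.
move=> ij t0 tr y0 H; have r0 := lt_le_trans t0 tr.
rewrite -(ler_pM2l (exprn_gt0 i r0)).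
apply: (@le_trans _ _ (y * r ^+ j * t ^+ i)).
  rewrite mulrCA -mulrA ler_wpM2l // mulrC [leRHS]mulrC.
  by have := monomial_cross ij t0 tr; rewrite mulrC.
by rewrite [leRHS]mulrA ler_pM2r ?exprn_gt0 // [leRHS]mulrC.
Qed.

Definition ndist p n := (p - n + (n - p))%N.

Lemma ndist_le_left p n d : d = n \/ d = n.+1 -> (p <= n)%N ->
  (ndist p d <= (n - p).+1)%N.
Proof. by rewrite /ndist => -[->|->] ?; lia. Qed.

Lemma ndist_le_right p n d : d = n \/ d = n.+1 -> (n < p)%N ->
  (ndist p d <= (p - n.+1).+1)%N.
Proof. by rewrite /ndist => -[->|->] ?; lia. Qed.

Lemma exists_exp2_gt c : exists n, c < 2 ^+ n.
Proof.
exists (Num.bound `|c|); apply: le_lt_trans (ler_norm c) _.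
apply: lt_le_trans (archi_boundP (normr_ge0 c)) _.
by rewrite -natrX ler_nat ltnW // ltn_expl.
Qed.

Section Peaks.
Variable B : nat -> R.
Hypothesis B_ge0 : forall j, 0 <= B j.
Hypothesis B_neq0 : exists j, 0 < B j.
Hypothesis B_bounded : forall r, 0 < r -> exists M, forall j, B j * r ^+ j <= M.

Let T j r := B j * r ^+ j.

Lemma monomial_ge0 j r : 0 < r -> 0 <= T j r.
Proof. by move=> r0; rewrite mulr_ge0 // exprn_ge0 // ltW. Qed.

Lemma monomial_small r c : 0 < r -> 0 < c -> exists N, forall j, (N <= j)%N -> T j r < c.
Proof.
move=> r0 c0; have [M HM] := B_bounded (mulr_gt0 (ltr0n R 2) r0).
have [N HN] := exists_exp2_gt (M / c).
exists N => j Nj; have p2 : 0 < 2 ^+ j :> R by rewrite exprn_gt0.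
rewrite -(ltr_pM2l p2); apply: (@le_lt_trans _ _ M).
  by have := HM j; rewrite exprMn /T mulrCA.
rewrite -ltr_pdivrMr //; apply: lt_le_trans HN _.
by rewrite ler_eXn2l // ltr1n.
Qed.

Definition active r j := 0 < r /\ forall i, T i r <= T j r.

Lemma exists_active r : 0 < r -> exists j, active r j.
Proof.
move=> r0; have [j0 Bj0] := B_neq0.
have Tj0 : 0 < T j0 r by rewrite mulr_gt0 ?exprn_gt0.
have [N HN] := monomial_small r0 Tj0.
have oj : (j0 < (maxn N j0).+1)%N by rewrite ltnS leq_maxr.
case: (@arg_maxP _ _ _ (Ordinal oj) xpredT (fun k : 'I__ => T k r)) => //= k _ Hk.
exists k; split => // i; case: (ltnP i (maxn N j0).+1) => [iN|].
  exact: (Hk (Ordinal iN)).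
move=> /ltnW; rewrite geq_max => /andP[/HN /ltW H _].
exact: le_trans H (Hk (Ordinal oj) isT).
Qed.

Lemma active_coef_gt0 r j : active r j -> 0 < B j.
Proof.
move=> [r0 aj]; have [j0 Bj0] := B_neq0.
have : 0 < T j r by apply: lt_le_trans (aj j0); rewrite mulr_gt0 ?exprn_gt0.
by rewrite pmulr_lgt0 ?exprn_gt0.
Qed.

Lemma active_monomial_gt0 r j t : active r j -> 0 < t -> 0 < T j t.
Proof. by move=> /active_coef_gt0 Bj t0; rewrite mulr_gt0 ?exprn_gt0. Qed.

Definition terminal r j := forall t, r <= t -> forall i, T i t <= 16 * T j t.

(** One step of the construction.  A state [(r, j)] consists of a point and of the
    index of a monomial that is maximal there.  The third clause gives geometric
    decay of the earlier monomials to the right of [s'.1], the fourth says that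
    nothing is lost between the two points, and the last one gives decay to the
    left: what follows [s'] is small at [s.1]. *)
Definition follows (s s' : R * nat) :=
  [/\ active s'.1 s'.2 /\ s.1 < s'.1, (s.2 < s'.2)%N, 16 * T s.2 s'.1 <= T s'.2 s'.1,
      forall t, s.1 <= t -> t <= s'.1 ->
        (forall i, T i t <= 16 * T s.2 t) \/ (forall i, T i t <= 16 * T s'.2 t) &
      forall r i, active r i -> s'.1 < r -> (s'.2 < i)%N ->
        16 * T s'.2 r <= T i r -> 16 * T i s.1 < T s.2 s.1].

(** Among the later states whose monomial has at least 16 times the size of the
    monomial [j], prefer those whose monomial is at [r] still within a factor 16
    of the maximum, and take the largest index among them: this thins out
    families of monomials that are nearly equal at [r].  If there are none, take
    the smallest index, so that no essential monomial is skipped. *)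
Lemma follows_or_terminal r j : active r j ->
  terminal r j \/ exists s', follows (r, j) s'.
Proof.
move=> aj; have [r0 Hj] := aj; have Bj := active_coef_gt0 aj.
pose P i := exists r', [/\ r < r', active r' i & 16 * T j r' <= T i r'].
have Pgt i : P i -> (j < i)%N.
  move=> [r' [rr' [r'0 ai] H]]; rewrite ltnNge; apply/negP => ij.
  have := dominate_right ij r0 (ltW rr') (B_ge0 i) (Hj i).
  rewrite -/(T i r') -/(T j r') => /(le_trans H).
  have := active_monomial_gt0 aj r'0; lra.
have Pnext j' r' : [/\ r < r', active r' j' & 16 * T j r' <= T j' r'] ->
    forall r'' i, active r'' i -> r' < r'' -> (j' < i)%N ->
    16 * T j' r'' <= T i r'' -> P i.
  move=> [rr' [r'0 aj'] H'] r'' i ai r'r'' ji H; exists r''; split => //.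
    exact: lt_trans r'r''.
  have jj' : (j < j')%N by apply: Pgt; exists r'.
  have r''0 := lt_trans r'0 r'r''.
  have : 16 * T j r'' <= T j' r''.
    rewrite /T mulrA; apply: (dominate_right (ltnW jj') r'0 (ltW r'r'')).
      by rewrite mulr_ge0.
    by rewrite -mulrA.
  have := monomial_ge0 j' r''0; lra.
have [[i0 Pi0]|noP] := pselect (exists i, P i); last first.
  left => t rt i; have t0 := lt_le_trans r0 rt.
  have [k [_ ak]] := exists_active t0.
  apply: le_trans (ak i) _; rewrite leNgt; apply/negP => H.
  move: rt; rewrite le_eqVlt => /predU1P[E|rt].
    by move: H; rewrite -E; have := Hj k; have := monomial_ge0 j r0; lra.
  by apply: noP; exists k, t; split => //; exact: ltW.
right; pose Q i := P i /\ T j r <= 16 * T i r.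
have [exQ|noQ] := pselect (exists i, Q i).
  have exQ' : exists i, `[< Q i >] by case: exQ => i Qi; exists i; apply/asboolP.
  have [N HN] := monomial_small r0 (divr_gt0 (active_monomial_gt0 aj r0) (ltr0n R 16)).
  have ubQ i : `[< Q i >] -> (i <= N)%N.
    move=> /asboolP[_ H]; rewrite leqNgt; apply/negP => /ltnW/HN.
    by rewrite ltr_pdivlMr // mulrC ltNge H.
  case: (ex_maxnP exQ' ubQ) => j' /asboolP[Pj' Qj'] maxj'.
  have [r' [rr' [r'0 aj'] H']] := Pj'.
  exists (r', j'); split => //=; first exact: Pgt.
    move=> t rt tr'; right => i; have t0 := lt_le_trans r0 rt.
    case: (leqP i j') => ij.
      rewrite /T mulrA; apply: (dominate_right ij r0 rt (B_ge0 i)).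
      by rewrite -mulrA; apply: le_trans Qj'; exact: Hj.
    have := dominate_left (ltnW ij) t0 tr' (B_ge0 i) (aj' i).
    by rewrite -/(T i t) -/(T j' t); have := monomial_ge0 j' t0; lra.
  move=> r'' i ai r'r'' ji H; rewrite ltNge; apply/negP => H2.
  have : (i <= j')%N.
    apply: maxj'; apply/asboolP; split => //.
    exact: (Pnext j' r' _ r'' i).
  by rewrite leqNgt ji.
have exP : exists i, `[< P i >] by exists i0; apply/asboolP.
case: (ex_minnP exP) => j' /asboolP Pj' minj'.
have [r' [rr' [r'0 aj'] H']] := Pj'.
exists (r', j'); split => //=; first exact: Pgt.
  move=> t rt tr'; have t0 := lt_le_trans r0 rt.
  have [k ak] := exists_active t0.
  move: rt; rewrite le_eqVlt => /predU1P[<-|rt].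
    by left => i; have := Hj i; have := monomial_ge0 j r0; lra.
  case: (leP (16 * T j t) (T k t)) => H; last first.
    by left => i; apply: ltW; apply: le_lt_trans H; exact: ak.2.
  right => i; apply: le_trans (ak.2 i) _.
  have kj : (j' <= k)%N by apply: minj'; apply/asboolP; exists t.
  have := dominate_left kj t0 tr' (B_ge0 k) (aj' k).
  by rewrite -/(T k t) -/(T j' t); have := monomial_ge0 j' t0; lra.
move=> r'' i ai r'r'' ji H; rewrite ltNge; apply/negP => H2.
apply: noQ; exists i; split => //; exact: (Pnext j' r' _ r'' i).
Qed.

(** Near 0 the monomial of least degree dominates. *)
Lemma first_active : exists r j, active r j /\
  forall t, 0 < t -> t <= r -> forall i, T i t <= T j t.
Proof.
have [j1 Bj1] := B_neq0.
have ex : exists j, 0 < B j by exists j1.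
case: (ex_minnP ex) => j Bj minj.
have [M HM] := B_bounded (@ltr01 R).
have {}HM i : B i <= M by have := HM i; rewrite expr1n mulr1.
have M0 : 0 < M by apply: lt_le_trans (HM j).
have H t : 0 < t -> t <= B j / M -> forall i, T i t <= T j t.
  move=> t0 tB i; case: (ltnP i j) => ij.
    have -> : T i t = 0; last exact: monomial_ge0.
    rewrite /T (_ : B i = 0) ?mul0r //; apply/eqP; rewrite eq_le B_ge0 andbT leNgt.
    by apply/negP => /minj; rewrite leqNgt ij.
  move: ij; rewrite leq_eqVlt => /predU1P[<- //|ij].
  have t1 : t <= 1 by apply: le_trans tB _; rewrite ler_pdivrMr // mul1r.
  have -> : T i t = B i * t * t ^+ j * t ^+ (i - j.+1).
    rewrite /T (_ : t ^+ i = t * t ^+ j * t ^+ (i - j.+1)) ?mulrA //.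
    by rewrite -exprS -exprD subnKC.
  have H2 : B i * t * t ^+ j <= T j t.
    rewrite ler_pM2r ?exprn_gt0 //; apply: (@le_trans _ _ (M * t)).
      by rewrite ler_pM2r.
    by rewrite mulrC -ler_pdivlMr.
  apply: le_trans H2; apply: ler_piMr; last by rewrite exprn_ile1 // ltW.
  by rewrite !mulr_ge0 // ltW // exprn_gt0.
have r0 : 0 < B j / M by rewrite divr_gt0.
by exists (B j / M), j; split => //; split => // i; apply: H.
Qed.

(** The construction stops, with value [None], at a state whose monomial dominates
    up to infinity. *)
Lemma peak_states : exists st : nat -> option (R * nat),
  [/\ exists r j, [/\ st 0%N = Some (r, j), active r j &
        forall t, 0 < t -> t <= r -> forall i, T i t <= T j t],
      forall p, st p = None -> st p.+1 = None,
      forall p s s', st p = Some s -> st p.+1 = Some s' -> follows s s' &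
      forall p s, st p = Some s -> active s.1 s.2 ->
        st p.+1 = None -> terminal s.1 s.2].
Proof.
have [r0 [j0 [a0 H0]]] := first_active.
pose nxt s :=
  if pselect (exists s', follows s s') is left e then Some (sval (cid e)) else None.
pose st := fix st p := if p is p'.+1 then obind nxt (st p') else Some (r0, j0).
exists st; split.
- by exists r0, j0.
- by move=> p /= ->.
- move=> p s s' /= -> /=; rewrite /nxt; case: pselect => // e [<-].
  exact: (svalP (cid e)).
- move=> p s /= -> /= as_; rewrite /nxt; case: pselect => // ne _.
  by case: (follows_or_terminal as_) => // -[s' Hs']; exfalso; apply: ne; exists s';
    rewrite -surjective_pairing in Hs'.
Qed.

(** Earlier monomials decay by a factor 16 at each position, later ones by a factor
    16 at every second position; hence the rate 4. *)
Lemma peak_sequence : exists (j : nat -> nat) (a : nat -> R),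
  [/\ forall p, 0 <= a p,
      forall p, a p = 0 \/ a p = B (j p) /\ (p <= j p)%N &
      forall t, 0 < t -> exists d,
        (forall i, B i * t ^+ i <= 16 * (a d * t ^+ j d)) /\
        (forall p, 4 ^+ ndist p d * (a p * t ^+ j p) <= 256 * (a d * t ^+ j d))].
Proof.
have [st [[r0 [j0 [st0 a0 H0]]] stN stS stE]] := peak_states.
pose j p := if st p is Some s then s.2 else 0%N.
pose a p := if st p is Some s then B s.2 else 0.
pose U p t := a p * t ^+ j p.
have st_active p s : st p = Some s -> active s.1 s.2 /\ (p <= s.2)%N.
  elim: p s => [|p IH] s; first by rewrite st0 => -[<-].
  case E : (st p) => [s'|]; last by rewrite stN.
  by move=> /(stS _ _ _ E)[[? _] ? _ _ _]; split => //; have [_] := IH _ E; lia.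
have US p s t : st p = Some s -> U p t = T s.2 t by rewrite /U /a /j => ->.
have UN p t : st p = None -> U p t = 0 by rewrite /U /a => ->; rewrite mul0r.
have a_ge0 p : 0 <= a p by rewrite /a; case: (st p).
have U_ge0 p t : 0 < t -> 0 <= U p t.
  by move=> t0; rewrite mulr_ge0 // exprn_ge0 // ltW.
have st_prev p n s : (p <= n)%N -> st n = Some s -> exists s', st p = Some s'.
  elim: n s => [|n IH] s; first by rewrite leqn0 => /eqP ->; exists s.
  rewrite leq_eqVlt => /predU1P[->|pn]; first by exists s.
  case E : (st n) => [s'|]; last by rewrite stN.
  by move=> _; apply: IH E.
have left_decay n s t : st n = Some s -> s.1 <= t ->
    forall p, (p <= n)%N -> 16 ^+ (n - p) * U p t <= U n t.
  elim: n s => [|n IH] s E st_ p.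
    by rewrite leqn0 => /eqP ->; rewrite mul1r.
  rewrite leq_eqVlt => /predU1P[->|pn]; first by rewrite subnn mul1r.
  have [s' E'] := st_prev n n.+1 s (leqnSn n) E.
  have [[[s0 _] ss'] jj H _ _] := stS _ _ _ E' E.
  have t0 := lt_le_trans s0 st_.
  have H1 : 16 * U n t <= U n.+1 t.
    rewrite (US _ _ _ E) (US _ _ _ E') /T mulrA.
    apply: (dominate_right (ltnW jj) s0 st_); first by rewrite mulr_ge0.
    by rewrite -mulrA.
  rewrite subSn // exprS -mulrA; apply: le_trans H1; rewrite ler_pM2l //.
  by apply: (IH s') => //; apply: le_trans st_; exact: ltW.
have right1 p s t : st p = Some s -> 0 < t -> t <= s.1 -> U p.+1 t <= U p t.
  move=> E t0 ts; case E' : (st p.+1) => [s'|]; last by rewrite (UN p.+1) // U_ge0.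
  have [_ jj _ _ _] := stS _ _ _ E E'.
  have [[_ as_] _] := st_active _ _ E.
  rewrite (US _ _ _ E) (US _ _ _ E').
  exact: (dominate_left (ltnW jj) t0 ts (B_ge0 _) (as_ _)).
have right2 p s t : st p = Some s -> 0 < t -> t <= s.1 -> 16 * U p.+2 t <= U p t.
  move=> E t0 ts; case E2 : (st p.+2) => [s2|]; last first.
    by rewrite (UN p.+2) // mulr0 U_ge0.
  have [s1 E1] := st_prev p.+1 p.+2 _ (leqnSn _) E2.
  have [_ j01 _ _ H] := stS _ _ _ E E1.
  have [[a2 r12] j12 H12 _ _] := stS _ _ _ E1 E2.
  have {H12}H := H _ _ a2 r12 j12 H12.
  rewrite (US _ _ _ E) (US _ _ _ E2) /T mulrA.
  apply: (dominate_left _ t0 ts); first by lia.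
    by rewrite mulr_ge0.
  by rewrite -mulrA ltW.
have right_decay k p s t : st p = Some s -> 0 < t -> t <= s.1 ->
    4 ^+ k * U (p + k)%N t <= 4 * U p t.
  have [n] := ubnP k; elim: n k p s => // n IH [|[|k]] p s kn E t0 ts.
  - by rewrite expr0 addn0 mul1r; have := U_ge0 p t t0; lra.
  - by rewrite expr1 addn1 ler_pM2l // (right1 p s).
  - case E2 : (st p.+2) => [s2|]; last first.
      have E3 : st (p + k.+2)%N = None.
        rewrite (_ : p + k.+2 = k + p.+2)%N; last by lia.
        by elim: k {kn} => [//|k IHk]; rewrite addSn stN.
      by rewrite (UN _ _ E3) mulr0 mulr_ge0 ?U_ge0.
    have [s1 E1] := st_prev p.+1 p.+2 _ (leqnSn _) E2.
    have [[_ r01] _ _ _ _] := stS _ _ _ E E1.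
    have [[_ r12] _ _ _ _] := stS _ _ _ E1 E2.
    have ts2 : t <= s2.1 by apply: le_trans ts _; rewrite ltW // (lt_trans r01).
    have /= := IH k p.+2 s2 ltac:(lia) E2 t0 ts2.
    have := right2 p s t E t0 ts.
    rewrite (_ : p.+2 + k = p + k.+2)%N; last by lia.
    by rewrite !exprS -!mulrA; lra.
exists j, a; split => //.
  move=> p; rewrite /a /j; case E : (st p) => [s|]; last by left.
  by right; split => //; have [] := st_active _ _ E.
move=> t t0; case: (leP t r0) => [tr|rt].
  exists 0%N; split.
    move=> i; rewrite -/(U 0%N t) (US _ _ _ st0) -/(T i t).
    apply: le_trans (H0 t t0 tr i) _; have := monomial_ge0 j0 t0; rewrite /=; lra.
  move=> p; rewrite -/(U p t) -/(U 0%N t) /ndist subn0 sub0n addn0.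
  have := right_decay p 0%N _ t st0 t0 tr; rewrite add0n.
  have := U_ge0 0%N t t0; lra.
pose P n := exists2 s, st n = Some s & s.1 <= t.
have exP : exists n, `[< P n >].
  by exists 0%N; apply/asboolP; exists (r0, j0) => //; exact: ltW.
have [M HM] := B_bounded (mulr_gt0 (ltr0n R 2) t0).
have tau0 : 0 < T j0 r0 by apply: (active_monomial_gt0 a0); case: a0.
have [N HN] := exists_exp2_gt (M / T j0 r0).
have ubP n : `[< P n >] -> (n <= N)%N.
  move=> /asboolP[s E st_]; have [[s0 as_] ns] := st_active _ _ E.
  rewrite leqNgt; apply/negP => Nn.
  have rs : r0 <= s.1.
    elim: n s E {st_ s0 as_ ns Nn} => [|n IH] s; first by rewrite st0 => -[<-].
    case E : (st n) => [s'|]; last by rewrite stN.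
    by move=> /(stS _ _ _ E)[[_ /ltW H] _ _ _ _]; apply: le_trans H; exact: IH.
  have H1 : T j0 r0 <= T s.2 s.1.
    apply: le_trans (as_ j0); rewrite ler_wpM2l //; apply: lerXn2r => //; rewrite nnegrE.
      by case: a0 => /ltW.
    exact: ltW.
  have H2 : 2 ^+ s.2 * T s.2 s.1 <= M.
    apply: le_trans (HM s.2); rewrite mulrCA ler_wpM2l // -exprMn.
    apply: lerXn2r; rewrite ?nnegrE ?mulr_ge0 ?(ltW s0) ?(ltW t0) //.
    by rewrite ler_pM2l.
  have H3 : 2 ^+ N <= 2 ^+ s.2 :> R by rewrite ler_eXn2l ?ltr1n // (leq_trans (ltnW Nn)).
  move: HN; rewrite ltr_pdivrMr // ltNge => /negP; apply.
  by apply: le_trans H2; apply: ler_pM => //; exact: ltW.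
case: (ex_maxnP exP ubP) => n /asboolP[s E st_] maxn_.
have [[s0 as_] _] := st_active _ _ E.
have Ld := left_decay n s t E st_.
have exp4 m : 4 ^+ m <= 16 ^+ m :> R by apply: lerXn2r; rewrite ?nnegrE //; lra.
have Ld4 p : (p <= n)%N -> 4 ^+ (n - p) * U p t <= U n t.
  move=> pn; apply: le_trans (Ld p pn); rewrite ler_wpM2r ?U_ge0 //.
case E' : (st n.+1) => [s'|]; last first.
  have term := stE _ _ E (conj s0 as_) E' t st_.
  exists n; split => [i|p].
    by rewrite -/(U n t) (US _ _ _ E); exact: term.
  rewrite -/(U n t) -/(U p t); case: (leqP p n) => pn.
    rewrite /ndist (_ : p - n = 0)%N; last by lia.
    by rewrite add0n; have := Ld4 p pn; have := U_ge0 n t t0; lra.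
  have E3 : st p = None.
    by rewrite -(subnK pn); elim: (p - n.+1)%N => [//|k IHk]; exact: stN.
  by rewrite (UN _ _ E3) mulr0; apply: mulr_ge0; [exact: ler0n|exact: U_ge0].
have [[as' ss'] jj HH cover _] := stS _ _ _ E E'.
have ts' : t <= s'.1.
  rewrite leNgt; apply/negP => /ltW H.
  have : (n.+1 <= n)%N by apply: maxn_; apply/asboolP; exists s'.
  by rewrite ltnn.
have Rd p : (n.+1 <= p)%N -> 4 ^+ (p - n.+1) * U p t <= 4 * U n.+1 t.
  move=> np; have := right_decay (p - n.+1)%N n.+1 s' t E' t0 ts'.
  by rewrite subnKC.
have fin d : (d = n \/ d = n.+1) -> (forall i, T i t <= 16 * U d t) ->
  exists d0, (forall i, B i * t ^+ i <= 16 * (a d0 * t ^+ j d0)) /\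
        (forall p, 4 ^+ ndist p d0 * (a p * t ^+ j p) <= 256 * (a d0 * t ^+ j d0)).
  move=> dn Hd; exists d; split => [i|p]; first exact: Hd.
  rewrite -/(U d t) -/(U p t).
  have Un : U n t <= 16 * U d t by rewrite (US _ _ _ E); exact: Hd.
  have Un1 : U n.+1 t <= 16 * U d t by rewrite (US _ _ _ E'); exact: Hd.
  case: (leqP p n) => pn.
    have : 4 ^+ ndist p d * U p t <= 4 ^+ (n - p).+1 * U p t.
      rewrite ler_wpM2r ?U_ge0 // ler_eXn2l ?ltr1n //.
      exact: ndist_le_left.
    have := Ld4 p pn; have := U_ge0 d t t0; rewrite exprS -mulrA; lra.
  have : 4 ^+ ndist p d * U p t <= 4 ^+ (p - n.+1).+1 * U p t.
    rewrite ler_wpM2r ?U_ge0 // ler_eXn2l ?ltr1n //.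
    exact: ndist_le_right.
  have := Rd p pn; have := U_ge0 d t t0; rewrite exprS -mulrA; lra.
case: (cover t st_ ts') => H.
  by apply: (fin n); [left|move=> i; rewrite (US _ _ _ E); exact: H].
by apply: (fin n.+1); [right|move=> i; rewrite (US _ _ _ E'); exact: H].
Qed.

End Peaks.
End PeakSequences.

(** * Median terms, monomial hulls and sums over peak sequences *)

Section MedianAndHull.
Context {R : realType}.
Implicit Types (r s t c : R) (j p n : nat).

(** Take for [j] the median of the weights [a k * s ^+ k]: the terms of index at
    least [j] carry half of the sum at [s], and so do those of index at most [j].
    The former bound the sum from below for [t >= s], the latter for [t <= s]. *)
Lemma median_index (a : nat -> R) n s : (forall k, 0 <= a k) -> 0 < s ->
  0 < \sum_(k < n) a k * s ^+ k ->
  exists2 j, (j < n)%N & forall t, 0 < t ->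
    (\sum_(k < n) a k * s ^+ k) * t ^+ j <= 2 * (\sum_(k < n) a k * t ^+ k) * s ^+ j.
Proof.
move=> a0 s0; set G := fun t : R => \sum_(k < n) a k * t ^+ k.
rewrite -/(G s) => G0.
have n0 : (0 < n)%N.
  by case: n @G G0 => // G; rewrite /G big_ord0 ltxx.
pose S j := \sum_(k < n | (k <= j)%N) a k * s ^+ k.
have Sn : G s <= 2 * S n.-1.
  rewrite /S (eq_bigl xpredT) -/(G s); first by lra.
  by move=> k; rewrite -ltnS prednK // ltn_ord.
case: (ex_minnP (ex_intro (fun j => G s <= 2 * S j) _ Sn)) => j Hj minj.
have jn : (j < n)%N by rewrite -(prednK n0) ltnS; exact: minj.
exists j => // t t0.
have term0 (k : nat) x : 0 < x -> 0 <= a k * x ^+ k.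
  by move=> x0; rewrite mulr_ge0 // exprn_ge0 // ltW.
have half (Q : pred 'I_n) : G s <= 2 * \sum_(k < n | Q k) a k * s ^+ k ->
    (forall k : 'I_n, Q k -> s ^+ k * t ^+ j <= t ^+ k * s ^+ j) ->
    G s * t ^+ j <= 2 * G t * s ^+ j.
  move=> HQ cross.
  apply: (@le_trans _ _ (2 * (\sum_(k < n | Q k) a k * s ^+ k) * t ^+ j)).
    by rewrite ler_pM2r // exprn_gt0.
  rewrite -!mulrA ler_pM2l // !mulr_suml.
  apply: (@le_trans _ _ (\sum_(k < n | Q k) a k * t ^+ k * s ^+ j)).
    by apply: ler_sum => k Qk; rewrite -!mulrA ler_wpM2l // cross.
  rewrite [leRHS](bigID Q) /= lerDl; apply: sumr_ge0 => k _.
  by rewrite mulr_ge0 ?term0 // exprn_ge0 // ltW.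
case: (leP t s) => ts.
  apply: (half (fun k => (k <= j)%N)) => // k kj.
  by rewrite mulrC; have := monomial_cross kj t0 ts; rewrite mulrC.
apply: (half (fun k => (j <= k)%N)) => [|k jk]; last first.
  by have := monomial_cross jk s0 (ltW ts); rewrite mulrC [leRHS]mulrC.
have -> : \sum_(k < n | (j <= k)%N) a k * s ^+ k =
    G s - \sum_(k < n | (k < j)%N) a k * s ^+ k.
  apply/eqP; rewrite eq_sym subr_eq addrC; apply/eqP.
  rewrite /G (bigID (fun k : 'I_n => (k < j)%N)) /=; congr (_ + _).
  by apply: eq_bigl => k; rewrite -leqNgt.
case: j Hj minj {jn half} => [|j] _ minj.
  by rewrite big_pred0 //; lra.
have : ~~ (G s <= 2 * S j) by apply/negP => /minj; rewrite ltnn.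
rewrite -ltNge /S; lra.
Qed.

(** [B j] is the infimum of [u t / t ^+ j], the largest coefficient for which the
    monomial stays below [u]. *)
Lemma monomial_hull (J : pred nat) (u : R -> R) c : 0 < c ->
  (forall t, 0 < t -> 0 < u t) ->
  (forall r, 0 < r -> exists2 j, J j &
     forall t, 0 < t -> c * u r * t ^+ j <= u t * r ^+ j) ->
  exists B : nat -> R, [/\ forall j, 0 <= B j,
    forall j, ~~ J j -> B j = 0,
    forall r j, 0 < r -> B j * r ^+ j <= u r &
    forall r, 0 < r -> exists2 j, J j & c * u r <= B j * r ^+ j].
Proof.
move=> c0 u0 H.
pose S j := [set u t / t ^+ j | t in [set t | 0 < t]].
have lbS j : lbound (S j) 0.
  by move=> _ [t /= t0 <-]; rewrite ltW // divr_gt0 ?u0 // exprn_gt0.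
have infS j : has_inf (S j).
  by split; [exists (u 1 / 1 ^+ j), 1 => //=|exists 0].
exists (fun j => if J j then inf (S j) else 0); split.
- by move=> j; case: (J j) => //; apply: lb_le_inf => //; case: (infS j).
- by move=> j /negbTE ->.
- move=> r j r0; case: (J j); last by rewrite mul0r ltW // u0.
  rewrite -ler_pdivlMr ?exprn_gt0 //; apply: ge_inf; first by case: (infS j).
  by exists r.
- move=> r r0; have [j Jj Hj] := H r r0; exists j; rewrite ?Jj //.
  rewrite -ler_pdivrMr ?exprn_gt0 //; apply: lb_le_inf; first by case: (infS j).
  move=> _ [t /= t0 <-]; rewrite ler_pdivrMr ?exprn_gt0 // mulrAC.
  by rewrite ler_pdivlMr ?exprn_gt0 //; exact: Hj.
Qed.

Lemma sum_half_exp_ndist d n : \sum_(p < n) (2^-1 : R) ^+ ndist p d <= 4.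
Proof.
have pos k : 0 <= (2^-1 : R) ^+ k by rewrite exprn_ge0 // invr_ge0.
have right k : \sum_(p < k) (2^-1 : R) ^+ p = 2 - 2 * 2^-1 ^+ k.
  elim: k => [|k IH]; first by rewrite big_ord0 expr0; lra.
  rewrite big_ord_recr /= IH exprS; lra.
have left : \sum_(p < d) (2^-1 : R) ^+ (d - p) = 1 - 2^-1 ^+ d.
  elim: d => [|k IH]; first by rewrite big_ord0 expr0; lra.
  rewrite big_ord_recr /= subSnn expr1 exprS.
  under eq_bigr => p _ do rewrite subSn ?(ltnW (ltn_ord p)) // exprS.
  rewrite -mulr_sumr IH; lra.
apply: (@le_trans _ _ (\sum_(p < d + n) (2^-1 : R) ^+ ndist p d)).
  rewrite -!(big_mkord xpredT (fun p => (2^-1 : R) ^+ ndist p d)).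
  rewrite [leRHS](big_cat_nat (leq0n n) (leq_addl d n)) /= lerDl.
  exact: sumr_ge0.
rewrite big_split_ord /=.
under eq_bigr => p _.
  rewrite /ndist (_ : p - d = 0)%N; last by have := ltn_ord p; lia.
  rewrite add0n; over.
rewrite left; under eq_bigr => p _.
  rewrite /ndist (_ : _ + _ = p)%N; last by lia.
  over.
rewrite right; have := pos d; have := pos n; lra.
Qed.

Section PeakSums.
Variables (T g : nat -> R) (d n : nat) (c2 : R).
Hypothesis T_ge0 : forall p, 0 <= T p.
Hypothesis T_decay : forall p, 4 ^+ ndist p d * T p <= 256 * T d.
Hypothesis g_le : forall p, `|g p| <= c2 * T p.

Let c2T_ge0 p : 0 <= c2 * T p.
Proof. exact: le_trans (normr_ge0 _) (g_le p). Qed.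

Lemma peak_term_le p : T p <= 256 * T d * 2^-1 ^+ ndist p d * 2^-1 ^+ ndist p d.
Proof.
rewrite -mulrA -exprMn (_ : 2^-1 * 2^-1 = 4^-1); last by field.
by rewrite exprVn ler_pdivlMr ?exprn_gt0 // mulrC.
Qed.

Lemma peak_tail (Q : pred nat) m : (forall p, Q p -> (m <= ndist p d)%N) ->
  2 ^+ m * `|\sum_(p < n | Q p) g p| <= 1024 * (c2 * T d).
Proof.
move=> Qm; have p2 : 0 < 2 ^+ m :> R by rewrite exprn_gt0.
apply: (@le_trans _ _ (\sum_(p < n | Q p) 256 * (c2 * T d) * 2^-1 ^+ ndist p d)).
  apply: (@le_trans _ _ (2 ^+ m * \sum_(p < n | Q p) `|g p|)).
    by rewrite ler_pM2l // ler_norm_sum.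
  rewrite mulr_sumr; apply: ler_sum => p Qp.
  rewrite mulrC -ler_pdivlMr //; apply: le_trans (g_le p) _.
  have [c20|c20] := leP 0 c2; last first.
    have T0 k : T k = 0.
      apply/eqP; rewrite eq_le T_ge0 andbT -(nmulr_rge0 _ c20); exact: c2T_ge0.
    by rewrite !T0 !mulr0 !mul0r.
  apply: (le_trans (ler_wpM2l c20 (peak_term_le p))).
  have : (2^-1 : R) ^+ ndist p d <= (2 ^+ m)^-1.
    rewrite exprVn lef_pV2 ?posrE ?exprn_gt0 // ler_eXn2l ?ltr1n //; exact: Qm.
  rewrite !mulrA [256 * c2]mulrC => H; apply: ler_wpM2l H.
  have h0 : 0 <= (2^-1 : R) ^+ ndist p d by rewrite exprn_ge0 // invr_ge0.
  exact: mulr_ge0 (mulr_ge0 (mulr_ge0 c20 (ler0n _ 256)) (T_ge0 d)) h0.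
rewrite -mulr_sumr; apply: (@le_trans _ _ (256 * (c2 * T d) * 4)); last lra.
apply: ler_wpM2l; first by apply: mulr_ge0; [exact: ler0n|exact: c2T_ge0].
apply: le_trans (sum_half_exp_ndist d n).
rewrite [leRHS](bigID (fun p : 'I_n => Q p)) /= lerDl.
by apply: sumr_ge0 => p _; rewrite exprn_ge0 // invr_ge0.
Qed.

Lemma peak_class_le (Q : pred nat) : `|\sum_(p < n | Q p) g p| <= 1024 * (c2 * T d).
Proof. by have := @peak_tail Q 0 (fun _ _ => leq0n _); rewrite expr0 mul1r. Qed.

(** Two positions in the same residue class modulo [M] have distance at least [M],
    so that the terms of the class of [d] other than [g d] are negligible. *)
Lemma peak_class_ge (c1 : R) M : (0 < M)%N -> (d < n)%N -> c1 * T d <= `|g d| ->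
  2048 * c2 <= c1 * 2 ^+ M ->
  c1 / 2 * T d <= `|\sum_(p < n | (p %% M == d %% M)%N) g p|.
Proof.
move=> M0 dn Hd HM; rewrite (bigD1 (Ordinal dn)) //=.
set S := \sum_(_ < _ | _) _.
have : 2 ^+ M * `|S| <= 1024 * (c2 * T d).
  have -> : S = \sum_(p < n | (p %% M == d %% M)%N && (p != d :> nat)) g p by [].
  apply: (@peak_tail (fun p => (p %% M == d %% M)%N && (p != d))) => p /andP[pd nd].
  rewrite /ndist; case: (ltngtP p d) nd => // H _.
    rewrite (_ : p - d = 0)%N ?add0n; last by lia.
    apply: dvdn_leq; first by rewrite subn_gt0.
    by rewrite -eqn_mod_dvd 1?eq_sym // ltnW.
  rewrite (_ : d - p = 0)%N ?addn0; last by lia.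
  apply: dvdn_leq; first by rewrite subn_gt0.
  by rewrite -eqn_mod_dvd // ltnW.
have p2 : 0 < 2 ^+ M :> R by rewrite exprn_gt0.
have H1 : 2 ^+ M * (c1 / 2 * T d) >= 1024 * (c2 * T d).
  rewrite mulrA mulrA ler_wpM2r //; lra.
move=> /le_trans /(_ H1); rewrite ler_pM2l // => HS.
have := lerB_dist (g d) (- S); rewrite opprK normrN; lra.
Qed.

End PeakSums.
End MedianAndHull.

(** * Homogeneous harmonic maps of bounded size and without zeros in even dimension *)

Lemma near_forall {T : topologicalType} (I : finType) (x : T) (P : I -> T -> Prop) :
  (forall i, \forall y \near x, P i y) -> \forall y \near x, forall i, P i y.
Proof. by move=> H; apply: (@filter_forall _ _ P (nbhs x)). Qed.

Section GenericPoints.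
Context {R : realType} {q : nat}.
Local Notation V := 'rV[R]_q.

(** Points off the coordinate hyperplanes: the radii of all groups of variables are
    positive there, and the estimates extend to the other points by continuity. *)
Definition generic (x : V) := forall i, x ord0 i != 0.

Lemma generic_dense (x : V) (P : V -> Prop) : (\forall y \near x, P y) ->
  exists2 y, generic y & P y.
Proof.
move=> nP; pose y (t : R) : V := t *: const_mx 1 + x.
have yx : \forall t \near (0 : R), P (y t).
  have := @line_continuous R V x (const_mx 1) 0 P.
  by rewrite scale0r add0r; apply.
have yg : \forall t \near (0 : R), forall i, t != 0 -> y t ord0 i != 0.
  apply: (@near_forall _ _ _ (fun i t => t != 0 -> y t ord0 i != 0)) => i.
  have [xi0|xi0] := eqVneq (x ord0 i) 0.
    by exists 1 => //= t _ t0; rewrite !mxE mulr1 xi0 addr0.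
  exists `|x ord0 i|; first by rewrite /= normr_gt0.
  move=> t /=; rewrite sub0r normrN !mxE mulr1 => H _; apply/eqP => /eqP.
  by rewrite addr_eq0 => /eqP E; move: H; rewrite E normrN ltxx.
have [e /= e0 He] : \forall t \near (0 : R),
    P (y t) /\ forall i, t != 0 -> y t ord0 i != 0.
  exact: (@filterI _ (nbhs (0 : R)) _ _ _ yx yg).
have [|Pe ge] := He (e / 2).
  by rewrite /= sub0r normrN gtr0_norm ?divr_gt0 // ltr_pdivrMr // mulr_natr mulr2n ltrDl.
by exists (y (e / 2)) => // i; apply: ge; rewrite gt_eqF // divr_gt0.
Qed.

Lemma ler_generic (f g : V -> R) : continuous f -> continuous g ->
  (forall x, generic x -> f x <= g x) -> forall x, f x <= g x.
Proof.
move=> cf cg H x; rewrite leNgt; apply/negP => fg.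
have : \forall y \near x, 0 < f y - g y.
  by apply: (cvgr_gt _ (cvgB (cf x) (cg x))); rewrite subr_gt0.
by move=> /generic_dense[y /H]; rewrite subr_gt0 ltNge => ->.
Qed.

Lemma exists_ler_generic (I : finType) (f : I -> V -> R) (g : V -> R) :
  (forall s, continuous (f s)) -> continuous g ->
  (forall x, generic x -> exists s, g x <= `|f s x|) -> forall x, exists s, g x <= `|f s x|.
Proof.
move=> cf cg H x; apply: contrapT => /forallNP ne.
have : \forall y \near x, forall s, 0 < g y - `|f s y|.
  apply: (@near_forall _ _ _ (fun s y => 0 < g y - `|f s y|)) => s.
  apply: (cvgr_gt _ (cvgB (cg x) (cvg_norm (cf s x)))); rewrite subr_gt0 ltNge.
  by apply/negP; exact: ne.
by move=> /generic_dense[y /H[s Hs] /(_ s)]; rewrite subr_gt0 ltNge Hs.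
Qed.

End GenericPoints.

Section BuildingBlocks.
Context {R : realType} {q : nat}.
Local Notation V := 'rV[R]_q.
Implicit Types (f g : V -> R) (x : V).

Lemma harmonicM_disjoint f g : poly_fun f -> poly_fun g ->
  laplacian f = (fun=> 0) -> laplacian g = (fun=> 0) ->
  (forall i, partial i f = (fun=> 0) \/ partial i g = (fun=> 0)) ->
  laplacian (fun x => f x * g x) = fun=> 0.
Proof.
move=> pf pg lf lg D; rewrite laplacianM // lf lg; apply/funext => x.
rewrite !mulr0 !add0r big1 ?mulr0 // => i _.
by case: (D i) => ->; rewrite ?mulr0 ?mul0r.
Qed.

Section PlanarPowers.
Variables (i0 i1 : 'I_q).
Hypothesis i01 : i0 != i1.

(** Real and imaginary parts of the [k]-th power of [x_i0 + i x_i1]. *)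
Fixpoint planar k : (V -> R) * (V -> R) :=
  if k is k'.+1 then
    (fun x => x ord0 i0 * (planar k').1 x - x ord0 i1 * (planar k').2 x,
     fun x => x ord0 i0 * (planar k').2 x + x ord0 i1 * (planar k').1 x)
  else (fun=> 1, fun=> 0).

Lemma planar_pol k : poly_fun (planar k).1 /\ poly_fun (planar k).2.
Proof.
elim: k => [|k [IH1 IH2]] /=; first by split; exact: pol_cst.
split; [apply: polB|apply: polD]; apply: polM => //; exact: pol_coord.
Qed.

Lemma planar_partial i k : i != i0 -> i != i1 ->
  partial i (planar k).1 = (fun=> 0) /\ partial i (planar k).2 = fun=> 0.
Proof.
move=> n0 n1; elim: k => [|k [IH1 IH2]] /=; first by rewrite !partial_cst.
have [p1 p2] := planar_pol k.
have pM j (f : V -> R) : i != j -> poly_fun f -> partial i f = (fun=> 0) ->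
    partial i (fun x => x ord0 j * f x) = fun=> 0.
  move=> nj pf Ef; rewrite (pol_partialM i (pol_coord j) pf) Ef partial_coord.
  by rewrite (negbTE nj); apply/funext => x; rewrite !mulr0 addr0.
have pc j f : poly_fun f -> poly_fun (fun x => x ord0 j * f x) by exact/polM/pol_coord.
rewrite (pol_partialB i (pc i0 _ p1) (pc i1 _ p2)).
rewrite (pol_partialD i (pc i0 _ p2) (pc i1 _ p1)) !pM //.
by split; apply/funext => x; rewrite ?subr0 ?addr0.
Qed.

Lemma planar_cauchy_riemann k :
  partial i0 (planar k).1 = partial i1 (planar k).2 /\
  partial i1 (planar k).1 = (fun x => - partial i0 (planar k).2 x).
Proof.
elim: k => [|k [IH1 IH2]] /=.
  by rewrite !partial_cst; split => //; apply/funext => x; rewrite oppr0.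
have [p1 p2] := planar_pol k.
have pc j f : poly_fun f -> poly_fun (fun x => x ord0 j * f x) by exact/polM/pol_coord.
have pM i j (f : V -> R) : poly_fun f -> partial i (fun x => x ord0 j * f x) =
    fun x => x ord0 j * partial i f x + f x * (i == j)%:R.
  by move=> pf; rewrite (pol_partialM i (pol_coord j) pf) partial_coord.
split.
  rewrite (pol_partialB i0 (pc i0 _ p1) (pc i1 _ p2)).
  rewrite (pol_partialD i1 (pc i0 _ p2) (pc i1 _ p1)) !pM // IH1 IH2.
  apply/funext => x; rewrite !eqxx (negbTE i01) eq_sym (negbTE i01) !mulr0 !mulr1.
  move: (planar k).1 (planar k).2 => u v.
  move: (partial i1 v x) (partial i0 v x) (u x) => *; ring.
rewrite (pol_partialB i1 (pc i0 _ p1) (pc i1 _ p2)).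
rewrite (pol_partialD i0 (pc i0 _ p2) (pc i1 _ p1)) !pM // IH1 IH2.
apply/funext => x; rewrite !eqxx (negbTE i01) eq_sym (negbTE i01) !mulr0 !mulr1.
move: (planar k).1 (planar k).2 => u v.
move: (partial i1 v x) (partial i0 v x) (u x) (v x) => *; ring.
Qed.

Lemma planar_harmonic k :
  laplacian (planar k).1 = (fun=> 0) /\ laplacian (planar k).2 = (fun=> 0).
Proof.
have lapE f : (forall i, i != i0 -> i != i1 -> partial i f = fun=> 0) ->
    laplacian f = fun x => partial i0 (partial i0 f) x + partial i1 (partial i1 f) x.
  move=> H; apply/funext => x; rewrite /laplacian (bigD1 i0) //= (bigD1 i1) 1?eq_sym //=.
  rewrite [X in _ + (_ + X)]big1; last first.
    by move=> i /andP[n0 n1]; rewrite (H i n0 n1) partial_cst.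
  by rewrite [X in _ + X]addr0.
have [p1 p2] := planar_pol k; have [C1 C2] := planar_cauchy_riemann k.
have pN i f : poly_fun f -> partial i (fun x => - f x) = fun x => - partial i f x.
  move=> pf; under eq_fun do rewrite -mulN1r.
  by rewrite pol_partialZ //; apply/funext => x; rewrite mulN1r.
have C2' : partial i0 (planar k).2 = fun x => - partial i1 (planar k).1 x.
  by rewrite C2; apply/funext => x; rewrite opprK.
split; (rewrite lapE; last by move=> i n0 n1; case: (planar_partial k n0 n1)).
  rewrite C1 C2 (pN _ _ (pol_partial i0 p2)) (partialC i0 i1 p2).
  by apply/funext => x; rewrite subrr.
rewrite C2' -C1 (pN _ _ (pol_partial i1 p1)) (partialC i0 i1 p1).
by apply/funext => x; rewrite addNr.
Qed.

Lemma planar_norm k x : (planar k).1 x ^+ 2 + (planar k).2 x ^+ 2 =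
  (x ord0 i0 ^+ 2 + x ord0 i1 ^+ 2) ^+ k.
Proof.
elim: k => [|k IH] /=; first by rewrite expr1n expr0n addr0.
rewrite [in RHS]exprS -IH; move: (planar k) => [u v] /=.
move: (x ord0 i0) (x ord0 i1) (u x) (v x) => *; ring.
Qed.

Definition planar_part (b : bool) k : V -> R := if b then (planar k).1 else (planar k).2.

Definition planar_radius x := Num.sqrt (x ord0 i0 ^+ 2 + x ord0 i1 ^+ 2).

Lemma planar_radius_sqr k x :
  (planar_radius x ^+ k) ^+ 2 = (x ord0 i0 ^+ 2 + x ord0 i1 ^+ 2) ^+ k.
Proof. by rewrite exprAC sqr_sqrtr // addr_ge0 ?sqr_ge0. Qed.

Lemma planar_part_le b k x : `|planar_part b k x| <= planar_radius x ^+ k.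
Proof.
rewrite -(@ler_pXn2r _ 2) ?nnegrE ?exprn_ge0 ?sqrtr_ge0 // real_normK ?num_real //.
rewrite planar_radius_sqr -planar_norm /planar_part.
by case: b; rewrite ?lerDl ?lerDr sqr_ge0.
Qed.

Lemma planar_part_ge k x : exists b, planar_radius x ^+ k / 2 <= `|planar_part b k x|.
Proof.
have pr0 : 0 <= planar_radius x ^+ k by rewrite exprn_ge0 ?sqrtr_ge0.
have sq b : (planar_radius x ^+ k) ^+ 2 / 4 <= planar_part b k x ^+ 2 ->
    planar_radius x ^+ k / 2 <= `|planar_part b k x|.
  move=> H; rewrite -(@ler_pXn2r _ 2) ?nnegrE ?divr_ge0 // real_normK ?num_real //.
  by rewrite expr_div_n -[2 ^+ 2]natrX.
case: (leP ((planar_radius x ^+ k) ^+ 2 / 4) (planar_part true k x ^+ 2)) => H.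
  by exists true; exact: sq.
exists false; apply: sq; move: H; rewrite planar_radius_sqr -planar_norm /planar_part.
have := sqr_ge0 ((planar k).1 x); have := sqr_ge0 ((planar k).2 x); lra.
Qed.

End PlanarPowers.

Definition radius e x : R := Num.sqrt (\sum_(i < q | (i < e.*2)%N) x ord0 i ^+ 2).

Lemma sqr_ratio (a b : R) : 0 < b -> b ^+ 2 * (1 + (a / b) ^+ 2) = a ^+ 2 + b ^+ 2.
Proof. by move=> b0; field; rewrite gt_eqF. Qed.

Lemma radius_step e (q0 : (e.*2 < q)%N) (q1 : (e.*2.+1 < q)%N) x :
  radius e.+1 x ^+ 2 =
  planar_radius (Ordinal q0) (Ordinal q1) x ^+ 2 + radius e x ^+ 2.
Proof.
have sum0 (P : pred 'I_q) : 0 <= \sum_(i < q | P i) x ord0 i ^+ 2.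
  by apply: sumr_ge0 => i _; exact: sqr_ge0.
rewrite !sqr_sqrtr ?addr_ge0 ?sqr_ge0 ?sum0 //.
rewrite (bigD1 (Ordinal q0)) /=; last by rewrite doubleS; lia.
rewrite (bigD1 (Ordinal q1)) /=; last by rewrite doubleS -val_eqE /=; lia.
rewrite addrA; congr (_ + _); apply: eq_bigl => i.
rewrite -!val_eqE /= doubleS; lia.
Qed.

Lemma ord_below e (q0 : (e.*2 < q)%N) (q1 : (e.*2.+1 < q)%N) (i : 'I_q) :
  (i < e.*2)%N -> i != Ordinal q0 /\ i != Ordinal q1.
Proof. by move=> ie; rewrite -!val_eqE /=; split; lia. Qed.

Lemma ord_above e (q0 : (e.*2 < q)%N) (q1 : (e.*2.+1 < q)%N) (i : 'I_q) :
  (e.+1.*2 <= i)%N -> [/\ i != Ordinal q0, i != Ordinal q1 & (e.*2 <= i)%N].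
Proof. by rewrite doubleS => ie; rewrite -!val_eqE /=; split; lia. Qed.

Lemma radius_continuous e : continuous (radius e).
Proof.
have ps : poly_fun (fun x : V => \sum_(i < q | (i < e.*2)%N) x ord0 i ^+ 2).
  by apply: pol_sum => i _; exact/pol_exp/pol_coord.
move=> x; apply: (@continuous_comp _ _ _ _ (@Num.sqrt R)).
  exact: (pol_continuous ps).
exact: sqrt_continuous.
Qed.

Lemma continuous_normr (T : topologicalType) (f : T -> R) :
  continuous f -> continuous (fun t => `|f t|).
Proof. by move=> cf t; exact: (cvg_norm (cf t)). Qed.

Lemma continuous_scaled_exp (T : topologicalType) (f : T -> R) c n :
  continuous f -> continuous (fun t : T => c * f t ^+ n).
Proof.
move=> cf t; apply: cvgM; first exact: cvg_cst.
apply: (@continuous_comp _ _ _ f (fun y => y ^+ n)); first exact: cf.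
exact: exprn_continuous.
Qed.

(** The square of [(1 + r^2)^(n/2)] is a polynomial in [r^2] with nonnegative
    coefficients, so that the lemma on medians applies, with constants that do not
    depend on [n]. *)
Lemma binomial_profile n : exists B : nat -> R, [/\ forall j, 0 <= B j,
   forall j, (n < j)%N -> B j = 0,
   forall r j, 0 < r -> B j * r ^+ j <= Num.sqrt (1 + r ^+ 2) ^+ n &
   forall r, 0 < r -> exists j, Num.sqrt (1 + r ^+ 2) ^+ n / 2 <= B j * r ^+ j].
Proof.
pose u (r : R) := Num.sqrt (1 + r ^+ 2) ^+ n.
have s0 (r : R) : 0 < 1 + r ^+ 2 by rewrite ltr_wpDr // sqr_ge0.
have u0 r : 0 < r -> 0 < u r by move=> _; rewrite exprn_gt0 // sqrtr_gt0.
have u2 r : u r ^+ 2 = \sum_(k < n.+1) 'C(n, k)%:R * (r ^+ 2) ^+ k.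
  rewrite /u exprAC sqr_sqrtr ?(ltW (s0 r)) // exprDn; apply: eq_bigr => k _.
  by rewrite expr1n mul1r mulr_natl.
have h0 : 0 < 2^-1 :> R by rewrite invr_gt0.
have [|B [B0 BJ Bu uB]] := @monomial_hull R (fun j => (j <= n)%N) u 2^-1 h0 u0.
  move=> r r0.
  have [|j jn Hj] := @median_index R (fun k => 'C(n, k)%:R) n.+1 (r ^+ 2)
    (fun k => ler0n _ _) (exprn_gt0 2 r0).
    by rewrite -u2 exprn_gt0 // u0.
  exists j => // t t0; have := Hj _ (exprn_gt0 2 t0); rewrite -!u2 => H.
  have ut := u0 t t0; have ur := u0 r r0.
  move: H; rewrite [(t ^+ 2) ^+ j]exprAC [(r ^+ 2) ^+ j]exprAC.
  move: (exprn_gt0 j t0) (exprn_gt0 j r0) ut ur.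
  move: (t ^+ j) (r ^+ j) (u t) (u r) => a b c d a0 b0 c0 d0 H.
  rewrite -(@ler_pXn2r _ 2) ?nnegrE //; [|by rewrite !mulr_ge0 ?invr_ge0 // ltW..].
  have : 0 <= c ^+ 2 * b ^+ 2 by rewrite mulr_ge0 ?sqr_ge0.
  by move: H; rewrite !exprMn !expr2; lra.
exists B; split => // [j nj|r r0]; first by apply: BJ; rewrite -ltnNge.
by have [j _ Hj] := uB r r0; exists j; rewrite mulrC.
Qed.

(** A substitute for the powers [z^n] in the first [2 e] variables: a harmonic map
    of size comparable to the [n]-th power of the radius. *)
Definition blocks e (I : finType) (c1 c2 : R) n (H : I -> V -> R) :=
  [/\ forall s, poly_fun (H s) /\ laplacian (H s) = (fun=> 0),
      forall s (i : 'I_q), (e.*2 <= i)%N -> partial i (H s) = (fun=> 0),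
      forall s x, `|H s x| <= c2 * radius e x ^+ n &
      forall x, exists s, c1 * radius e x ^+ n <= `|H s x|].

Lemma blocks_base : (2 <= q)%N -> forall n,
  exists H : bool -> V -> R, blocks 1 2^-1 1 n H.
Proof.
move=> q2 n; pose i0 : 'I_q := Ordinal (ltnW q2); pose i1 : 'I_q := Ordinal q2.
have i01 : i0 != i1 by [].
have rE x : radius 1 x = planar_radius i0 i1 x.
  rewrite /radius /planar_radius (bigD1 i0) //= (bigD1 i1) //= big_pred0 ?addr0 //.
  by move=> [[|[|k]] kq]; rewrite //= -?val_eqE /= ?andbF.
exists (fun b => planar_part i0 i1 b n); split.
- have [p1 p2] := planar_pol i0 i1 n; have [l1 l2] := planar_harmonic i01 n.
  by case; [exact: conj p1 l1|exact: conj p2 l2].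
- move=> s i i2; have [||E1 E2] := @planar_partial i0 i1 i n.
  + by apply: contraTneq i2 => ->.
  + by apply: contraTneq i2 => ->.
  + by case: s.
- by move=> s x; rewrite rE mul1r planar_part_le.
- by move=> x; have [b Hb] := planar_part_ge i0 i1 n x; exists b; rewrite rE mulrC.
Qed.

(** The size of the monomials [z^k * H_(n - k)], where [z] is the new complex
    variable, is governed by [B_k t^k] with [t] the ratio of the two radii.  Keep
    a peak sequence of them, and put each residue class of positions, each
    component of [H] and each of the two parts of [z^k] into a component of its
    own. *)
Lemma blocks_step e (I : finType) (c1 c2 : R) : (0 < e)%N -> (e.+1.*2 <= q)%N ->
  0 < c1 -> 0 < c2 ->
  (forall n, exists H : I -> V -> R, blocks e c1 c2 n H) ->
  exists (I' : finType) (c1' c2' : R), [/\ 0 < c1', 0 < c2' &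
    forall n, exists H : I' -> V -> R, blocks e.+1 c1' c2' n H].
Proof.
move=> e0 eq c10 c20 /choice[H bH].
have [M0 HM0] := @exists_exp2_gt R (2048 * c2 / (c1 / 2)).
(* The other terms of a class sum up to at most half of the dominant one. *)
pose M := M0.+1.
have HM : 2048 * c2 <= c1 / 2 * 2 ^+ M.
  rewrite [leRHS]mulrC -ler_pdivrMr ?divr_gt0 // (le_trans (ltW HM0)) // ler_eXn2l ?ltr1n //.
exists ('I_M * I * bool)%type, (c1 / 128), (1024 * c2); split.
- by apply: divr_gt0; [exact: c10|rewrite ltr0n].
- by apply: mulr_gt0; [rewrite ltr0n|exact: c20].
move=> n.
have q1 : (e.*2.+1 < q)%N by rewrite -doubleS.
have q0 : (e.*2 < q)%N := ltnW q1.
pose i0 : 'I_q := Ordinal q0; pose i1 : 'I_q := Ordinal q1.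
have i01 : i0 != i1 by rewrite -val_eqE /= neq_ltn ltnSn.
have [B [B0 Bn Bu uB]] := binomial_profile n.
have su (t : R) : 0 < Num.sqrt (1 + t ^+ 2) by rewrite sqrtr_gt0 ltr_wpDr // sqr_ge0.
have [j [a [a0 aB peak]]] : exists (j : nat -> nat) (a : nat -> R),
  [/\ forall p, 0 <= a p,
      forall p, a p = 0 \/ a p = B (j p) /\ (p <= j p)%N &
      forall t, 0 < t -> exists d,
        (forall i, B i * t ^+ i <= 16 * (a d * t ^+ j d)) /\
        (forall p, 4 ^+ ndist p d * (a p * t ^+ j p) <= 256 * (a d * t ^+ j d))].
  apply: peak_sequence => //.
    have [k] := uB 1 ltr01; rewrite !expr1n mulr1 => Hk; exists k.
    by apply: lt_le_trans Hk; rewrite divr_gt0 // exprn_gt0 // sqrtr_gt0.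
  move=> r r0; exists (Num.sqrt (1 + r ^+ 2) ^+ n) => k; exact: Bu.
have jn p : a p = 0 \/ a p = B (j p) /\ (p <= j p <= n)%N.
  case: (aB p) => [|[E pj]]; first by left.
  case: (leqP (j p) n) => [jn|/Bn E0]; first by right; rewrite pj.
  by left; rewrite E.
pose g s b p x := a p * (planar_part i0 i1 b (j p) x * H (n - j p)%N s x).
pose G (k : 'I_M * I * bool) x :=
  \sum_(p < n.+1 | (p %% M == k.1.1)%N) g k.1.2 k.2 p x.
have pp b k : poly_fun (planar_part i0 i1 b k).
  by have [p1 p2] := planar_pol i0 i1 k; case: b; [exact: p1|exact: p2].
have hp b k : laplacian (planar_part i0 i1 b k) = (fun=> 0).
  by have [l1 l2] := planar_harmonic i01 k; case: b; [exact: l1|exact: l2].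
have dp b k i : i != i0 -> i != i1 -> partial i (planar_part i0 i1 b k) = (fun=> 0).
  move=> n0 n1; have [d1 d2] := planar_partial k n0 n1.
  by case: b; [exact: d1|exact: d2].
have pH k s : poly_fun (H k s) by case: (bH k) => /(_ s)[].
have hH k s : laplacian (H k s) = (fun=> 0) by case: (bH k) => /(_ s)[].
have dH k s (i : 'I_q) : (e.*2 <= i)%N -> partial i (H k s) = (fun=> 0).
  by case: (bH k) => _ + _ _; apply.
have pg s b p : poly_fun (g s b p) by apply/polZ/polM.
have pG k : poly_fun (G k) by apply: pol_sum => p _; exact: pg.
have rS x := radius_step q0 q1 x.
have bounds x : generic x ->
    (forall k, `|G k x| <= 1024 * c2 * radius e.+1 x ^+ n) /\
    exists k, c1 / 128 * radius e.+1 x ^+ n <= `|G k x|.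
  move=> gx; set r1 := planar_radius i0 i1 x; set r2 := radius e x.
  have r10 : 0 < r1.
    by rewrite sqrtr_gt0 ltr_pwDl ?sqr_ge0 // lt_def sqr_ge0 sqrf_eq0 gx.
  have r20 : 0 < r2.
    have q00 : (0 < q)%N by exact: leq_ltn_trans (leq0n _) q0.
    rewrite sqrtr_gt0 (bigD1 (Ordinal q00)) /= ?double_gt0 // ltr_pwDl ?sumr_ge0 //.
      by rewrite lt_def sqr_ge0 sqrf_eq0 gx.
    by move=> i _; exact: sqr_ge0.
  have t0 : 0 < r1 / r2 by rewrite divr_gt0.
  have [d [domd decd]] := peak _ t0.
  pose T p := r2 ^+ n * (a p * (r1 / r2) ^+ j p).
  have TE p : T p = a p * (r1 ^+ j p * r2 ^+ (n - j p)).
    rewrite /T; case: (jn p) => [->|[_ /andP[_ jpn]]]; first by rewrite !mul0r mulr0.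
    rewrite mulrCA; congr (_ * _); rewrite expr_div_n mulrCA; congr (_ * _).
    by rewrite -[in r2 ^+ n](subnK jpn) exprD mulfK // gt_eqF // exprn_gt0.
  have r2n : 0 < r2 ^+ n by rewrite exprn_gt0.
  have T0 p : 0 <= T p.
    by apply: mulr_ge0; [exact: ltW|apply: mulr_ge0 => //; rewrite exprn_ge0 // ltW].
  have rn : radius e.+1 x ^+ n = r2 ^+ n * Num.sqrt (1 + (r1 / r2) ^+ 2) ^+ n.
    rewrite -exprMn; congr (_ ^+ _); apply/eqP.
    rewrite -(@eqrXn2 _ 2) ?sqrtr_ge0 // ?mulr_ge0 ?sqrtr_ge0 ?(ltW r20) //.
    rewrite exprMn [Num.sqrt (1 + _) ^+ 2]sqr_sqrtr; last by rewrite addr_ge0 ?sqr_ge0.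
    by rewrite rS sqr_ratio.
  have Td : radius e.+1 x ^+ n <= 32 * T d.
    have [k Hk] := uB _ t0; have := le_trans Hk (domd k) => Hd.
    rewrite rn /T mulrCA ler_pM2l //; lra.
  have Tle p : T p <= radius e.+1 x ^+ n.
    rewrite rn /T ler_pM2l //; case: (jn p) => [->|[-> _]]; last exact: Bu.
    by rewrite mul0r exprn_ge0 // ltW.
  have dec p : 4 ^+ ndist p d * T p <= 256 * T d.
    by rewrite /T [leLHS]mulrCA [leRHS]mulrCA (ler_pM2l r2n).
  have gle s b p : `|g s b p x| <= c2 * T p.
    rewrite /g TE !normrM (ger0_norm (a0 p)) [leRHS]mulrCA ler_wpM2l // [leRHS]mulrCA.
    apply: ler_pM => //; first exact: planar_part_le.
    by case: (bH (n - j p)%N) => _ _ + _; apply.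
  split.
    move=> k; have := @peak_class_le R T (fun p => g k.1.2 k.2 p x) d n.+1 c2 T0 dec
      (gle k.1.2 k.2) (fun p => (p %% M == k.1.1)%N).
    move=> /le_trans; apply.
    rewrite -mulrA; apply: ler_wpM2l; first exact: ler0n.
    by rewrite ler_pM2l.
  have [s Hs] : exists s, c1 * r2 ^+ (n - j d) <= `|H (n - j d)%N s x|.
    by case: (bH (n - j d)%N) => _ _ _ /(_ x).
  have [b Hb] := planar_part_ge i0 i1 (j d) x.
  have Td0 : 0 < T d.
    have : 0 < radius e.+1 x ^+ n by rewrite rn mulr_gt0 // exprn_gt0.
    by move=> /lt_le_trans /(_ Td); rewrite pmulr_rgt0.
  have dn : (d < n.+1)%N.
    rewrite ltnS; case: (jn d) => [E|[_ /andP[H1 H2]]]; last exact: leq_trans H1 H2.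
    by move: Td0; rewrite TE E mul0r ltxx.
  have gd : c1 / 2 * T d <= `|g s b d x|.
    rewrite /g TE !normrM (ger0_norm (a0 d)) [leLHS]mulrCA ler_wpM2l //.
    rewrite (_ : c1 / 2 * _ = r1 ^+ j d / 2 * (c1 * r2 ^+ (n - j d))); last first.
      by move: (r1 ^+ _) (r2 ^+ _) => *; field.
    apply: ler_pM => //; first by rewrite divr_ge0 // exprn_ge0 // ltW.
    by rewrite mulr_ge0 ?(ltW c10) // exprn_ge0 // ltW.
  have Md : (d %% M < M)%N by rewrite ltn_mod.
  exists (Ordinal Md, s, b).
  have := @peak_class_ge R T (fun p => g s b p x) d n.+1 c2 T0 dec (gle s b)
    (c1 / 2) M (ltn0Sn _) dn gd HM.
  apply: le_trans.
  have := ler_wpM2l (ltW c10) Td; move: (radius _ _ ^+ n) (T d) => u v; lra.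
have cr c : continuous (fun x : V => c * radius e.+1 x ^+ n).
  by apply: continuous_scaled_exp; exact: radius_continuous.
exists G; split.
- move=> k; split => //; rewrite laplacian_sum; last by move=> p _; exact: pg.
  apply/funext => x; rewrite big1 // => p _.
  rewrite laplacianZ; last exact: polM.
  rewrite harmonicM_disjoint ?mulr0 // => i.
  case: (leqP e.*2 i) => ie; first by right; exact: dH.
  by left; have [n0 n1] := ord_below q0 q1 ie; exact: dp.
- move=> k i ie; rewrite pol_partial_sum; last by move=> p _; exact: pg.
  apply/funext => x; rewrite big1 // => p _.
  rewrite pol_partialZ; last exact: polM.
  have [n0 n1 ie'] := ord_above q0 q1 ie.
  rewrite (pol_partialM i (pp k.2 (j p)) (pH (n - j p)%N k.1.2)).
  by rewrite (dp _ _ _ n0 n1) (dH _ _ _ ie') !mulr0 addr0 mulr0.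
- move=> k; apply: ler_generic; [|exact: cr|by move=> x /bounds[+ _]; apply].
  exact: (continuous_normr (pol_continuous (pG k))).
- apply: exists_ler_generic; [|exact: cr|by move=> x /bounds[]].
  by move=> k; exact: pol_continuous.
Qed.

Lemma exists_blocks e : (0 < e)%N -> (e.*2 <= q)%N ->
  exists (I : finType) (c1 c2 : R), [/\ 0 < c1, 0 < c2 &
    forall n, exists H : I -> V -> R, blocks e c1 c2 n H].
Proof.
case: e => // e _; elim: e => [|e IH] eq.
  exists bool, 2^-1, 1; split; [by rewrite invr_gt0|exact: ltr01|exact: blocks_base].
have eq' : (e.+1.*2 <= q)%N by move: eq; rewrite doubleS; lia.
have [I [c1 [c2 [c10 c20 bH]]]] := IH eq'.
exact: (@blocks_step e.+1 I c1 c2).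
Qed.

End BuildingBlocks.

(** * Limits of harmonic polynomials *)

Lemma cvg_finsum {R : realType} (I : Type) (r : seq I) (F : nat -> I -> R) (l : I -> R) :
  (forall i, F n i @[n --> \oo] --> l i) ->
  \sum_(i <- r) F n i @[n --> \oo] --> \sum_(i <- r) l i.
Proof.
move=> Fl; elim: r => [|i r IH].
  by under eq_fun do rewrite big_nil; rewrite big_nil; exact: cvg_cst.
by under eq_fun do rewrite big_cons; rewrite big_cons; exact: cvgD.
Qed.

Section HarmonicLimits.
Context {R : realType} {q : nat}.
Local Notation V := 'rV[R]_q.
Implicit Types (u : nat -> V -> R) (f g : V -> R) (x a : V).

Definition converges_locally u f := forall r e : R, 0 < e ->
  exists N, forall n, (N <= n)%N -> forall x, `|x| <= r -> `|u n x - f x| <= e.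

Definition cauchy_locally u := forall r e : R, 0 < e ->
  exists N, forall n m, (N <= n)%N -> (N <= m)%N ->
    forall x, `|x| <= r -> `|u n x - u m x| <= e.

Lemma converges_pointwise u f x : converges_locally u f -> u n x @[n --> \oo] --> f x.
Proof.
move=> uf; apply/cvgrPdist_le => e e0; have [N HN] := uf `|x| e e0.
by exists N => // n /= Nn; rewrite distrC; exact: HN.
Qed.

Lemma cauchy_locally_limit u : cauchy_locally u -> exists f, converges_locally u f.
Proof.
move=> cu; have cv x : cvg (u n x @[n --> \oo]).
  apply: cauchy_cvg; apply: cauchy_exP => e e0.
  have [N HN] := cu `|x| (e / 2) (divr_gt0 e0 (ltr0n R 2)).
  exists (u N x); exists N => // n /= Nn.
  rewrite /ball /=; apply: le_lt_trans (HN N n (leqnn N) Nn x (lexx _)) _.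
  by rewrite ltr_pdivrMr // mulr_natr mulr2n ltrDl.
exists (fun x => lim (u n x @[n --> \oo])) => r e e0.
have [N HN] := cu r e e0; exists N => n Nn x xr.
apply/ler_addgt0Pr => d d0.
have /cvgrPdist_le/(_ d d0)[N' _ HN'] := cv x.
have H1 := HN n (maxn N N') Nn (leq_maxl _ _) x xr.
have := HN' (maxn N N') (leq_maxr _ _); rewrite distrC => H2.
by apply: le_trans (ler_distD (u (maxn N N') x) _ _) (lerD H1 H2).
Qed.

Lemma converges_continuous u f : (forall n, continuous (u n)) ->
  converges_locally u f -> continuous f.
Proof.
move=> cu uf x; apply: ((@cvgrPdist_le _ _ _ (nbhs x) _ f (f x)).2) => e e0.
have e3 : 0 < e / 3 by rewrite divr_gt0.
have [N HN] := uf (`|x| + 1) (e / 3) e3.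
have H : \forall y \near x, `|u N x - u N y| <= e / 3.
  exact: ((@cvgrPdist_le _ _ _ (nbhs x) _ (u N) (u N x)).1 (cu N x) (e / 3) e3).
have H1 : \forall y \near x, `|x - y| <= 1.
  by apply/nbhs_ballP; exists 1 => //= y; rewrite -ball_normE /= => /ltW.
near=> y.
have yx : `|x - y| <= 1 by near: y.
have Hy : `|u N x - u N y| <= e / 3 by near: y.
have yr : `|y| <= `|x| + 1.
  by rewrite -[y](subKr x) (le_trans (ler_normB _ _)) // lerD2l.
have xr : `|x| <= `|x| + 1 by rewrite lerDl.
have Hx := HN N (leqnn N) x xr; have Hfy := HN N (leqnn N) y yr.
rewrite distrC in Hx.
apply: (le_trans (ler_distD (u N x) _ _)); apply: (@le_trans _ _ (e / 3 + (e / 3 + e / 3))).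
  by apply: lerD Hx (le_trans (ler_distD (u N y) _ _) (lerD Hy Hfy)).
lra.
Unshelve. all: by end_near.
Qed.

Lemma norm_delta_mx (i : 'I_q) : `|delta_mx ord0 i : V| <= 1.
Proof.
rewrite /Num.Def.normr /= mx_normrE; apply: bigmax_le => //= -[k l] _ /=.
by rewrite mxE; case: (_ && _); rewrite ?normr1 ?normr0.
Qed.

Lemma norm_line_le (t : R) (i : 'I_q) a : `|t *: (delta_mx ord0 i : V) + a| <= `|a| + `|t|.
Proof.
rewrite addrC (le_trans (ler_normD _ _)) // lerD2l normrZ ler_piMr //.
exact: norm_delta_mx.
Qed.

Lemma increment_le f a i (t K : R) : poly_fun f ->
  (forall x, `|x| <= `|a| + `|t| -> `|partial i f x| <= K) ->
  `|f (t *: delta_mx ord0 i + a) - f a| <= K * `|t|.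
Proof.
move=> pf HK; pose phi (s : R) := f (s *: delta_mx ord0 i + a).
have dphi (s : R) : is_derive s 1 phi (partial i f (s *: delta_mx ord0 i + a)).
  rewrite /partial; apply: (@is_derive_line R V f a (delta_mx ord0 i) s).
  exact: pol_derivable.
have cphi (b c : R) : {within `[b, c], continuous phi}.
  apply: derivable_within_continuous => s _.
  exact: (@ex_derive _ _ _ _ _ _ _ (dphi s)).
have E0 : f a = phi 0 by rewrite /phi scale0r add0r.
rewrite E0 -/(phi t).
have bnd (s : R) : `|s| <= `|t| -> `|partial i f (s *: delta_mx ord0 i + a)| <= K.
  by move=> st; apply: HK; apply: le_trans (norm_line_le _ _ _) _; rewrite lerD2l.
case: (ltgtP 0 t) => t0.
- have [s] := MVT t0 (fun s _ => dphi s) (cphi 0 t).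
  rewrite in_itv /= subr0 => /andP[s0 st] ->.
  rewrite normrM ler_wpM2r // bnd // !gtr0_norm //; exact: ltW.
- have [s] := MVT t0 (fun s _ => dphi s) (cphi t 0).
  rewrite in_itv /= sub0r => /andP[ts s0]; rewrite distrC => ->.
  rewrite normrM normrN ler_wpM2r // bnd // !ltr0_norm // lerN2; exact: ltW.
- by rewrite -t0 subrr normr0 mulr0.
Qed.

Definition harmonic_pol f := poly_fun f /\ laplacian f = (fun=> 0).

Lemma harmonic_polB f g : harmonic_pol f -> harmonic_pol g ->
  harmonic_pol (fun x => f x - g x).
Proof.
move=> [pf lf] [pg lg]; split; first exact: polB.
by rewrite laplacianB // lf lg; apply/funext => x; rewrite subrr.
Qed.

Lemma harmonic_pol_partial i f : harmonic_pol f -> harmonic_pol (partial i f).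
Proof.
move=> [pf lf]; split; first exact: pol_partial.
by rewrite laplacian_partial // lf partial_cst.
Qed.

Lemma converges_cauchy u f : converges_locally u f -> cauchy_locally u.
Proof.
move=> uf r e e0; have [N HN] := uf r (e / 2) (divr_gt0 e0 (ltr0n R 2)).
exists N => n m Nn Nm x xr; apply: le_trans (ler_distD (f x) _ _) _.
have := HN n Nn x xr; have := HN m Nm x xr; rewrite (distrC (u m x)); lra.
Qed.

(** The gradient of a harmonic polynomial at a point is bounded by its values on a
    ball of radius 1 around it. *)
Lemma partial_cauchy u i : (0 < q)%N -> (forall n, harmonic_pol (u n)) ->
  cauchy_locally u -> cauchy_locally (fun n => partial i (u n)).
Proof.
move=> q0 hu cu r e e0; have Q0 : 0 < q%:R :> R by rewrite ltr0n.
have [N HN] := cu (r + 1) (e / q%:R) (divr_gt0 e0 Q0).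
exists N => n m Nn Nm x xr.
have [pv lv] := harmonic_polB (hu n) (hu m).
have [[pn _] [pm _]] := (hu n, hu m).
have := @partial_bound R q i _ x (e / q%:R) q0 pv lv.
rewrite pol_partialB // [q%:R * _]mulrC divfK ?gt_eqF //; apply => y yx.
apply: HN => //; rewrite -[y](subrK x) (le_trans (ler_normD _ _)) //.
by rewrite addrC lerD.
Qed.

(** The increments of [u n - f] over a step [h] are at most [e / 3 * |h|] by the
    mean value theorem applied to [u n - u m], so the difference quotients of [f]
    are close to those of [u n]. *)
Lemma converges_partial u f i : (0 < q)%N -> (forall n, harmonic_pol (u n)) ->
  converges_locally u f ->
  has_partial i f /\ converges_locally (fun n => partial i (u n)) (partial i f).
Proof.
move=> q0 hu uf; have cu := converges_cauchy uf.
have cpu := @partial_cauchy u i q0 hu cu.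
have [g ug] := cauchy_locally_limit cpu.
suff dfg x : is_derive x (delta_mx ord0 i : V) f (g x).
  have -> : partial i f = g.
    by apply/funext => x; exact: (@derive_val _ _ _ _ _ _ _ (dfg x)).
  by split => // x; exact: (@ex_derive _ _ _ _ _ _ _ (dfg x)).
suff H : h^-1 *: ((f \o shift x) (h *: delta_mx ord0 i) - f x) @[h --> (0 : R)^'] --> g x.
  by split; [apply/cvg_ex; exists (g x)|exact: cvg_lim].
apply/cvgrPdist_le => e e0; have e3 : 0 < e / 3 by rewrite divr_gt0.
have [N1 HN1] := cpu (`|x| + 1) (e / 3) e3.
have [N2 HN2] := ug `|x| (e / 3) e3.
pose n := maxn N1 N2.
have Hn2 : `|partial i (u n) x - g x| <= e / 3 by apply: HN2; rewrite ?leq_maxr.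
have incr (h : R) : `|h| <= 1 ->
    `|(u n (h *: delta_mx ord0 i + x) - u n x) - (f (h *: delta_mx ord0 i + x) - f x)|
      <= e / 3 * `|h|.
  move=> h1; set y := _ + x.
  have lim : `|(u n y - u n x) - (u m y - u m x)| @[m --> \oo] -->
             `|(u n y - u n x) - (f y - f x)|.
    apply: cvg_norm; apply: cvgB; first exact: cvg_cst.
    by apply: cvgB; exact: converges_pointwise.
  rewrite -(cvg_lim _ lim) //; apply: limr_le; first by apply/cvg_ex; eexists; exact: lim.
  exists N1 => // m /= N1m.
  have [pv _] := harmonic_polB (hu n) (hu m).
  have [[pn _] [pm _]] := (hu n, hu m).
  rewrite (_ : _ - _ - _ = (u n y - u m y) - (u n x - u m x)); last first.
    by move: (u n y) (u n x) (u m y) (u m x) => *; ring.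
  apply: (increment_le pv) => z zx; rewrite pol_partialB //.
  apply: HN1 => //; first exact: leq_maxl.
  by rewrite (le_trans zx) // lerD2l.
have /cvgrPdist_le/(_ (e / 3) e3) D : h^-1 *: ((u n \o shift x) (h *: delta_mx ord0 i) - u n x)
    @[h --> (0 : R)^'] --> partial i (u n) x.
  by case: (hu n) => pn _; exact: (pol_derivable pn).
have Hh1 : \forall h \near (0 : R)^', `|h| <= 1.
  exact: dnbhs0_le.
have Hh0 : \forall h \near (0 : R)^', h != 0 by exact: nbhs_dnbhs_neq.
near=> h.
have h1 : `|h| <= 1 by near: h.
have h0 : h != 0 by near: h.
have Dh : `|partial i (u n) x - h^-1 *: (u n (h *: delta_mx ord0 i + x) - u n x)| <= e / 3.
  by near: h.
have Ih := incr h h1.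
rewrite /=; move: Dh Ih.
move: (u n (h *: _ + x) - u n x) (f (h *: _ + x) - f x) => A B Dh Ih.
have H3 : `|h^-1 *: A - h^-1 *: B| <= e / 3.
  rewrite -scalerBr normrZ normrV ?unitfE // mulrC ler_pdivrMr ?normr_gt0 //.
rewrite distrC in Hn2.
apply: (le_trans (ler_distD (partial i (u n) x) _ _)).
apply: (@le_trans _ _ (e / 3 + (e / 3 + e / 3))); last by lra.
by apply: lerD Hn2 (le_trans (ler_distD (h^-1 *: A) _ _) (lerD Dh H3)).
Unshelve. all: by end_near.
Qed.

Lemma converges_harmonic u f : (0 < q)%N -> (forall n, harmonic_pol (u n)) ->
  converges_locally u f -> harmonic_fun f.
Proof.
move=> q0 hu uf.
have C v g : (forall n, harmonic_pol (v n)) -> converges_locally v g -> continuous g.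
  by move=> hv; apply: converges_continuous => n; case: (hv n) => /pol_continuous.
have D i := converges_partial i q0 hu uf.
have hp i n := harmonic_pol_partial i (hu n).
have DD i j := converges_partial j q0 (hp i) (D i).2.
have hpp i j n := harmonic_pol_partial j (hp i n).
split; [split|].
- exact: C hu uf.
- by move=> i; split; [exact: (D i).1|exact: C (hp i) (D i).2].
- by move=> i j; split; [exact: (DD i j).1|exact: C (hpp i j) (DD i j).2].
move=> x; have lim : \sum_i partial i (partial i (u n)) x @[n --> \oo] --> laplacian f x.
  apply: cvg_finsum => i; exact: converges_pointwise (DD i i).2.
rewrite -(cvg_lim _ lim) //.
have -> : (fun n => \sum_i partial i (partial i (u n)) x) = (fun=> 0).
  by apply/funext => n; case: (hu n) => _ /(congr1 (@^~ x)).
exact: lim_cst.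
Qed.

End HarmonicLimits.

(** * From log-tropical weights to harmonic maps *)

Section EuclideanNorm.
Context {R : realType} {q : nat}.
Local Notation V := 'rV[R]_q.
Implicit Types (x y : V).

Lemma euclid_ge0 x : 0 <= euclid x.
Proof. exact: sqrtr_ge0. Qed.

Lemma euclid_sqr x : euclid x ^+ 2 = sqnorm x.
Proof. by rewrite sqr_sqrtr // sqnorm_ge0. Qed.

Lemma coord_le_euclid x i : `|x ord0 i| <= euclid x.
Proof.
rewrite -(@ler_pXn2r _ 2) ?nnegrE ?euclid_ge0 // real_normK ?num_real //.
by rewrite euclid_sqr coord_sqr_le.
Qed.

Lemma euclid_le (c : R) x : (forall i, `|x ord0 i| <= c) -> euclid x <= q%:R * c.
Proof.
move=> H; case: q x H => [|n] x H.
  by rewrite /euclid big_ord0 sqrtr0 mul0r.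
have c0 : 0 <= c := le_trans (normr_ge0 _) (H ord0).
rewrite -(@ler_pXn2r _ 2) ?nnegrE ?mulr_ge0 ?sqrtr_ge0 // sqr_sqrtr; last first.
  by apply: sumr_ge0 => i _; exact: sqr_ge0.
apply: (@le_trans _ _ (\sum_(i < n.+1) c ^+ 2)).
  apply: ler_sum => i _; rewrite -[_ ^+ 2]real_normK ?num_real //.
  by apply: lerXn2r; rewrite ?nnegrE.
rewrite sumr_const card_ord exprMn -[c ^+ 2 *+ _]mulr_natl ler_wpM2r ?sqr_ge0 //.
by rewrite -natrX ler_nat leq_pmulr.
Qed.

Lemma coord_le_norm x i : `|x ord0 i| <= `|x|.
Proof.
by rewrite [leRHS]/Num.Def.normr /= mx_normrE; apply: (le_bigmax _ _ (ord0, i)).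
Qed.

Lemma euclid_continuous : continuous (@euclid R q).
Proof.
move=> x; apply: (@continuous_comp _ _ _ (@sqnorm R q) (@Num.sqrt R)).
  exact: (pol_continuous pol_sqnorm).
exact: sqrt_continuous.
Qed.

Lemma weight_continuous (v : R -> R) : weight v -> continuous (fun y : V => v (euclid y)).
Proof.
move=> [_ _ /subspace_continuousP cv _] y.
have ey : `[0, +oo[%classic (euclid y) by rewrite /= in_itv /= euclid_ge0.
move=> P /= nP.
have H := cv (euclid y) ey P nP.
have {}H : nbhs (euclid y) [set t | `[0, +oo[%classic t -> P (v t)] by exact: H.
have ez (z : V) : `[0, +oo[%classic (euclid z) by rewrite /= in_itv /= euclid_ge0.
exact: (@filterS _ (nbhs y) _ (fun z => `[0, +oo[%classic (euclid z) -> P (v (euclid z)))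
  (fun z => P (v (euclid z))) (fun z Hz => Hz (ez z)) (@euclid_continuous y _ H)).
Qed.

End EuclideanNorm.

Section Tropical.
Context {R : realType}.

(** The factor 1/2 accounts for the supremum not being attained a priori. *)
Lemma log_tropical_monomials (v : R -> R) : weight v -> log_tropical v ->
  exists B : nat -> R, [/\ forall j, 0 <= B j,
    forall r j, 0 < r -> B j * r ^+ j <= v r &
    forall r, 0 < r -> exists j, v r / 2 <= B j * r ^+ j].
Proof.
move=> [v0 _ _ _] [E [b H]].
have lnE (r : R) : 0 < r -> let S := [set b j + j%:R * ln r | j in E] in
    has_sup S /\ ln (v r) = sup S.
  by move=> r0; have := H (ln r); rewrite lnK ?posrE.
have term j r : 0 < r -> expR (b j) * r ^+ j = expR (b j + j%:R * ln r).
  by move=> r0; rewrite expRD expRM_natl lnK ?posrE.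
exists (fun j => if `[< E j >] then expR (b j) else 0); split.
- by move=> j; case: asboolP => // _; exact: expR_ge0.
- move=> r j r0; have vr := v0 r (ltW r0).
  case: asboolP => Ej; last by rewrite mul0r ltW.
  have [hs vE] := lnE r r0.
  rewrite term // -[v r]lnK ?posrE // ler_expR vE.
  by apply: sup_upper_bound => //; exists j.
- move=> r r0; have vr := v0 r (ltW r0); have [hs vE] := lnE r r0.
  have l2 : 0 < ln (2 : R) by rewrite ln_gt0 // ltr1n.
  have [_ [j Ej <-] Hj] := sup_adherent l2 hs.
  exists j; case: asboolP => // _; rewrite term //.
  have -> : v r / 2 = expR (ln (v r) - ln 2) by rewrite expRB !lnK ?posrE.
  by rewrite ler_expR vE ltW.
Qed.

(** The components of the map are the series of [a_p H_(j_p)] over the residue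
    classes of [p]. *)
Lemma tropical_approximable q (w v : R -> R) : (2 <= q)%N -> ~~ odd q ->
  weight v -> log_tropical v -> equivalent `[0, +oo[ w v -> harmonic_approximable q w.
Proof.
move=> q2 qev wv /(log_tropical_monomials wv)[B [B0 Bv vB]] [C1 [C2 [C10 C20 wCv]]].
have [v0 _ _ _] := wv.
have q0 : (0 < q)%N := ltnW q2.
have e2 : q./2.*2 = q by rewrite even_halfK.
have e0 : (0 < q./2)%N by rewrite half_gt0.
have rE (x : 'rV[R]_q) : radius q./2 x = euclid x.
  rewrite /radius /euclid; congr (Num.sqrt _); apply: eq_bigl => i.
  by rewrite e2 ltn_ord.
have [|I [c1 [c2 [c10 c20 /choice[H bH]]]]] := @exists_blocks R q q./2 e0.
  by rewrite e2.
have [j [a [a0 aB peak]]] : exists (j : nat -> nat) (a : nat -> R),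
  [/\ forall p, 0 <= a p,
      forall p, a p = 0 \/ a p = B (j p) /\ (p <= j p)%N &
      forall t, 0 < t -> exists d,
        (forall i, B i * t ^+ i <= 16 * (a d * t ^+ j d)) /\
        (forall p, 4 ^+ ndist p d * (a p * t ^+ j p) <= 256 * (a d * t ^+ j d))].
  apply: peak_sequence => //.
    have [k] := vB 1 ltr01; rewrite expr1n mulr1 => Hk; exists k.
    by apply: lt_le_trans Hk; rewrite divr_gt0 // v0.
  by move=> r r0; exists (v r) => k; exact: Bv.
have aT t p : 0 < t -> a p * t ^+ j p <= v t.
  move=> t0; case: (aB p) => [->|[-> _]]; last exact: Bv.
  by rewrite mul0r ltW // v0 // ltW.
have [M0 HM0] := @exists_exp2_gt R (2048 * c2 / c1).
pose M := M0.+1.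
have HM : 2048 * c2 <= c1 * 2 ^+ M.
  by rewrite [leRHS]mulrC -ler_pdivrMr // (le_trans (ltW HM0)) // ler_eXn2l ?ltr1n.
pose K : finType := ('I_M * I)%type.
pose g s p (x : 'rV[R]_q) := a p * H (j p) s x.
pose u (k : K) n x := \sum_(p < n | (p %% M == k.1)%N) g k.2 p x.
have pg s p : harmonic_pol (g s p).
  case: (bH (j p)) => /(_ s)[pH lH] _ _ _; split; first exact: polZ.
  by rewrite laplacianZ // lH; apply/funext => x; rewrite mulr0.
have hu k n : harmonic_pol (u k n).
  split; first by apply: pol_sum => p _; case: (pg k.2 p).
  rewrite laplacian_sum => [|p _]; last by case: (pg k.2 p).
  by apply/funext => x; rewrite big1 // => p _; case: (pg k.2 p) => _ ->.
have gle s p x : `|g s p x| <= c2 * (a p * euclid x ^+ j p).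
  rewrite /g normrM (ger0_norm (a0 p)) [leRHS]mulrCA ler_wpM2l // -rE.
  by case: (bH (j p)) => _ _ + _; apply.
have cu k : cauchy_locally (u k).
  move=> r e eps0; pose t := q%:R * `|r| + 1.
  have t0 : 0 < t by rewrite ltr_wpDl // mulr_ge0.
  have [d [_ decd]] := peak t t0.
  pose T p := a p * t ^+ j p.
  have T0 p : 0 <= T p by rewrite mulr_ge0 // exprn_ge0 // ltW.
  have [L HL] := @exists_exp2_gt R (1024 * (c2 * T d) / e).
  have tail n m x : (d + L <= n)%N -> (n <= m)%N -> `|x| <= r -> `|u k m x - u k n x| <= e.
    move=> dn nm xr.
    have xt : euclid x <= t.
      apply: (@le_trans _ _ (q%:R * `|r|)); last by rewrite lerDl.
      apply: euclid_le => i; apply: le_trans (coord_le_norm x i) _.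
      exact: le_trans xr (ler_norm r).
    have gT p : `|g k.2 p x| <= c2 * T p.
      apply: le_trans (gle _ _ _) _; apply: ler_wpM2l; first exact: ltW.
      by apply: ler_wpM2l => //; apply: lerXn2r; rewrite ?nnegrE ?euclid_ge0 // ltW.
    have -> : u k m x - u k n x =
        \sum_(p < m | (p %% M == k.1)%N && (n <= p)%N) g k.2 p x.
      rewrite /u -!(big_mkord (fun p => p %% M == k.1)%N (fun p => g k.2 p x)).
      rewrite (big_cat_nat (n := n)) //= addrC addrK.
      rewrite big_nat_cond -(big_mkord (fun p => (p %% M == k.1)%N && (n <= p)%N) (fun p => g k.2 p x)).
      rewrite [RHS](big_cat_nat (n := n)) //= [X in _ = X + _]big_nat_cond.
      rewrite [X in _ = X + _]big_pred0 ?add0r => [|p]; last first.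
        by case: (ltnP p n) => pn; rewrite ?andbF // leqNgt pn !andbF.
      rewrite [RHS]big_nat_cond; apply: eq_bigl => p.
      by case: (ltnP p n) => pn; rewrite ?andbF ?andbT // leqNgt pn.
    have := @peak_tail R T (fun p => g k.2 p x) d m c2 T0 decd gT
      (fun p => (p %% M == k.1)%N && (n <= p)%N) L.
    have Q p : (p %% M == k.1)%N && (n <= p)%N -> (L <= ndist p d)%N.
      by move=> /andP[_ np]; rewrite /ndist; move: dn np; clear; lia.
    move=> /(_ Q) H1.
    rewrite -(ler_pM2l (exprn_gt0 L (ltr0n R 2))); apply: le_trans H1 _.
    by rewrite -ler_pdivrMr // ltW.
  exists (d + L)%N => n m Nn Nm x xr.
  case: (leqP n m) => nm; first by rewrite distrC; apply: tail.
  by apply: tail => //; exact: ltnW.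
have /choice[h uh] k : exists f, converges_locally (u k) f.
  exact: cauchy_locally_limit (cu k).
have hh k : harmonic_fun (h k) := converges_harmonic q0 (hu k) (uh k).
have ch k : continuous (h k) by case: (hh k) => -[].
have near_u k x e : 0 < e -> exists N, forall n, (N <= n)%N -> `|u k n x - h k x| <= e.
  by move=> eps0; have [N HN] := uh k `|x| e eps0; exists N => n /HN; apply.
have bounds x : generic x ->
    (forall k, `|h k x| <= 1024 * c2 * v (euclid x)) /\
    exists k, c1 / 64 * v (euclid x) <= `|h k x|.
  move=> gx; have t0 : 0 < euclid x.
    apply: lt_le_trans (coord_le_euclid x (Ordinal q0)).
    by rewrite normr_gt0.
  have [d [domd decd]] := peak _ t0.
  pose T p := a p * euclid x ^+ j p.
  have T0 p : 0 <= T p by rewrite mulr_ge0 // exprn_ge0 // ltW.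
  split=> [k|].
    apply/ler_addgt0Pr => e eps0; have [N HN] := near_u k x e eps0.
    have := @peak_class_le R T (fun p => g k.2 p x) d N c2 T0 decd
      (fun p => gle k.2 p x) (fun p => (p %% M == k.1)%N).
    rewrite -/(u k N x) => H1; have H2 := HN N (leqnn N).
    have H3 : 1024 * (c2 * T d) <= 1024 * c2 * v (euclid x).
      rewrite -mulrA; apply: ler_wpM2l; first exact: ler0n.
      by rewrite ler_pM2l //; exact: aT.
    have := ler_distD (u k N x) (h k x) 0; rewrite !subr0 => H4.
    apply: le_trans H4 _; rewrite addrC; apply: lerD; first exact: le_trans H1 H3.
    by rewrite distrC.
  have [s Hs] : exists s, c1 * euclid x ^+ j d <= `|H (j d) s x|.
    by case: (bH (j d)) => _ _ _ /(_ x)[s]; rewrite rE; exists s.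
  have Md : (d %% M < M)%N by rewrite ltn_mod.
  exists (Ordinal Md, s).
  apply/ler_addgt0Pr => e eps0; have [N HN] := near_u (Ordinal Md, s) x e eps0.
  have gd : c1 * T d <= `|g s d x|.
    by rewrite /g normrM (ger0_norm (a0 d)) [leLHS]mulrCA ler_wpM2l.
  have dn : (d < maxn N d.+1)%N by exact: leq_maxr.
  have := @peak_class_ge R T (fun p => g s p x) d (maxn N d.+1) c2 T0 decd
    (fun p => gle s p x) c1 M (ltn0Sn _) dn gd HM.
  have -> : \sum_(p < maxn N d.+1 | (p %% M == d %% M)%N) g s p x =
    u (Ordinal Md, s) (maxn N d.+1) x by [].
  have H2 := HN (maxn N d.+1) (leq_maxl _ _).
  have [i Hi] := vB _ t0; have Hd := le_trans Hi (domd i).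
  have Hv : c1 / 64 * v (euclid x) <= c1 / 2 * T d.
    have : c1 * (v (euclid x) / 2) <= c1 * (16 * T d) by rewrite ler_pM2l.
    by clear; move: (v (euclid x)) (T d) => *; lra.
  move=> /(le_trans Hv) H1; apply: le_trans H1 _.
  have := ler_distD (h (Ordinal Md, s) x) (u (Ordinal Md, s) (maxn N d.+1) x) 0.
  rewrite !subr0 => H4; apply: le_trans H4 _; rewrite addrC; exact: lerD.
have cv c : continuous (fun x : 'rV[R]_q => c * v (euclid x)).
  exact: (@continuous_scaled_exp R _ _ c 1 (weight_continuous wv)).
have upper k x : `|h k x| <= 1024 * c2 * v (euclid x).
  exact: (@ler_generic R q (fun z => `|h k z|) (fun z => 1024 * c2 * v (euclid z))
    (continuous_normr (ch k)) (cv _) (fun y gy => (bounds y gy).1 k)).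
have lower x : exists k, c1 / 64 * v (euclid x) <= `|h k x|.
  exact: (@exists_ler_generic R q K h (fun z => c1 / 64 * v (euclid z))
    ch (cv _) (fun y gy => (bounds y gy).2)).
have K0 : (0 < #|K|)%N by have [k _] := lower 0; apply/card_gt0P; exists k.
exists #|K|; split => //.
exists (fun y => \row_i h (enum_val i) y); split.
  move=> i; rewrite (_ : (fun y => _) = h (enum_val i)) //.
  by apply/funext => y; rewrite mxE.
have n0 : 0 < #|K|%:R :> R by rewrite ltr0n.
pose c := #|K|%:R * (1024 * c2).
have cc0 : 0 < c.
  by apply: mulr_gt0; [exact: n0|apply: mulr_gt0; [rewrite ltr0n|exact: c20]].
have c64 : 0 < c1 / 64 by apply: divr_gt0; [exact: c10|rewrite ltr0n].
have C264 : 0 < C1 * (c1 / 64) := mulr_gt0 C10 c64.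
exists ((c * C2)^-1), ((C1 * (c1 / 64))^-1); split.
- by rewrite invr_gt0; exact: mulr_gt0 cc0 C20.
- by rewrite invr_gt0; exact: C264.
move=> y _; have ey : `[0, +oo[%classic (euclid y) by rewrite /= in_itv /= euclid_ge0.
have [w1 w2] := wCv _ ey; rewrite /radial; split.
  rewrite (ler_pdivrMl _ _ (mulr_gt0 cc0 C20)); apply: (@le_trans _ _ (c * v (euclid y))).
    rewrite /c -mulrA; apply: euclid_le => i; rewrite mxE; exact: upper.
  by rewrite -[c * C2 * _]mulrA (ler_pM2l cc0).
rewrite (ler_pdivlMl _ _ C264); have [k Hk] := lower y.
apply: (@le_trans _ _ (c1 / 64 * v (euclid y))).
  by rewrite mulrAC [leLHS]mulrC (ler_pM2l c64).
apply: le_trans Hk _.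
have := coord_le_euclid (\row_i h (enum_val i) y) (enum_rank k).
by rewrite mxE enum_rankK.
Qed.
End Tropical.

(** * The Weierstrass approximation theorem in several variables *)

Section Weierstrass.
Context {R : realType} {q : nat}.
Local Notation V := 'rV[R]_q.
Implicit Types (f g : V -> R) (x y z : V) (k : 'I_q -> nat) (s : seq 'I_q).

Definition cube (r : R) : set V := [set x | forall i, `[- r, r]%classic (x ord0 i)].

Lemma cubeP r x : cube r x <-> forall i, `|x ord0 i| <= r.
Proof. by split=> H i; have := H i; rewrite /= in_itv /= ler_norml. Qed.

Lemma cube_compact r : compact (cube r).
Proof.
by apply: (@rV_compact R q (fun=> `[- r, r]%classic)) => i; exact: segment_compact.
Qed.

Lemma norm_sqr_le_sqnorm x : `|x| ^+ 2 <= sqnorm x.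
Proof.
have H : `|x| <= Num.sqrt (sqnorm x).
  by apply: norm_le_sqnorm; rewrite ?sqrtr_ge0 // sqr_sqrtr ?sqnorm_ge0.
by rewrite -[leRHS]sqr_sqrtr ?sqnorm_ge0 //; apply: lerXn2r; rewrite ?nnegrE ?sqrtr_ge0.
Qed.

(** Uniform continuity in the form in which second moments can be used: points
    close to each other contribute at most [e], and for the others the quadratic
    term exceeds the oscillation of [f]. *)
Lemma quadratic_modulus f (r e : R) : continuous f -> 0 < e ->
  exists C : nat, forall x z, cube r x -> cube r z ->
    `|f z - f x| <= e + C%:R * sqnorm (z - x).
Proof.
move=> cf e0.
have [M HM] : exists M : R, forall z, cube r z -> `|f z| <= M.
  have [[z0 Kz0]|ne] := pselect (cube r !=set0); last first.
    by exists 0 => z Kz; exfalso; apply: ne; exists z.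
  have [c _ Hc] := EVT_max_rV (ex_intro _ z0 Kz0) (@cube_compact r)
    (continuous_subspaceT (continuous_normr cf)).
  by exists `|f c| => z Kz; apply: Hc; rewrite inE.
pose P (n : nat) x := forall z, cube r z -> `|f z - f x| <= e + n%:R * sqnorm (z - x).
suff : \forall n \near \oo, cube r `<=` P n.
  by move=> [N _ /(_ N (leqnn N)) HN]; exists N => x z Kx; exact: HN.
move/compact_near_coveringP: (@cube_compact r); apply => x Kx.
have : \forall y \near x, `|f x - f y| <= e / 2.
  exact: ((@cvgrPdist_le _ _ _ (nbhs x) _ f (f x)).1 (cf x) (e / 2) (divr_gt0 e0 (ltr0n R 2))).
move=> /nbhs_ballP[d /= d0 Hd].
pose N := Num.bound ((2 * `|M| + e) / (d / 2) ^+ 2).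
have nx : nbhs x (ball x (d / 2)) by apply: nbhsx_ballx; rewrite divr_gt0.
exists (ball x (d / 2), [set n | (N <= n)%N]).
  by split => //=; exists N.
move=> [x' n] [/= Hx' Nn] z Kz.
have xx' : `|x - x'| < d / 2 by move: Hx'; rewrite -ball_normE.
have xd : ball x d x' by rewrite -ball_normE /=; apply: lt_trans xx' _; lra.
have Hfx' := Hd _ xd.
case: (ltP `|x - z| d) => xz.
  have Hfz : `|f x - f z| <= e / 2 by apply: Hd; rewrite -ball_normE.
  apply: (@le_trans _ _ e); last first.
    by rewrite lerDl mulr_ge0 // sqnorm_ge0.
  apply: le_trans (ler_distD (f x) _ _) _.
  by rewrite [`|f z - _|]distrC; move: Hfz Hfx'; lra.
have zx' : d / 2 <= `|z - x'|.
  have := ler_distD x' x z; rewrite (distrC x' z) => H1.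
  by move: xz xx' H1; lra.
have H2 : (d / 2) ^+ 2 <= sqnorm (z - x').
  apply: le_trans (norm_sqr_le_sqnorm _); apply: lerXn2r; rewrite ?nnegrE //.
  by rewrite divr_ge0 // ltW.
have d2 : 0 < (d / 2) ^+ 2 by rewrite exprn_gt0 // divr_gt0.
have H3 : 2 * `|M| + e <= n%:R * sqnorm (z - x').
  apply: (@le_trans _ _ (n%:R * (d / 2) ^+ 2)); last by rewrite ler_wpM2l.
  rewrite -ler_pdivrMr //; apply: (@le_trans _ _ N%:R); last by rewrite ler_nat.
  apply: ltW; apply: archi_boundP; rewrite divr_ge0 ?(ltW d2) // addr_ge0 // ?mulr_ge0 //.
  exact: ltW.
have fz : `|f z| <= `|M| by apply: le_trans (HM z Kz) (ler_norm M).
have fx : `|f x| <= `|M| by apply: le_trans (HM x Kx) (ler_norm M).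
have H4 := ler_normB (f z) (f x).
have H5 := ler_distD (f x) (f z) (f x').
by move: H3 fz fx H4 H5 Hfx'; lra.
Qed.

Definition bump_at (i : 'I_q) k : 'I_q -> nat := fun l => (k l + (l == i))%N.

(** The expectation of [phi] after a random walk on the lattice that starts at [k]
    and attempts one step along the axis [i], with probability [y_i], for each
    entry [i] of [s].  With [n] entries for each axis this is the Bernstein
    operator. *)
Fixpoint walk s (phi : ('I_q -> nat) -> R) k y : R :=
  if s is i :: s' then
    y ord0 i * walk s' phi (bump_at i k) y + (1 - y ord0 i) * walk s' phi k y
  else phi k.

Definition unit_cube y := forall i, 0 <= y ord0 i <= 1.

Lemma walk_le s phi psi k y : unit_cube y -> (forall l, phi l <= psi l) ->
  walk s phi k y <= walk s psi k y.
Proof.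
move=> y01 H; elim: s k => [|i s IH] k //=.
have /andP[y0 y1] := y01 i.
by apply: lerD; apply: ler_wpM2l => //; rewrite subr_ge0.
Qed.

Lemma walkD s phi psi k y :
  walk s (fun l => phi l + psi l) k y = walk s phi k y + walk s psi k y.
Proof.
by elim: s k => [|i s IH] k //=; rewrite !IH !mulrDr addrACA.
Qed.

Lemma walkZ s c phi k y : walk s (fun l => c * phi l) k y = c * walk s phi k y.
Proof.
elim: s k => [|i s IH] k //=; rewrite !IH.
by rewrite mulrCA [X in _ + X]mulrCA -mulrDr.
Qed.

Lemma walk_cst s c k y : walk s (fun=> c) k y = c.
Proof. by elim: s k => [|i s IH] k //=; rewrite !IH; ring. Qed.

Lemma walk_sum s (I : finType) (phi : I -> _ -> R) k y :
  walk s (fun l => \sum_i phi i l) k y = \sum_i walk s (phi i) k y.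
Proof.
elim: s k => [|j s IH] k //=; rewrite !IH !mulr_sumr -big_split.
by apply: eq_bigr.
Qed.

(** Squared bias plus the variance of a sum of independent Bernoulli variables. *)
Lemma walk_second_moment s i (a : R) k y :
  walk s (fun l => ((l i)%:R - a) ^+ 2) k y =
  ((k i)%:R + (count_mem i s)%:R * y ord0 i - a) ^+ 2 +
  (count_mem i s)%:R * y ord0 i * (1 - y ord0 i).
Proof.
elim: s k => [|j s IH] k /=; first by rewrite !mul0r !addr0.
rewrite !IH /bump_at; have [->|ji] := eqVneq j i.
  rewrite /= !natrD mulr1n.
  by move: (_%:R) (_%:R) (y ord0 i) => *; ring.
rewrite /= addn0 add0n; move: (_%:R) (_%:R) (y ord0 i) (y ord0 j) => *; ring.
Qed.

(** Bernstein's proof: the expectation of [f] at the rescaled end point of the walk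
    is a polynomial in [y], and the variance of that end point is of order
    [1 / n]. *)
Lemma weierstrass_approximation f (r e : R) : continuous f -> 0 < r -> 0 < e ->
  exists2 p, poly_fun p & forall x, cube r x -> `|f x - p x| <= e.
Proof.
move=> cf r0 e0.
have e2 : 0 < e / 2 by rewrite divr_gt0.
have [C HC] := @quadratic_modulus f r (e / 2) cf e2.
pose n := (Num.bound (C%:R * q%:R * r ^+ 2 / (e / 2))).+1.
have n0 : 0 < n%:R :> R by rewrite ltr0n.
have Hn : C%:R * q%:R * r ^+ 2 / n%:R <= e / 2.
  rewrite ler_pdivrMr // [leRHS]mulrC -ler_pdivrMr //.
  apply: ltW; apply: (@lt_le_trans _ _ (Num.bound (C%:R * q%:R * r ^+ 2 / (e / 2)))%:R).
    apply: archi_boundP; apply: divr_ge0; last exact: ltW.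
    by apply: mulr_ge0; [exact: mulr_ge0|exact: sqr_ge0].
  by rewrite ler_nat leqnSn.
pose s := flatten (nseq n (enum 'I_q)).
have cs i : count_mem i s = n.
  rewrite count_flatten map_nseq sumn_nseq.
  by rewrite (count_uniq_mem i (enum_uniq _)) mem_enum mul1n.
(* The coordinates are truncated at [n] to keep all nodes in the cube; this only
   decreases the distance to points of the cube. *)
pose node k : V := \row_i (2 * r * (minn (k i) n)%:R / n%:R - r).
have Knode k : cube r (node k).
  apply/cubeP => i; rewrite mxE ler_norml.
  have : 0 <= ((minn (k i) n)%:R / n%:R : R) <= 1.
    by rewrite divr_ge0 //= ler_pdivrMr // mul1r ler_nat geq_minr.
  rewrite -[2 * r * _ / _]mulrA; move: (_ / n%:R) => t /andP[t0 t1].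
  have : 0 <= r * t by rewrite mulr_ge0 // ltW.
  have : r * t <= r by rewrite ger_pMr.
  by move=> H1 H2; apply/andP; split; nra.
(* [Y] maps the cube onto the unit cube. *)
pose Y x : V := \row_i ((2 * r)^-1 * x ord0 i + 2^-1).
pose W := walk s (fun k => f (node k)) (fun=> 0%N).
have pW : poly_fun (fun x => W (Y x)).
  rewrite /W; elim: s (fun=> 0%N) {W cs} => [|i s IH] k /=; first exact: pol_cst.
  have pY : poly_fun (fun x => Y x ord0 i).
    rewrite (_ : (fun x => _) = fun x => (2 * r)^-1 * x ord0 i + 2^-1); last first.
      by apply/funext => x; rewrite mxE.
    exact: polD (polZ _ (pol_coord i)) (pol_cst _).
  by apply: polD; apply: polM => //; exact: polB (pol_cst _) pY.
exists (fun x => W (Y x)) => // x Kx.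
have Yx i : x ord0 i = 2 * r * Y x ord0 i - r.
  rewrite mxE; move: (x ord0 i) => t; field.
  by rewrite gt_eqF.
have Y01 : unit_cube (Y x).
  move=> i; have := (cubeP r x).1 Kx i; rewrite Yx ler_norml.
  move: (Y x ord0 i) => t /andP[H1 H2].
  have H3 : 0 <= 2 * r * t by lra.
  have H4 : r * (t - 1) <= 0 by lra.
  move: H3; rewrite pmulr_rge0 ?mulr_gt0 // => -> /=.
  by move: H4; rewrite pmulr_rle0 // subr_le0.
have node_dist k : sqnorm (node k - x) <=
    (2 * r / n%:R) ^+ 2 * \sum_i ((k i)%:R - n%:R * Y x ord0 i) ^+ 2.
  rewrite mulr_sumr; apply: ler_sum => i _.
  rewrite [X in X ^+ 2](_ : _ = 2 * r / n%:R * ((minn (k i) n)%:R - n%:R * Y x ord0 i)); last first.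
    rewrite [LHS]mxE [(- x) _ _]mxE [node k _ _]mxE Yx.
    move: (Y x ord0 i) (minn _ _)%:R => t m; field.
    by rewrite gt_eqF.
  rewrite exprMn ler_wpM2l ?sqr_ge0 //.
  have /andP[t0 t1] := Y01 i; move: (Y x ord0 i) t0 t1 => t t0 t1.
  case: (leqP (k i) n) => [kn|/ltnW nk] //.
  have H1 : n%:R * t <= n%:R by rewrite ger_pMr.
  have H2 : n%:R <= (k i)%:R :> R by rewrite ler_nat.
  apply: lerXn2r; rewrite ?nnegrE; [by rewrite subr_ge0| |by rewrite lerD2r].
  by rewrite subr_ge0 (le_trans H1).
have E0 : f x = walk s (fun=> f x) (fun=> 0%N) (Y x) by rewrite walk_cst.
pose phi (k : 'I_q -> nat) := e / 2 + C%:R * ((2 * r / n%:R) ^+ 2 *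
   \sum_i ((k i)%:R - n%:R * Y x ord0 i) ^+ 2).
have Hphi k : `|f (node k) - f x| <= phi k.
  apply: le_trans (HC x (node k) Kx (Knode k)) _.
  by rewrite /phi lerD2l ler_wpM2l.
have Ephi : walk s phi (fun=> 0%N) (Y x) <= e.
  rewrite /phi walkD walk_cst !walkZ walk_sum.
  have -> : \sum_i walk s (fun k => ((k i)%:R - n%:R * Y x ord0 i) ^+ 2) (fun=> 0%N) (Y x) =
     \sum_i n%:R * (Y x ord0 i * (1 - Y x ord0 i)).
    apply: eq_bigr => i _; rewrite walk_second_moment cs.
    by rewrite add0r subrr expr0n add0r mulrA.
  have H1 : \sum_i n%:R * (Y x ord0 i * (1 - Y x ord0 i)) <= n%:R * q%:R / 4.
    apply: (@le_trans _ _ (\sum_(i < q) n%:R / 4)); last first.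
      by rewrite sumr_const card_ord -[(_ / 4) *+ _]mulr_natr mulrAC.
    apply: ler_sum => i _; rewrite ler_pM2l //.
    move: (Y x ord0 i) => t; have := sqr_ge0 (t - 2^-1); rewrite expr2; lra.
  have H2 : C%:R * ((2 * r / n%:R) ^+ 2 * (n%:R * q%:R / 4)) = C%:R * q%:R * r ^+ 2 / n%:R.
    by move: (C%:R) (q%:R) (n%:R) n0 => c Q m m0; field; rewrite gt_eqF.
  have H3 : C%:R * ((2 * r / n%:R) ^+ 2 *
      \sum_i n%:R * (Y x ord0 i * (1 - Y x ord0 i))) <= C%:R * q%:R * r ^+ 2 / n%:R.
    by rewrite -H2 ler_wpM2l // ler_wpM2l ?sqr_ge0.
  by move: H3 Hn; lra.
rewrite ler_norml; apply/andP; split.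
  have : W (Y x) <= walk s (fun k => f x + phi k) (fun=> 0%N) (Y x).
    apply: walk_le => // k; have := Hphi k; have := ler_norm (f (node k) - f x); lra.
  rewrite walkD walk_cst; lra.
have : f x <= walk s (fun k => f (node k) + phi k) (fun=> 0%N) (Y x).
  rewrite {1}E0; apply: walk_le => // k.
  by have := Hphi k; rewrite ler_norml => /andP[]; lra.
rewrite walkD -/(W (Y x)); lra.
Qed.

End Weierstrass.

(** * From harmonic maps to log-tropical weights *)

Section HarmonicApproximation.
Context {R : realType} {q : nat}.
Local Notation V := 'rV[R]_q.
Implicit Types (f p : V -> R) (x : V).

Lemma class_C2_affine c f p : class_C2 f -> poly_fun p ->
  class_C2 (fun x => c * f x + p x) /\
  forall x, laplacian (fun x => c * f x + p x) x = c * laplacian f x + laplacian p x.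
Proof.
have P1 i g r : has_partial i g -> poly_fun r ->
    has_partial i (fun x => c * g x + r x) /\
    partial i (fun x => c * g x + r x) = fun x => c * partial i g x + partial i r x.
  move=> dg pr.
  have dcg x : derivable (fun x => c * g x) x (delta_mx ord0 i).
    exact: (derivableM (derivable_cst c x _) (dg x)).
  split=> [x|]; first exact: (derivableD (dcg x) (@pol_derivable _ _ r pr x _)).
  apply/funext => x; rewrite /partial.
  rewrite (deriveD (dcg x) (@pol_derivable _ _ r pr x _)); congr (_ + _).
  have -> : 'D_(delta_mx ord0 i) (fun y => c * g y) x =
    c *: 'D_(delta_mx ord0 i) g x + g x *: 'D_(delta_mx ord0 i) (fun=> c) x.
    exact: (deriveM (derivable_cst c x _) (dg x)).
  by rewrite derive_cst scaler0 addr0.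
have C1 g r : continuous g -> poly_fun r -> continuous (fun x => c * g x + r x).
  move=> cg pr; apply: (@continuous_add _ _ (fun x => c * g x)).
    exact: (@continuous_scaled_exp R _ g c 1).
  exact: pol_continuous.
move=> [cf df ddf] pp; have pd i := pol_partial i pp.
have D i := P1 i f p (df i).1 pp.
have DD i j := P1 j _ _ (ddf i j).1 (pd i).
split; [split|].
- exact: C1.
- move=> i; split; first exact: (D i).1.
  by rewrite (D i).2; apply: C1; [exact: (df i).2|exact: pd].
- move=> i j; rewrite (D i).2; split; first exact: (DD i j).1.
  by rewrite (DD i j).2; apply: C1; [exact: (ddf i j).2|exact/pol_partial/pd].
move=> x; rewrite /laplacian mulr_sumr -big_split; apply: eq_bigr => i _.
by rewrite (D i).2 (DD i i).2.
Qed.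

(** Approximate [f] by a polynomial on the cube, replace the latter by its harmonic
    extension from the sphere, and conclude by the maximum principle. *)
Lemma harmonic_pol_approximation f (r e : R) : (0 < q)%N -> harmonic_fun f ->
  0 < r -> 0 < e -> exists2 u, harmonic_pol u &
    forall x, sqnorm x <= r ^+ 2 -> `|f x - u x| <= e.
Proof.
move=> q0 [C2f lf] r0 e0; have cf : continuous f by case: C2f.
have [p pp Hp] := weierstrass_approximation cf r0 e0.
have [u [s [pu ps lu E]]] := extendable_pol (r ^+ 2) q0 pp.
exists u => // x xr.
have Eu y : sqnorm y = r ^+ 2 -> u y = p y.
  by move=> yr; rewrite E yr subrr mul0r addr0.
have Hpu y : sqnorm y = r ^+ 2 -> `|f y - u y| <= e.
  move=> yr; rewrite Eu //; apply: Hp; apply/cubeP => i.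
  apply: le_trans (coord_le_norm y i) _.
  by apply: norm_le_sqnorm; [exact: ltW|rewrite yr].
rewrite ler_norml; apply/andP; split.
  have [C2g lg] := @class_C2_affine (-1) f u C2f pu.
  have := @maximum_principle R q _ (r ^+ 2) e q0 C2g _ _ x xr.
  rewrite mulN1r lerNl opprB addrC; apply => [y|y /Hpu].
    by rewrite lg lf lu mulr0 addr0.
  by rewrite ler_norml mulN1r => /andP[+ _]; rewrite lerNl opprB addrC.
have [C2g lg] := @class_C2_affine 1 f (fun x => -1 * u x) C2f (polZ _ pu).
have := @maximum_principle R q _ (r ^+ 2) e q0 C2g _ _ x xr.
rewrite mul1r mulN1r; apply => [y|y /Hpu].
  by rewrite lg lf laplacianZ // lu !mulr0 addr0.
by rewrite ler_norml mul1r mulN1r => /andP[].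
Qed.

Lemma pizzetti_stable N1 N rho f : (forall m, (N1 <= m)%N -> iter m laplacian f = (fun=> 0)) ->
  (N1 <= N)%N -> pizzetti N rho f = pizzetti N1 rho f.
Proof.
move=> H N1N; rewrite /pizzetti -(subnKC N1N) big_split_ord /= [X in _ + X]big1 ?addr0 //.
by move=> m _; rewrite H ?mulr0 // leq_addr.
Qed.

(** The sum is the Pizzetti functional of [sum_j u_j^2]: its coefficients are
    nonnegative because the [u_j] are harmonic, and it lies between [lo] and [hi]
    by positivity. *)
Lemma energy_profile m (u : 'I_m -> V -> R) : (0 < q)%N -> (forall j, harmonic_pol (u j)) ->
  exists n (a : nat -> R), (forall k, 0 <= a k) /\
    forall (rho lo hi : R), 0 <= rho ->
      (forall x, sqnorm x = rho -> lo <= \sum_j u j x ^+ 2 <= hi) ->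
      lo <= \sum_(k < n) a k * rho ^+ k <= hi.
Proof.
move=> q0 hu; pose p x := \sum_j u j x ^+ 2.
have pu j : poly_fun (u j) by case: (hu j).
have pp : poly_fun p by apply: pol_sum => j _; exact: pol_exp.
have [N1 HN1] := pol_nilpotent pp.
exists N1, (fun k => pizzetti_coef (R := R) (q := q) k * iter k laplacian p 0); split.
  move=> k; apply: mulr_ge0; first exact/ltW/pizzetti_coef_gt0.
  rewrite /p; under eq_fun do under eq_bigr do rewrite expr2.
  rewrite iter_laplacian_sum; last by move=> j _; exact: polM.
  by apply: sumr_ge0 => j _; apply: iter_laplacian_sqr_ge0 => //; case: (hu j).
move=> rho lo hi rho0 H.
have -> : \sum_(k < N1) pizzetti_coef (R := R) (q := q) k * iter k laplacian p 0 * rho ^+ k =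
    pizzetti N1 rho p.
  by apply: eq_bigr => k _; rewrite mulrAC.
have pc c : poly_fun (fun x : V => c) := pol_cst c.
have Hlo x : sqnorm x = rho -> 0 <= p x + - lo.
  by move=> /H /andP[+ _]; rewrite subr_ge0.
have Hhi x : sqnorm x = rho -> 0 <= hi + -1 * p x.
  by move=> /H /andP[_]; rewrite mulN1r subr_ge0.
have [N2 H2] := pizzetti_ge0 q0 (polD pp (pc _)) Hlo rho0.
have [N3 H3] := pizzetti_ge0 q0 (polD (pc _) (polZ _ pp)) Hhi rho0.
pose N := (maxn N1 (maxn N2 N3)).+1.
have NN1 : (N1 <= N)%N by rewrite /N; lia.
have := H2 N; have := H3 N.
rewrite (pizzettiD _ _ pp (pc _)) (pizzettiD _ _ (pc _) (polZ _ pp)) pizzettiZ //.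
have pizz_cst d : pizzetti N rho (fun=> d : R) = d.
  by rewrite /N pizzetti_harmonic // laplacian_cst.
rewrite !pizz_cst (pizzetti_stable _ HN1 NN1).
rewrite mulN1r !subr_ge0 => H3' H2'.
by apply/andP; split; [apply: H2'|apply: H3']; rewrite /N; lia.
Qed.

(** On the ball of radius [r] the map [h] is replaced by a harmonic polynomial map;
    since [|h|] is bounded below, an absolute error does not change the order of
    magnitude. *)
Lemma approximable_profile (w : R -> R) m (h : V -> 'rV[R]_m) (C1 C2 r : R) :
  (0 < q)%N -> weight w -> (0 < m)%N -> harmonic_map h -> 0 < C1 -> 0 < C2 ->
  (forall y, C1 * euclid (h y) <= w (euclid y) /\ w (euclid y) <= C2 * euclid (h y)) ->
  0 < r ->
  exists n (a : nat -> R), (forall k, 0 <= a k) /\ forall t, 0 < t -> t <= r ->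
    w t ^+ 2 / (4 * C2 ^+ 2) <= \sum_(k < n) a k * (t ^+ 2) ^+ k <= 3 * w t ^+ 2 / C1 ^+ 2.
Proof.
move=> q0 [w0 wm _ _] m0 hh C10 C20 hw r0.
have w00 : 0 < w 0 by exact: w0.
have m0' : 0 < m%:R :> R by rewrite ltr0n.
(* With this error, [m * e^2] is at most a quarter of [|h|^2] everywhere. *)
pose e := w 0 / (2 * C2 * m%:R).
have e0 : 0 < e by rewrite divr_gt0 // !mulr_gt0.
have /choice[u Hu] j : exists u, harmonic_pol u /\
    forall x, sqnorm x <= r ^+ 2 -> `|h x ord0 j - u x| <= e.
  by have [u ? ?] := harmonic_pol_approximation q0 (hh j) r0 e0; exists u.
have [n [a [a0 Ha]]] := energy_profile q0 (fun j => (Hu j).1).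
exists n, a; split => // t t0 tr; apply: Ha => [|x xt]; first exact: sqr_ge0.
have et : euclid x = t by rewrite /euclid -/(sqnorm x) xt sqrtr_sqr gtr0_norm.
have xr : sqnorm x <= r ^+ 2.
  by rewrite xt; apply: lerXn2r => //; rewrite nnegrE; exact: ltW.
have [hw1 hw2] := hw x; rewrite et in hw1 hw2.
pose S := \sum_j h x ord0 j ^+ 2.
have ES : euclid (h x) ^+ 2 = S by rewrite sqr_sqrtr // sqnorm_ge0.
have wt0 : 0 < w t by apply: w0; exact: ltW.
have eh0 : 0 <= euclid (h x) := euclid_ge0 _.
have S1 : C1 ^+ 2 * S <= w t ^+ 2.
  rewrite -ES -exprMn; apply: lerXn2r => //; rewrite nnegrE; last exact: ltW.
  by rewrite mulr_ge0 // ltW.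
have S2 : w t ^+ 2 <= C2 ^+ 2 * S.
  rewrite -ES -exprMn; apply: lerXn2r => //; rewrite nnegrE; first exact: ltW.
  by rewrite mulr_ge0 // ltW.
have me : 4 * (m%:R * e ^+ 2) <= S.
  have H1 : w 0 ^+ 2 <= C2 ^+ 2 * S.
    apply: le_trans S2; apply: lerXn2r; [exact: ltW|exact: ltW|].
    by apply: wm => //; exact: ltW.
  rewrite -(ler_pM2l (exprn_gt0 2 C20)); apply: le_trans H1.
  have -> : C2 ^+ 2 * (4 * (m%:R * e ^+ 2)) = w 0 ^+ 2 / m%:R.
    rewrite /e; move: (m%:R) m0' (w 0) => M M0 W.
    by field; rewrite !gt_eqF.
  rewrite ler_pdivrMr // ler_peMr ?sqr_ge0 //.
  by rewrite ler1n.
pose P := \sum_j u j x ^+ 2.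
have esum : \sum_(j < m) 2 * e ^+ 2 = 2 * (m%:R * e ^+ 2).
  by rewrite sumr_const card_ord -[(2 * _) *+ _]mulr_natl mulrCA.
have cmp j : `|h x ord0 j - u j x| <= e by apply: (Hu j).2.
have sqd (b c : R) : `|b - c| <= e -> b ^+ 2 <= 2 * c ^+ 2 + 2 * e ^+ 2.
  move=> H; have : (b - c) ^+ 2 <= e ^+ 2.
    rewrite -[(b - c) ^+ 2]real_normK ?num_real //.
    by apply: lerXn2r => //; rewrite nnegrE // ltW.
  by have := sqr_ge0 (b - 2 * c); rewrite !expr2; nra.
have SP : S <= 2 * P + 2 * (m%:R * e ^+ 2).
  rewrite -esum mulr_sumr -big_split; apply: ler_sum => j _; exact: sqd.
have PS : P <= 2 * S + 2 * (m%:R * e ^+ 2).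
  rewrite -esum mulr_sumr -big_split; apply: ler_sum => j _.
  by apply: sqd; rewrite distrC.
rewrite -/P; apply/andP; split.
  rewrite ler_pdivrMr ?mulr_gt0 ?exprn_gt0 //.
  apply: le_trans S2 _; rewrite mulrCA mulrA mulrC ler_pM2r ?exprn_gt0 //.
  by lra.
rewrite ler_pdivlMr ?exprn_gt0 // mulrC.
apply: (@le_trans _ _ (C1 ^+ 2 * (3 * S))); first by rewrite ler_pM2l ?exprn_gt0 //; lra.
by rewrite mulrCA ler_pM2l.
Qed.

(** The polynomial profile on [(0, rho]] provides an index [j] valid for [t] up to
    [rho].  The index stays bounded as [rho] grows, as the choice [t = 2 r] shows,
    so one index serves for arbitrarily large [rho]. *)
Lemma approximable_tangent (w : R -> R) : (0 < q)%N -> weight w ->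
  harmonic_approximable q w ->
  exists2 c : R, 0 < c & forall r, 0 < r -> exists j : nat,
    forall t, 0 < t -> c * w r * t ^+ j <= w t * r ^+ j.
Proof.
move=> q0 ww [m [m0 [h [hh [C1 [C2 [C10 C20 hw]]]]]]].
have hw' y := hw y I; have [w0 wm _ _] := ww.
exists (C1 / (5 * C2)); first by rewrite divr_gt0 // mulr_gt0.
set c := C1 / (5 * C2); have c0 : 0 < c by rewrite divr_gt0 // mulr_gt0.
move=> r r0.
pose P j (rho : R) := forall t, 0 < t -> t <= rho -> c * w r * t ^+ j <= w t * r ^+ j.
have wr : 0 < w r by apply: w0; exact: ltW.
have exP rho : r <= rho -> exists j, P j rho.
  move=> rrho; have rho0 := lt_le_trans r0 rrho.
  have [n [a [a0 Ha]]] := approximable_profile q0 ww m0 hh C10 C20 hw' rho0.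
  have /andP[lo hi] := Ha r r0 rrho.
  have lo0 : 0 < w r ^+ 2 / (4 * C2 ^+ 2).
    by rewrite divr_gt0 ?exprn_gt0 // mulr_gt0 // exprn_gt0.
  have [|j _ Hj] := @median_index R a n (r ^+ 2) a0 (exprn_gt0 2 r0).
    exact: lt_le_trans lo.
  exists j => t t0 trho; have := Hj _ (exprn_gt0 2 t0).
  have /andP[_ hit] := Ha t t0 trho.
  have wt : 0 < w t by apply: w0; exact: ltW.
  rewrite [(t ^+ 2) ^+ j]exprAC [(r ^+ 2) ^+ j]exprAC.
  move: lo hit (exprn_gt0 j t0) (exprn_gt0 j r0).
  move: (t ^+ j) (r ^+ j) (\sum_(k < n) _) (\sum_(k < n) _) => tj rj Ft Fr lo' hit tj0 rj0 HF.
  have H1 : w r ^+ 2 / (4 * C2 ^+ 2) * tj ^+ 2 <= 2 * (3 * w t ^+ 2 / C1 ^+ 2) * rj ^+ 2.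
    apply: (@le_trans _ _ (Fr * tj ^+ 2)); first by rewrite ler_pM2r // exprn_gt0.
    apply: le_trans HF _; rewrite ler_pM2r ?exprn_gt0 // ler_pM2l //.
  rewrite -(@ler_pXn2r _ 2) ?nnegrE //; first last.
  - by apply: mulr_ge0; exact: ltW.
  - by apply: mulr_ge0; [apply: mulr_ge0|]; exact: ltW.
  have H2 : C1 ^+ 2 * (w r ^+ 2 / (4 * C2 ^+ 2) * tj ^+ 2) <=
            C1 ^+ 2 * (2 * (3 * w t ^+ 2 / C1 ^+ 2) * rj ^+ 2).
    by rewrite ler_pM2l // exprn_gt0.
  have E1 : C1 ^+ 2 * (w r ^+ 2 / (4 * C2 ^+ 2) * tj ^+ 2) = 25 / 4 * (c * w r * tj) ^+ 2.
    by rewrite /c; move: (w r) => W; field; rewrite gt_eqF.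
  have E2 : C1 ^+ 2 * (2 * (3 * w t ^+ 2 / C1 ^+ 2) * rj ^+ 2) = 6 * (w t * rj) ^+ 2.
    by move: (w t) => W; field; rewrite gt_eqF.
  move: H2; rewrite E1 E2; have := sqr_ge0 (w t * rj); lra.
have [J HJ] := @exists_exp2_gt R (w (2 * r) / (c * w r)).
have bounded j rho : 2 * r <= rho -> P j rho -> (j <= J)%N.
  move=> rrho /(_ (2 * r)) /(_ (mulr_gt0 (ltr0n R 2) r0) rrho).
  rewrite exprMn [X in X <= _ -> _]mulrA (ler_pM2r (exprn_gt0 j r0)) => H.
  rewrite leqNgt; apply/negP => Jj; move: HJ; rewrite (ltr_pdivrMr _ _ (mulr_gt0 c0 wr)) ltNge.
  move=> /negP; apply; rewrite [leLHS]mulrC; apply: le_trans H.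
  by rewrite (ler_pM2l (mulr_gt0 c0 wr)) ler_eXn2l ?ltr1n // ltnW.
(* Otherwise each index fails before some bound, and past the largest of the
   bounds of the finitely many possible indices no index is left. *)
apply: contrapT => noj.
have /choice[k Hk] j : exists k : nat, ~ P j (2 * r + k%:R).
  have /existsNP[t /not_implyP[t0 nle]] :
      ~ forall t, 0 < t -> c * w r * t ^+ j <= w t * r ^+ j.
    by move=> Hj; apply: noj; exists j.
  exists (Num.bound t) => HP; apply: nle; apply: HP => //.
  apply: (@le_trans _ _ (Num.bound t)%:R); first by apply/ltW/archi_boundP/ltW.
  by rewrite lerDr mulr_ge0 // ltW.
pose K := \max_(j < J.+1) k j.
have rK (n : nat) : r <= 2 * r + n%:R.
  by rewrite mulrDl mul1r -addrA lerDl addr_ge0 // ltW.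
have [j Pj] := exP _ (rK K).
have jJ : (j < J.+1)%N by rewrite ltnS; apply: bounded Pj; rewrite lerDl.
apply: (Hk j) => t t0 tk; apply: Pj => //; apply: le_trans tk _.
by rewrite lerD2l ler_nat; exact: (leq_bigmax (Ordinal jJ)).
Qed.

End HarmonicApproximation.

Section TropicalHull.
Context {R : realType}.
Variables (w : R -> R) (B : nat -> R) (c : R).
Hypothesis ww : weight w.
Hypothesis c0 : 0 < c.
Hypothesis B0 : forall j, 0 <= B j.
Hypothesis Bw : forall r j, 0 < r -> B j * r ^+ j <= w r.
Hypothesis wB : forall r, 0 < r -> exists j, c * w r <= B j * r ^+ j.

Let w0 t : 0 <= t -> 0 < w t. Proof. by case: ww => + _ _ _; apply. Qed.

Let wm s t : 0 <= s -> s <= t -> w s <= w t. Proof. by case: ww => _ + _ _; apply. Qed.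

(** At [r = 0] the convention [0 ^+ 0 = 1] makes this the constant term. *)
Definition monomial_sup (r : R) := sup (range (fun j => B j * r ^+ j)).

Lemma monomials_have_sup r : 0 <= r -> has_sup (range (fun j => B j * r ^+ j)).
Proof.
move=> r0; split; first by exists (B 0%N * r ^+ 0), 0%N.
exists (w (r + 1)) => _ [j _ <-].
apply: le_trans (Bw j (_ : 0 < r + 1)); last by rewrite ltr_wpDl.
by rewrite ler_wpM2l //; apply: lerXn2r; rewrite ?nnegrE ?lerDl ?addr_ge0.
Qed.

Lemma monomial_le_sup r j : 0 <= r -> B j * r ^+ j <= monomial_sup r.
Proof.
move=> r0; apply: sup_upper_bound; first exact: monomials_have_sup.
by exists j.
Qed.

Lemma monomial_sup_le r d : 0 <= r -> (forall j, B j * r ^+ j <= d) -> monomial_sup r <= d.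
Proof.
move=> r0 H; apply: ge_sup; first by case: (monomials_have_sup r0).
by move=> _ [j _ <-].
Qed.

(** Near 0 the monomials of positive degree are too small to bound [w] from below. *)
Lemma constant_term_ge : c * w 0 <= B 0%N.
Proof.
have w00 := w0 (lexx 0); have w1 := w0 (@ler01 R).
pose r := Num.min 1 (c * w 0 / (2 * w 1)).
have r0 : 0 < r by rewrite lt_min ltr01 divr_gt0 // mulr_gt0.
have r1 : r <= 1 by rewrite ge_min lexx.
have rc : r * (2 * w 1) <= c * w 0.
  by rewrite -ler_pdivlMr ?mulr_gt0 // ge_min lexx orbT.
have [[|j]] := wB r0.
  rewrite expr0 mulr1; apply: le_trans; rewrite ler_pM2l //; apply: wm => //; exact: ltW.
move=> H; exfalso.
have H1 : c * w 0 <= c * w r by rewrite ler_pM2l //; apply: wm => //; exact: ltW.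
have H2 : B j.+1 * r ^+ j.+1 <= w 1 * r.
  apply: (@le_trans _ _ (B j.+1 * r)).
    by rewrite ler_wpM2l // exprS ler_piMr ?(ltW r0) // exprn_ile1 // ltW.
  by rewrite ler_pM2r //; have := Bw j.+1 ltr01; rewrite expr1n mulr1.
have H3 : 0 < w 1 * r by rewrite mulr_gt0.
by move: rc H H1 H2 H3; rewrite mulrCA [r * _]mulrC; lra.
Qed.

(** By convexity of the power the slope of the chord over [[s, t]] is at most that of
    a chord that ends at [2 * rho]. *)
Lemma exprn_chord (s t rho : R) j : 0 <= s -> s <= t -> t <= rho ->
  (t ^+ j - s ^+ j) * rho <= (t - s) * (2 * rho) ^+ j.
Proof.
move=> s0 st tr; have t0 := le_trans s0 st; have rho0 := le_trans t0 tr.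
elim: j => [|j IH]; first by rewrite !expr0 subrr mul0r mulr1 subr_ge0.
have -> : t ^+ j.+1 - s ^+ j.+1 = t * (t ^+ j - s ^+ j) + s ^+ j * (t - s).
  by rewrite !exprS; ring.
have ts : 0 <= t - s by rewrite subr_ge0.
have H1 : t * ((t ^+ j - s ^+ j) * rho) <= rho * ((t - s) * (2 * rho) ^+ j).
  apply: ler_pM => //; rewrite mulr_ge0 // subr_ge0.
  by apply: lerXn2r; rewrite ?nnegrE.
have H2 : s ^+ j * (t - s) * rho <= (2 * rho) ^+ j * (t - s) * rho.
  do 2!rewrite ler_wpM2r //; apply: lerXn2r; rewrite ?nnegrE ?mulr_ge0 //.
  by have := le_trans st tr; lra.
move: H1 H2; rewrite exprS; move: ((2 * rho) ^+ j) (s ^+ j) (t ^+ j) => a b d; lra.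
Qed.

Lemma monomial_sup_lipschitz (s t rho : R) : 0 <= s -> s <= t -> t <= rho -> 0 < rho ->
  monomial_sup t <= monomial_sup s + (t - s) * (monomial_sup (2 * rho) / rho).
Proof.
move=> s0 st tr rho0; have t0 := le_trans s0 st.
apply: monomial_sup_le => // j.
have H1 := monomial_le_sup j s0.
have rho2 : 0 <= 2 * rho by rewrite mulr_ge0 // ltW.
have H2 := monomial_le_sup j rho2.
have H3 : B j * ((t ^+ j - s ^+ j) * rho) <= (t - s) * monomial_sup (2 * rho).
  apply: (@le_trans _ _ (B j * ((t - s) * (2 * rho) ^+ j))).
    by rewrite ler_wpM2l // exprn_chord.
  by rewrite mulrCA ler_wpM2l // subr_ge0.
have H4 : B j * (t ^+ j - s ^+ j) <= (t - s) * (monomial_sup (2 * rho) / rho).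
  by rewrite mulrA ler_pdivlMr // -mulrA.
by move: H1 H4; rewrite mulrBr; lra.
Qed.

Lemma monomial_sup_mono s t : 0 <= s -> s <= t -> monomial_sup s <= monomial_sup t.
Proof.
move=> s0 st; apply: monomial_sup_le => // j; have t0 := le_trans s0 st.
apply: le_trans (monomial_le_sup j t0); rewrite ler_wpM2l //.
by apply: lerXn2r; rewrite ?nnegrE.
Qed.

Lemma constant_term_gt0 : 0 < B 0%N.
Proof. by apply: lt_le_trans constant_term_ge; rewrite mulr_gt0 // w0. Qed.

Lemma monomial_sup_gt0 t : 0 <= t -> 0 < monomial_sup t.
Proof.
move=> t0; apply: lt_le_trans constant_term_gt0 _.
by have := monomial_le_sup 0 t0; rewrite expr0 mulr1.
Qed.

Lemma monomial_sup_continuous : {within `[0, +oo[, continuous monomial_sup}.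
Proof.
apply/subspace_continuousP => x; rewrite /= in_itv /= andbT => x0.
apply/cvgrPdist_le => e e0.
pose K := monomial_sup (2 * (x + 1)) / (x + 1).
have x1 : 0 < x + 1 by rewrite ltr_wpDl.
have K0 : 0 < K.
  by rewrite divr_gt0 // monomial_sup_gt0 // mulr_ge0 // ltW.
exists (Num.min 1 (e / K)) => /=; first by rewrite lt_min ltr01 divr_gt0.
move=> t /=; rewrite lt_min => /andP[xt1 xte]; rewrite in_itv /= andbT => t0.
have tx1 : t <= x + 1.
  by rewrite -lerBlDl; apply: le_trans (ler_norm _) _; rewrite distrC ltW.
have xteK : `|x - t| * K <= e by rewrite -ler_pdivlMr // ltW.
case: (leP x t) => xt.
  have := monomial_sup_lipschitz x0 xt tx1 x1; have := monomial_sup_mono x0 xt.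
  rewrite -/K distrC => H1 H2; rewrite ger0_norm ?subr_ge0 //.
  move: xteK; rewrite distrC ger0_norm ?subr_ge0 //.
  by move: H2; rewrite -lerBlDl => /le_trans H2 /H2.
have xx1 : x <= x + 1 by rewrite lerDl.
have := monomial_sup_lipschitz t0 (ltW xt) xx1 x1; have := monomial_sup_mono t0 (ltW xt).
rewrite -/K => H1 H2; rewrite ger0_norm ?subr_ge0 //.
move: xteK; rewrite ger0_norm ?subr_ge0 ?(ltW xt) //.
by move: H2; rewrite -lerBlDl => /le_trans H2 /H2.
Qed.

Lemma weight_le_sup t : 0 <= t -> c * w t <= monomial_sup t.
Proof.
rewrite le_eqVlt => /predU1P[<-|t0].
  apply: le_trans constant_term_ge _.
  by have := monomial_le_sup 0 (lexx 0); rewrite expr0 mulr1.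
by have [j Hj] := wB t0; apply: le_trans Hj (monomial_le_sup j (ltW t0)).
Qed.

Lemma monomial_sup_weight : weight monomial_sup.
Proof.
split; [exact: monomial_sup_gt0|exact: monomial_sup_mono|exact: monomial_sup_continuous|].
move=> M; have [_ _ _ /(_ (M / c))[t t0 Ht]] := ww; exists t => //.
by apply: lt_le_trans (weight_le_sup t0); rewrite mulrC -ltr_pdivrMr.
Qed.

Lemma monomial_sup_log_tropical : log_tropical monomial_sup.
Proof.
exists [set j | 0 < B j], (fun j => ln (B j)) => x S.
have r0 := expR_gt0 x; have v0 := monomial_sup_gt0 (ltW r0).
have term j : 0 < B j -> ln (B j) + j%:R * x = ln (B j * expR x ^+ j).
  by move=> Bj; rewrite lnM ?posrE ?exprn_gt0 // -expRM_natl expRK.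
have hS : has_sup S.
  split; first by exists (ln (B 0%N) + 0%:R * x), 0%N => //; exact: constant_term_gt0.
  exists (ln (monomial_sup (expR x))) => _ [j /= Bj <-].
  rewrite term // ler_ln ?posrE ?mulr_gt0 ?exprn_gt0 //.
  exact: monomial_le_sup (ltW r0).
split => //; apply/eqP; rewrite eq_le; apply/andP; split; last first.
  apply: ge_sup; first by case: hS.
  move=> _ [j /= Bj <-]; rewrite term // ler_ln ?posrE ?mulr_gt0 ?exprn_gt0 //.
  exact: monomial_le_sup (ltW r0).
rewrite -ler_expR lnK ?posrE //; apply: monomial_sup_le; first exact: ltW.
move=> j; have [Bj|Bj] := ltP 0 (B j); last first.
  by apply: le_trans (expR_ge0 _); rewrite mulr_le0_ge0 // exprn_ge0 // ltW.
rewrite -[leLHS]lnK ?posrE ?mulr_gt0 ?exprn_gt0 // ler_expR -term //.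
by apply: sup_upper_bound => //; exists j.
Qed.

Lemma monomial_sup_equivalent : equivalent `[0, +oo[ w monomial_sup.
Proof.
have w00 := w0 (lexx 0); have w1 := w0 (@ler01 R).
exists c, (1 + w 1 / w 0); split => //.
  by rewrite ltr_pwDl // divr_ge0 // ltW.
move=> t; rewrite /= in_itv /= andbT => t0; split; first exact: weight_le_sup.
apply: monomial_sup_le => // j; rewrite mulrDl mul1r.
move: t0; rewrite le_eqVlt => /predU1P[<-|t0]; last first.
  apply: le_trans (Bw j t0) _; rewrite lerDl mulr_ge0 ?divr_ge0 // ltW // w0 //; exact: ltW.
rewrite divfK ?gt_eqF //; apply: (@le_trans _ _ (w 1)); last by rewrite lerDr ltW.
apply: le_trans (Bw j ltr01); rewrite expr1n ler_wpM2l //.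
by rewrite exprn_ile1.
Qed.

End TropicalHull.

Lemma approximable_log_tropical (R : realType) (q : nat) (w : R -> R) :
  (0 < q)%N -> weight w -> harmonic_approximable q w -> equivalent_to_log_tropical w.
Proof.
move=> q0 ww aw; have [c c0 Hc] := approximable_tangent q0 ww aw.
have w0 t : 0 < t -> 0 < w t by move=> t0; case: ww => + _ _ _; apply; exact: ltW.
have [|B [B0 _ Bw wB]] := @monomial_hull R predT w c c0 w0.
  by move=> r /Hc[j Hj]; exists j.
have wB' r : 0 < r -> exists j, c * w r <= B j * r ^+ j.
  by move=> /wB[j _ Hj]; exists j.
exists (monomial_sup B); split.
- exact: (monomial_sup_weight ww c0 B0 Bw wB').
- exact: (monomial_sup_log_tropical ww c0 B0 Bw wB').
- exact: (monomial_sup_equivalent ww c0 B0 Bw wB').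
Qed.

Theorem proposition10 (R : realType) (q : nat) (w : R -> R) :
  (2 <= q)%N -> weight w ->
  (harmonic_approximable q w -> equivalent_to_log_tropical w) /\
  (~~ odd q -> (harmonic_approximable q w <-> equivalent_to_log_tropical w)).
Proof.
move=> q2 ww; have q0 : (0 < q)%N := ltnW q2.
have direct := approximable_log_tropical q0 ww.
split=> // qe; split => // -[v [wv tv ev]].
exact: tropical_approximable ev.
Qed.
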